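(* Let $\alpha_0=1.48\ldots$ denote the unique positive solution of the equation $\alpha\zeta(1+\alpha)=2$. Suppose that $\varphi\in\mathscr{G}$ has $c_0=0$ and that $0<\operatorname{Re}(c_1)-1/2\leq\alpha_0$. Then \[\|\mathscr{C}_\varphi\|\leq\sqrt{\frac{2}{\operatorname{Re}(c_1)-1/2}}.\] Moreover, for every value of $\operatorname{Re}(c_1)-1/2$ in $(0,\alpha_0]$ there are $\varphi\in\mathscr{G}$ (with $c_0=0$ and this value of $\operatorname{Re}(c_1)-1/2$) for which equality holds in this inequality.
   Context: $\zeta(s)=\sum_{n\geq1}n^{-s}$ is the Riemann zeta function. For real $\theta$, $\mathbb{C}_\theta=\{s\in\mathbb{C}:\operatorname{Re}(s)>\theta\}$. $\mathscr{H}^2$ is the Hilbert space of Dirichlet series $f(s)=\sum_{n\geq1}a_n n^{-s}$ with $\|f\|_{\mathscr{H}^2}:=\left(\sum_{n\geq1}|a_n|^2\right)^{1/2}<\infty$; such series converge absolutely in $\mathbb{C}_{1/2}$. The Gordon--Hedenmalm class $\mathscr{G}$ consists of symbols of the form $\varphi(s)=c_0 s+\sum_{n=1}^\infty c_n n^{-s}=:c_0 s+\varphi_0(s)$, where $c_0$ is a non-negative integer, the Dirichlet series $\varphi_0$ converges uniformly in $\mathbb{C}_\varepsilon$ for every $\varepsilon>0$, and: (a) if $c_0=0$, then $\varphi_0(\mathbb{C}_0)\subset\mathbb{C}_{1/2}$; (b) if $c_0\geq1$, then $\varphi_0\equiv0$ or $\varphi_0(\mathbb{C}_0)\subset\mathbb{C}_0$.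 The numbers $c_0,c_1$ in the claim are these coefficients of $\varphi$. For $\varphi\in\mathscr{G}$, the composition operator $\mathscr{C}_\varphi f=f\circ\varphi$ maps $\mathscr{H}^2$ boundedly into $\mathscr{H}^2$ (theorem of Gordon and Hedenmalm), and $\|\mathscr{C}_\varphi\|$ is its operator norm on $\mathscr{H}^2$. *)

(* Defs.v *)
(* Stdlib reals with Coquelicot. *)
From Stdlib Require Export Reals.
From Coquelicot Require Export Coquelicot.

Open Scope R_scope.

Definition Cexp (z : C) : C := (exp (Re z) * cos (Im z), exp (Re z) * sin (Im z)).

(* [npow n s] is n^(-s), for n >= 1. *)
Definition npow (n : nat) (s : C) : C := Cexp (- (s * RtoC (ln (INR n))))%C.

(* A Dirichlet series sum_{n >= 1} a_n n^(-s) is given by a coefficient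
   sequence [a : nat -> C]; the entry [a 0] is never used. *)
Definition dterm (a : nat -> C) (s : C) (k : nat) : C := (a (S k) * npow (S k) s)%C.

(* Coquelicot's [Series] is real-valued, so the sum is taken componentwise;
   this is the sum of the complex series whenever that series converges. *)
Definition dsum (a : nat -> C) (s : C) : C :=
  (Series (fun k => Re (dterm a s k)), Series (fun k => Im (dterm a s k))).

Definition zeta (s : C) : C := dsum (fun _ => RtoC 1) s.

Definition in_H2 (a : nat -> C) : Prop :=
  ex_series (fun k => (Cmod (a (S k))) ^ 2).

Definition H2norm (a : nat -> C) : R :=
  sqrt (Series (fun k => (Cmod (a (S k))) ^ 2)).

Definition halfplane (theta : R) (s : C) : Prop := theta < Re s.

Definition dirichlet_cvu (c : nat -> C) (theta : R) : Prop :=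
  forall eta : R, 0 < eta -> exists N : nat, forall n : nat, (N <= n)%nat ->
  forall s : C, halfplane theta s ->
    Cmod (sum_n (dterm c s) n - dsum c s)%C < eta.

(* The symbol c_0 s + sum_{n >= 1} c_n n^(-s): the integer c_0 is kept apart
   from the sequence [c], whose entries [c 1], [c 2], ... are c_1, c_2, ... *)
Definition symbol (c0 : nat) (c : nat -> C) (s : C) : C :=
  (RtoC (INR c0) * s + dsum c s)%C.

Definition in_G (c0 : nat) (c : nat -> C) : Prop :=
  (forall eps : R, 0 < eps -> dirichlet_cvu c eps) /\
  (c0 = 0%nat ->
     forall s : C, halfplane 0 s -> halfplane (1/2) (dsum c s)) /\
  ((1 <= c0)%nat ->
     (forall s : C, halfplane 0 s -> dsum c s = RtoC 0) \/
     (forall s : C, halfplane 0 s -> halfplane 0 (dsum c s))).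

(* [b] is the coefficient sequence of an element of H^2 equal to f o phi, f
   being the series with coefficients [a]; elements of H^2 are functions on
   the half-plane Re s > 1/2. *)
Definition is_comp (phi : C -> C) (a b : nat -> C) : Prop :=
  in_H2 b /\ forall s : C, halfplane (1/2) s -> dsum b s = dsum a (phi s).

Definition comp_bound (phi : C -> C) (K : R) : Prop :=
  0 <= K /\
  forall a : nat -> C, in_H2 a ->
    exists b : nat -> C, is_comp phi a b /\ H2norm b <= K * H2norm a.

(* The operator norm on H^2 of f |-> f o phi; it is [p_infty] unless f o phi
   belongs to H^2 for every f in H^2 and the operator is bounded. *)
Definition comp_norm (phi : C -> C) : Rbar := Glb_Rbar (comp_bound phi).

(* Main.v *)
Require Import Defs.
From Stdlib Require Import Reals Lra Lia List ZArith Ranalysis5 IndefiniteDescription.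
From Coquelicot Require Import Coquelicot.
Open Scope R_scope.

(** Write [al = Re c_1 - 1/2]. For a Dirichlet polynomial [f], [|f|^2] is dominated on [Re w > 1/2] by the
    real part of an explicit analytic [G], the harmonic extension of its boundary values; the difference
    is a sum of squares because [min(m^(2x), n^(2x))] is a positive kernel. Since [G o phi] is again
    a uniform limit of Dirichlet polynomials, its mean value on a vertical line is its constant term
    [G(c_1)], and Parseval gives [||f o phi||^2 <= Re G(c_1)]. This is a quadratic form in the coefficients
    of [f] of Hilbert type, with kernel [(mn)^(al-1/2) / max(m,n)^(2 al)], and the Schur test with weights
    [n^(-1/2)] bounds it by [2/al]: the row [m = 1] of the test is exactly [zeta(1+al) <= 2/al], that is
    [al <= alpha_0], and the other rows leave room. Polynomials are then exchanged for all of [H^2] by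
    completeness.

    For sharpness take [phi = 1/2 + al (1 - z)/(1 + z)] with [z = 2^(-s)]. Reproducing kernels at real [s > 0]
    give [||C_phi||^2 >= (1 - z^2) zeta(2 phi)], and [zeta(1 + t) >= 1/t] makes the right-hand side tend to
    [2/al] as [z] tends to [1]. *)

(** * Dirichlet polynomials and their uniform limits *)

(** No complex analysis enters: a function is known only through uniform approximation by Dirichlet
    polynomials on [Re s >= sig], for every [sig > 0]. This class is closed under sums, products and
    exponentials, which is why the majorant is needed as an explicit finite expression in
    exponentials of the symbol. Convergence is the obstacle. Square summable coefficients can in
    general be summed only for [Re s > 1/2], whereas the extremal symbol has to be tested at [s]
    tending to 0. Approximants therefore carry a multiplicative set [T] of frequencies: all integers
    for the upper bound, the powers of 2 for the extremal symbol, where Cauchy-Schwarz gives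
    convergence on all of [Re s > 0]. In the Schur test with [al > 1], sums and integrals differ at
    order [1/m] in each half of a row. These errors cancel, so the comparison must be sharp to
    second order (midpoint and trapezoidal rules), and the bound [alpha_0 < 1.49] supplies its
    numerical constants. *)

Fixpoint csum (f : nat -> C) (n : nat) : C :=
  match n with O => RtoC 0 | S n => (csum f n + f n)%C end.
Fixpoint rsum (f : nat -> R) (n : nat) : R :=
  match n with O => 0 | S n => rsum f n + f n end.

Lemma sum_n_csum f n : sum_n f n = csum f (S n).
Proof.
induction n as [|n IH].
- rewrite sum_O. simpl. symmetry; apply (plus_zero_l (f 0%nat : C)).
- rewrite sum_Sn, IH. reflexivity.
Qed.

Lemma sum_n_rsum f n : sum_n f n = rsum f (S n).
Proof.
induction n as [|n IH].
- rewrite sum_O. simpl. symmetry; apply Rplus_0_l.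
- rewrite sum_Sn, IH. reflexivity.
Qed.

Lemma csum_ext f g n : (forall k, (k < n)%nat -> f k = g k) -> csum f n = csum g n.
Proof.
induction n as [|n IH]; intros H; simpl; auto.
rewrite IH, H; auto.
Qed.

Lemma rsum_ext f g n : (forall k, (k < n)%nat -> f k = g k) -> rsum f n = rsum g n.
Proof.
induction n as [|n IH]; intros H; simpl; auto.
rewrite IH, H; auto.
Qed.

Lemma csum_plus f g n : csum (fun k => f k + g k)%C n = (csum f n + csum g n)%C.
Proof. induction n as [|n IH]; simpl; [ring|rewrite IH; ring]. Qed.

Lemma rsum_plus f g n : rsum (fun k => f k + g k) n = rsum f n + rsum g n.
Proof. induction n as [|n IH]; simpl; [ring|rewrite IH; ring]. Qed.

Lemma csum_scal a f n : csum (fun k => a * f k)%C n = (a * csum f n)%C.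
Proof. induction n as [|n IH]; simpl; [ring|rewrite IH; ring]. Qed.

Lemma rsum_scal a f n : rsum (fun k => a * f k) n = a * rsum f n.
Proof. induction n as [|n IH]; simpl; [ring|rewrite IH; ring]. Qed.

Lemma rsum_le f g n : (forall k, (k < n)%nat -> f k <= g k) -> rsum f n <= rsum g n.
Proof.
induction n as [|n IH]; intros H; simpl; [lra|].
apply Rplus_le_compat; auto.
Qed.

Lemma rsum_pos f n : (forall k, (k < n)%nat -> 0 <= f k) -> 0 <= rsum f n.
Proof.
induction n as [|n IH]; intros H; simpl; [lra|].
apply Rplus_le_le_0_compat; auto.
Qed.

Lemma rsum_incr f n m : (forall k, 0 <= f k) -> (n <= m)%nat -> rsum f n <= rsum f m.
Proof. intros H; induction 1; simpl; [lra|specialize (H m); lra]. Qed.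

Lemma csum_stable f n m : (n <= m)%nat -> (forall k, (n <= k)%nat -> f k = RtoC 0) ->
  csum f m = csum f n.
Proof. intros H H0; induction H; simpl; auto. rewrite IHle, H0; auto. ring. Qed.

Lemma rsum_stable f n m : (n <= m)%nat -> (forall k, (n <= k)%nat -> f k = 0) ->
  rsum f m = rsum f n.
Proof. intros H H0; induction H; simpl; auto. rewrite IHle, H0; auto. ring. Qed.

Lemma Cmod_csum f n : Cmod (csum f n) <= rsum (fun k => Cmod (f k)) n.
Proof.
induction n as [|n IH]; simpl; [rewrite Cmod_0; lra|].
eapply Rle_trans; [apply Cmod_triangle|lra].
Qed.

Lemma Re_csum f n : Re (csum f n) = rsum (fun k => Re (f k)) n.
Proof. induction n as [|n IH]; simpl; auto. rewrite <- IH. reflexivity. Qed.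

Lemma Im_csum f n : Im (csum f n) = rsum (fun k => Im (f k)) n.
Proof. induction n as [|n IH]; simpl; auto. rewrite <- IH. reflexivity. Qed.

Lemma csum_RtoC f n : csum (fun k => RtoC (f k)) n = RtoC (rsum f n).
Proof. induction n as [|n IH]; simpl; auto. rewrite IH, RtoC_plus. reflexivity. Qed.

Lemma rsum_head f n : rsum f (S n) = f 0%nat + rsum (fun k => f (S k)) n.
Proof.
induction n as [|n IH]; [simpl; ring|].
change (rsum f (S (S n))) with (rsum f (S n) + f (S n)).
rewrite IH; simpl; ring.
Qed.

Lemma csum_single f n j : (j < n)%nat -> (forall k, (k < n)%nat -> k <> j -> f k = RtoC 0) ->
  csum f n = f j.
Proof.
induction n as [|n IH]; intros Hj H; [lia|simpl].
destruct (Nat.eq_dec j n) as [->|Hn].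
- assert (E : csum f n = RtoC 0).
  { rewrite (csum_ext _ (fun _ => RtoC 0 * RtoC 0)%C).
    - rewrite csum_scal; ring.
    - intros k Hk. rewrite H; [ring|lia|lia]. }
  rewrite E; ring.
- rewrite IH, (H n); try lia; [ring|]. intros k Hk; apply H; lia.
Qed.

Lemma Cexp_plus z w : Cexp (z + w)%C = (Cexp z * Cexp w)%C.
Proof.
destruct z as [x y], w as [u v]. unfold Cexp, Cmult, Cplus; simpl.
rewrite exp_plus, cos_plus, sin_plus. f_equal; ring.
Qed.

Lemma Cexp_0 : Cexp (RtoC 0) = RtoC 1.
Proof. unfold Cexp; simpl. rewrite exp_0, cos_0, sin_0. unfold RtoC; f_equal; ring. Qed.

Lemma Cmod_sqr z : Cmod z ^ 2 = Re z ^ 2 + Im z ^ 2.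
Proof. unfold Cmod, Re, Im. rewrite pow2_sqrt; auto. nra. Qed.

Lemma Cmod_Cexp z : Cmod (Cexp z) = exp (Re z).
Proof.
assert (0 < exp (Re z)) by apply exp_pos.
apply Rsqr_inj; [apply Cmod_ge_0|lra|].
rewrite !Rsqr_pow2, Cmod_sqr; unfold Cexp; simpl.
pose proof (sin2_cos2 (Im z)) as E; unfold Rsqr in E. nra.
Qed.

Lemma npow_mult m n s : (1 <= m)%nat -> (1 <= n)%nat ->
  (npow m s * npow n s)%C = npow (m * n) s.
Proof.
intros Hm Hn. unfold npow. rewrite <- Cexp_plus, mult_INR, ln_mult, RtoC_plus.
- f_equal; ring.
- apply lt_0_INR; lia.
- apply lt_0_INR; lia.
Qed.

Lemma npow_1 s : npow 1 s = RtoC 1.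
Proof.
unfold npow. rewrite <- Cexp_0. f_equal. simpl INR. rewrite ln_1. ring.
Qed.

Lemma INR_ge1 k : 1 <= INR (S k).
Proof. rewrite S_INR. pose proof (pos_INR k); lra. Qed.

Lemma ln_INR_pos k : 0 <= ln (INR (S k)).
Proof.
rewrite <- ln_1. pose proof (INR_ge1 k).
destruct (Req_dec (INR (S k)) 1) as [->|]; [lra|].
left; apply ln_increasing; lra.
Qed.

Lemma Cmod_npow n s : Cmod (npow n s) = Rpower (INR n) (- Re s).
Proof.
unfold npow. rewrite Cmod_Cexp. unfold Rpower. f_equal.
destruct s as [x y]; simpl; ring.
Qed.

Lemma Rpower_le1 k x : 0 <= x -> Rpower (INR (S k)) (- x) <= 1.
Proof.
intros Hx. unfold Rpower. rewrite <- exp_0.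
pose proof (ln_INR_pos k).
destruct (Req_dec (-x * ln (INR (S k))) 0) as [->|]; [lra|].
left; apply exp_increasing. nra.
Qed.

(* [None] stands for [Re s = +infinity], where a Dirichlet series takes its constant term as value:
   constant terms are thus carried along by every pointwise estimate. *)
Definition mono (n : nat) (x : option C) : C :=
  match x with
  | Some s => npow n s
  | None => if Nat.eqb n 1 then RtoC 1 else RtoC 0
  end.

Lemma mono_mult m n x : (1 <= m)%nat -> (1 <= n)%nat ->
  (mono m x * mono n x)%C = mono (m * n) x.
Proof.
intros Hm Hn. destruct x as [s|]; simpl; [apply npow_mult; auto|].
destruct (Nat.eqb_spec m 1), (Nat.eqb_spec n 1), (Nat.eqb_spec (m * n) 1); subst;
  try ring; try lia; exfalso; nia.
Qed.

Definition dpoly (p : nat -> C) (N : nat) (x : option C) : C :=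
  csum (fun k => p (S k) * mono (S k) x)%C N.

Definition dom (sig : R) (x : option C) : Prop :=
  match x with Some s => sig <= Re s | None => True end.

Lemma Cmod_mono k x : dom 0 x -> Cmod (mono (S k) x) <= 1.
Proof.
destruct x as [s|]; unfold dom, mono; intros H.
- rewrite Cmod_npow. apply Rpower_le1; auto.
- destruct (Nat.eqb _ _); rewrite ?Cmod_1, ?Cmod_0; lra.
Qed.

(** [T] is the set of admissible frequencies; the bound [N] allows padding to a common length. *)
Definition supp (T : nat -> Prop) (p : nat -> C) (N : nat) : Prop :=
  (forall n, (N < n)%nat -> p n = RtoC 0) /\ (forall n, ~ T n -> p n = RtoC 0).

Definition is_dpoly (T : nat -> Prop) (P : option C -> C) : Prop :=
  exists p N, supp T p N /\ forall x, P x = dpoly p N x.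

(** [None] lies in every [dom sig], so an approximant is also close in its constant term. *)
Definition unif_approx (T : nat -> Prop) (sig : R) (F : option C -> C) : Prop :=
  forall eps, 0 < eps -> exists P, is_dpoly T P /\
    forall x, dom sig x -> Cmod (F x - P x)%C <= eps.

Definition submonoid (T : nat -> Prop) : Prop :=
  T 1%nat /\ forall m n, (1 <= m)%nat -> (1 <= n)%nat -> T m -> T n -> T (m * n)%nat.

Lemma dpoly_pad T p N M x : supp T p N -> (N <= M)%nat -> dpoly p M x = dpoly p N x.
Proof.
intros [H _] HM. apply csum_stable; auto. intros k Hk. rewrite H; [ring|lia].
Qed.

Lemma supp_pad T p N M : supp T p N -> (N <= M)%nat -> supp T p M.
Proof. intros [H1 H2] HM; split; auto. intros n Hn; apply H1; lia. Qed.

Lemma supp_plus T p q N : supp T p N -> supp T q N -> supp T (fun n => p n + q n)%C N.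
Proof.
intros [H1 H2] [H3 H4]; split; intros n Hn.
- rewrite H1, H3; auto; ring.
- rewrite H2, H4; auto; ring.
Qed.

Lemma dpoly_plus p q N x : dpoly (fun n => p n + q n)%C N x = (dpoly p N x + dpoly q N x)%C.
Proof. unfold dpoly. rewrite <- csum_plus. apply csum_ext; intros; ring. Qed.

Lemma dpoly_scal a p N x : dpoly (fun n => a * p n)%C N x = (a * dpoly p N x)%C.
Proof. unfold dpoly. rewrite <- csum_scal. apply csum_ext; intros; ring. Qed.

Section Closure.
Variable T : nat -> Prop.
Hypothesis HT : submonoid T.

Lemma is_dpoly_ext P Q : (forall x, P x = Q x) -> is_dpoly T Q -> is_dpoly T P.
Proof.
intros E (p & N & H & H'). exists p, N; split; auto. intros x; rewrite E; auto.
Qed.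

Lemma is_dpoly_plus P Q : is_dpoly T P -> is_dpoly T Q -> is_dpoly T (fun x => P x + Q x)%C.
Proof.
intros (p & N & H & H') (q & M & K & K').
exists (fun n => p n + q n)%C, (max N M); split.
- apply supp_plus; eapply supp_pad; eauto; lia.
- intros x. rewrite dpoly_plus, H', K'.
  rewrite (dpoly_pad T p N (max N M)), (dpoly_pad T q M (max N M)); auto; lia.
Qed.

Lemma is_dpoly_monomial a n : (1 <= n)%nat -> (T n \/ a = RtoC 0) -> is_dpoly T (fun x => a * mono n x)%C.
Proof.
intros Hn H. exists (fun k => if Nat.eqb k n then a else RtoC 0), n; repeat split.
- intros k Hk. destruct (Nat.eqb_spec k n); auto; lia.
- intros k Hk. destruct (Nat.eqb_spec k n); auto; subst; tauto.
- intros x. unfold dpoly. rewrite (csum_single _ _ (pred n)); try lia.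
  + replace (S (pred n)) with n by lia. rewrite Nat.eqb_refl; auto.
  + intros k Hk Hk'. destruct (Nat.eqb_spec (S k) n); [lia|ring].
Qed.

Lemma is_dpoly_csum P n : (forall k, (k < n)%nat -> is_dpoly T (P k)) ->
  is_dpoly T (fun x => csum (fun k => P k x) n).
Proof.
induction n as [|n IH]; intros H; simpl.
- apply is_dpoly_ext with (fun x => RtoC 0 * mono 1 x)%C; [intros; ring|].
  apply is_dpoly_monomial; auto.
- apply is_dpoly_plus; auto.
Qed.

Lemma is_dpoly_mult P Q : is_dpoly T P -> is_dpoly T Q -> is_dpoly T (fun x => P x * Q x)%C.
Proof.
intros (p & N & [_ H] & H') (q & M & [_ K] & K').
apply is_dpoly_ext with
  (fun x => csum (fun i => csum (fun j => (p (S i) * q (S j)) * mono (S i * S j) x)%C M) N).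
- intros x. rewrite H', K'. unfold dpoly at 1. rewrite Cmult_comm, <- csum_scal.
  apply csum_ext; intros i _. unfold dpoly. rewrite Cmult_comm, <- csum_scal.
  apply csum_ext; intros j _. rewrite <- mono_mult by lia. ring.
- apply is_dpoly_csum; intros i _. apply is_dpoly_csum; intros j _. apply is_dpoly_monomial; [lia|].
  destruct HT as [_ HT'].
  (* [T] need not be decidable; if an index is outside [T], its coefficient is 0 and so is that of
     the product. *)
  destruct (Classical_Prop.classic (T (S i))) as [A|A]; [|right; rewrite (H _ A); ring].
  destruct (Classical_Prop.classic (T (S j))) as [B|B]; [|right; rewrite (K _ B); ring].
  left; apply HT'; auto; lia.
Qed.

Lemma is_dpoly_const a : is_dpoly T (fun _ => a).
Proof.
apply is_dpoly_ext with (fun x => a * mono 1 x)%C.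
- intros [s|]; simpl; rewrite ?npow_1; ring.
- destruct HT; apply is_dpoly_monomial; auto.
Qed.

Variable sig : R.
Hypothesis Hsig : 0 <= sig.

Lemma is_dpoly_unif_approx P : is_dpoly T P -> unif_approx T sig P.
Proof.
intros H eps He. exists P; split; auto. intros x _.
replace (P x - P x)%C with (RtoC 0) by ring. rewrite Cmod_0; lra.
Qed.

Lemma unif_approx_ext F G : (forall x, dom sig x -> F x = G x) -> unif_approx T sig G -> unif_approx T sig F.
Proof.
intros E H eps He. destruct (H eps He) as (P & HP & HP'). exists P; split; auto.
intros x Hx; rewrite E; auto.
Qed.

Lemma is_dpoly_bounded P : is_dpoly T P -> exists B, 0 <= B /\ forall x, dom sig x -> Cmod (P x) <= B.
Proof.
intros (p & N & _ & H). exists (rsum (fun k => Cmod (p (S k))) N); split.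
- apply rsum_pos; intros; apply Cmod_ge_0.
- intros x Hx. rewrite H. eapply Rle_trans; [apply Cmod_csum|].
  apply rsum_le; intros k _. rewrite Cmod_mult.
  assert (D : dom 0 x) by (destruct x; simpl in *; auto; lra).
  pose proof (Cmod_mono k x D). pose proof (Cmod_ge_0 (p (S k))). nra.
Qed.

Lemma unif_approx_bounded F : unif_approx T sig F -> exists B, 0 <= B /\ forall x, dom sig x -> Cmod (F x) <= B.
Proof.
intros H. destruct (H 1) as (P & HP & HP'); [lra|].
destruct (is_dpoly_bounded P HP) as (B & HB & HB'). exists (1 + B); split; [lra|].
intros x Hx. replace (F x) with ((F x - P x) + P x)%C by ring.
eapply Rle_trans; [apply Cmod_triangle|]. apply Rplus_le_compat; auto.
Qed.

Lemma unif_approx_plus F G : unif_approx T sig F -> unif_approx T sig G -> unif_approx T sig (fun x => F x + G x)%C.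
Proof.
intros HF HG eps He.
destruct (HF (eps/2)) as (P & HP & HP'); [lra|].
destruct (HG (eps/2)) as (Q & HQ & HQ'); [lra|].
exists (fun x => P x + Q x)%C; split; [apply is_dpoly_plus; auto|]. intros x Hx.
replace (F x + G x - (P x + Q x))%C with ((F x - P x) + (G x - Q x))%C by ring.
eapply Rle_trans; [apply Cmod_triangle|]. specialize (HP' x Hx); specialize (HQ' x Hx). lra.
Qed.

Lemma unif_approx_mult F G : unif_approx T sig F -> unif_approx T sig G -> unif_approx T sig (fun x => F x * G x)%C.
Proof.
intros HF HG eps He.
destruct (unif_approx_bounded F HF) as (B & HB & HB').
destruct (HG (eps/2/(B+1))) as (Q & HQ & HQ').
{ apply Rdiv_lt_0_compat; lra. }
destruct (is_dpoly_bounded Q HQ) as (D & HD & HD').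
destruct (HF (eps/2/(D+1))) as (P & HP & HP').
{ apply Rdiv_lt_0_compat; lra. }
exists (fun x => P x * Q x)%C; split; [apply is_dpoly_mult; auto|]. intros x Hx.
replace (F x * G x - P x * Q x)%C with (F x * (G x - Q x) + (F x - P x) * Q x)%C by ring.
eapply Rle_trans; [apply Cmod_triangle|]. rewrite !Cmod_mult.
specialize (HP' x Hx); specialize (HQ' x Hx); specialize (HB' x Hx); specialize (HD' x Hx).
assert (X1 : Cmod (F x) * Cmod (G x - Q x)%C <= B * (eps/2/(B+1))).
{ apply Rmult_le_compat; auto using Cmod_ge_0. }
assert (X2 : Cmod (F x - P x)%C * Cmod (Q x) <= eps/2/(D+1) * D).
{ apply Rmult_le_compat; auto using Cmod_ge_0. }
assert (Y1 : B * (eps/2/(B+1)) <= eps/2).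
{ apply Rmult_le_reg_r with (B+1); [lra|]. field_simplify; [|lra]. nra. }
assert (Y2 : eps/2/(D+1)*D <= eps/2).
{ apply Rmult_le_reg_r with (D+1); [lra|]. field_simplify; [|lra]. nra. }
lra.
Qed.

Lemma unif_approx_const a : unif_approx T sig (fun _ => a).
Proof. apply is_dpoly_unif_approx, is_dpoly_const. Qed.

Lemma unif_approx_scal a F : unif_approx T sig F -> unif_approx T sig (fun x => a * F x)%C.
Proof. apply (unif_approx_mult (fun _ => a)), unif_approx_const. Qed.

Lemma unif_approx_csum F n : (forall k, (k < n)%nat -> unif_approx T sig (F k)) ->
  unif_approx T sig (fun x => csum (fun k => F k x) n).
Proof.
induction n as [|n IH]; intros H; simpl; [apply unif_approx_const|apply unif_approx_plus; auto].
Qed.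

Lemma unif_approx_pow F n : unif_approx T sig F -> unif_approx T sig (fun x => Cpow (F x) n).
Proof. intros H. induction n as [|n IH]; simpl; [apply unif_approx_const|apply unif_approx_mult; auto]. Qed.

Lemma unif_approx_limit F : (forall eps, 0 < eps -> exists G, unif_approx T sig G /\
   forall x, dom sig x -> Cmod (F x - G x)%C <= eps) -> unif_approx T sig F.
Proof.
intros H eps He. destruct (H (eps/2)) as (G & HG & HG'); [lra|].
destruct (HG (eps/2)) as (P & HP & HP'); [lra|]. exists P; split; auto. intros x Hx.
replace (F x - P x)%C with ((F x - G x) + (G x - P x))%C by ring.
eapply Rle_trans; [apply Cmod_triangle|]. specialize (HP' x Hx); specialize (HG' x Hx). lra.
Qed.
End Closure.

(** * Explicit error bounds for the exponential *)

Lemma exp_monotone x y : x <= y -> exp x <= exp y.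
Proof. intros [H| ->]; [left; apply exp_increasing; auto|lra]. Qed.

Lemma exp_INR_mult x n : exp (INR n * x) = exp x ^ n.
Proof.
induction n as [|n IH]; [simpl; rewrite Rmult_0_l; apply exp_0|].
rewrite S_INR, Rmult_plus_distr_r, exp_plus, IH, Rmult_1_l. simpl; ring.
Qed.

(** Half-angle formula [cos y = 1 - 2 sin(y/2)^2] together with [|sin u| <= u]. *)
Lemma cos_lower y : 1 - y ^ 2 / 2 <= cos y.
Proof.
assert (H : forall y, 0 <= y -> 1 - y ^ 2 / 2 <= cos y).
{ clear y; intros y Hy. replace y with (2 * (y / 2)) at 2 by field.
  rewrite cos_2a_sin.
  assert (0 <= y/2) by lra.
  assert (Hs : Rabs (sin (y/2)) <= y/2).
  { destruct (Req_dec y 0) as [->|]; [replace (0/2) with 0 by lra; rewrite sin_0, Rabs_R0; lra|].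
    apply Rabs_le; split.
    - destruct (Rle_dec (y/2) PI).
      + pose proof (sin_ge_0 (y/2)); lra.
      + pose proof (SIN_bound (y/2)). pose proof PI2_1. lra.
    - left; apply sin_lt_x; lra. }
  apply Rabs_le_between in Hs. nra. }
destruct (Rle_dec 0 y); auto.
rewrite <- cos_neg. replace (y ^ 2) with ((-y)^2) by ring. apply H; lra.
Qed.

Lemma sin_linear_approx y : Rabs y <= 1 -> Rabs (sin y - y) <= y ^ 2 / 2.
Proof.
assert (H : forall y, 0 <= y <= 1 -> y - y ^ 2 / 2 <= sin y <= y).
{ clear y; intros y Hy. split.
  - destruct (Req_dec y 0) as [->|]; [rewrite sin_0; lra|].
    destruct (MVT_cor2 (fun t => sin t - t) (fun t => cos t - 1) 0 y) as (c & E & Hc); [lra| |].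
    + intros c _. auto_derive; auto; ring.
    + rewrite sin_0 in E. pose proof (cos_lower c). nra.
  - destruct (Req_dec y 0) as [->|]; [rewrite sin_0; lra|].
    left; apply sin_lt_x; lra. }
intros Hy. apply Rabs_le_between in Hy.
destruct (Rle_dec 0 y) as [h|h].
- apply Rabs_le. specialize (H y). lra.
- apply Rabs_le. specialize (H (-y)). rewrite sin_neg in H. nra.
Qed.

(** The upper half combines [exp x * (1 - x) <= 1], the tangent bound at [-x], with [(1 + x +
    2x^2)(1 - x) = 1 + x^2 (1 - 2x) >= 1]. *)
Lemma exp_linear_approx x : Rabs x <= 1/2 -> 0 <= exp x - 1 - x <= 2 * x ^ 2.
Proof.
intros H. apply Rabs_le_between in H. split.
- pose proof (exp_ineq1_le x). lra.
- pose proof (exp_ineq1_le (-x)) as K. pose proof (exp_pos x).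
  assert (E : exp x * exp (-x) = 1) by (rewrite <- exp_plus, Rplus_opp_r; apply exp_0).
  assert (exp x * (1 - x) <= 1) by nra.
  assert (0 <= x ^ 2 * (1 - 2 * x)) by (apply Rmult_le_pos; nra).
  assert (exp x * (1-x) <= (1 + x + 2*x^2) * (1 - x)) by nra.
  apply Rmult_le_reg_r with (1-x); nra.
Qed.

Lemma Cmod_le_abs z : Cmod z <= Rabs (Re z) + Rabs (Im z).
Proof.
pose proof (Cmod_sqr z) as E. pose proof (Cmod_ge_0 z).
pose proof (Rabs_pos (Re z)). pose proof (Rabs_pos (Im z)).
rewrite <- (pow2_abs (Re z)), <- (pow2_abs (Im z)) in E. nra.
Qed.

Lemma Cexp_linear_approx z : Cmod z <= 1/2 -> Cmod (Cexp z - (1 + z))%C <= 8 * Cmod z ^ 2.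
Proof.
intros Hz. destruct z as [x y].
assert (Hx : Rabs x <= Cmod (x, y)) by (apply (Rle_trans _ (Rmax (Rabs x) (Rabs y))); [apply Rmax_l|apply (Rmax_Cmod (x, y))]).
assert (Hy : Rabs y <= Cmod (x, y)) by (apply (Rle_trans _ (Rmax (Rabs x) (Rabs y))); [apply Rmax_r|apply (Rmax_Cmod (x, y))]).
pose proof (Cmod_sqr (x, y)) as E. simpl in E.
destruct (exp_linear_approx x) as [E1 E2]; [lra|].
pose proof (cos_lower y) as C1. pose proof (COS_bound y) as C2.
pose proof (sin_linear_approx y ltac:(lra)) as S1. apply Rabs_le_between in S1.
pose proof (exp_pos x).
assert (Hx' : -(1/2) <= x <= 1/2) by (apply Rabs_le_between; lra).
assert (Hy' : -(1/2) <= y <= 1/2) by (apply Rabs_le_between; lra).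
eapply Rle_trans; [apply Cmod_le_abs|].
unfold Cexp; simpl. rewrite E.
assert (A1 : Rabs (exp x * cos y + - (1 + x)) <= 2*x^2 + y^2).
{ assert (exp x <= 2) by nra. apply Rabs_le; split; nra. }
assert (A2 : Rabs (exp x * sin y + - (0 + y)) <= 2 * (x^2 + y^2) + y^2/2).
{ replace (exp x * sin y + - (0 + y)) with ((exp x - 1) * sin y + (sin y - y)) by ring.
  assert (D : Rabs (exp x - 1) <= 2 * Rabs x).
  { destruct (Rle_dec 0 x).
    - rewrite !Rabs_pos_eq; nra.
    - rewrite (Rabs_left x) by lra. apply Rabs_le; split; nra. }
  assert (D' : Rabs (sin y) <= 2 * Rabs y).
  { destruct (Rle_dec 0 y).
    - rewrite (Rabs_pos_eq y) by lra. apply Rabs_le; split; nra.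
    - rewrite (Rabs_left y) by lra. apply Rabs_le; split; nra. }
  eapply Rle_trans; [apply Rabs_triang|]. rewrite Rabs_mult.
  assert (Rabs (sin y - y) <= y^2/2) by (apply Rabs_le; lra).
  pose proof (Rabs_pos x). pose proof (Rabs_pos y).
  pose proof (Rabs_pos (exp x - 1)). pose proof (Rabs_pos (sin y)).
  assert (Rabs (exp x - 1) * Rabs (sin y) <= (2 * Rabs x) * (2 * Rabs y)) by (apply Rmult_le_compat; auto).
  pose proof (pow2_abs x). pose proof (pow2_abs y).
  assert (0 <= Rabs x ^ 2 - 2 * (Rabs x * Rabs y) + Rabs y ^ 2)
    by (replace (Rabs x ^ 2 - 2 * (Rabs x * Rabs y) + Rabs y ^ 2) with ((Rabs x - Rabs y) ^ 2) by ring; apply pow2_ge_0).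
  lra. }
nra.
Qed.

Lemma Cpow_diff_bound a b r n : Cmod a <= r -> Cmod b <= r ->
  Cmod (a ^ S n - b ^ S n)%C <= INR (S n) * Cmod (a - b)%C * r ^ n.
Proof.
intros Ha Hb. assert (Hr : 0 <= r) by (pose proof (Cmod_ge_0 a); lra).
induction n as [|n IH].
- simpl. replace (a * 1 - b * 1)%C with (a - b)%C by ring. lra.
- replace (a ^ S (S n) - b ^ S (S n))%C with (a * (a ^ S n - b ^ S n) + (a - b) * b ^ S n)%C
    by (rewrite !(Cpow_S _ (S n)); ring).
  eapply Rle_trans; [apply Cmod_triangle|]. rewrite !Cmod_mult, Cmod_pow.
  assert (A : Cmod b ^ S n <= r ^ S n) by (apply pow_incr; split; auto using Cmod_ge_0).
  pose proof (Cmod_ge_0 a). pose proof (Cmod_ge_0 (a - b)%C).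
  pose proof (Cmod_ge_0 (a ^ S n - b ^ S n)%C). pose proof (pow_le r n Hr).
  assert (B : Cmod a * Cmod (a ^ S n - b ^ S n)%C <= r * (INR (S n) * Cmod (a - b)%C * r ^ n))
    by (apply Rmult_le_compat; auto).
  assert (D : Cmod (a - b)%C * Cmod b ^ S n <= Cmod (a - b)%C * r ^ S n)
    by (apply Rmult_le_compat_l; auto).
  rewrite (S_INR (S n)). change (r ^ S n) with (r * r ^ n) in *. lra.
Qed.

Lemma Cexp_pow z n : Cexp (RtoC (INR n) * z)%C = (Cexp z ^ n)%C.
Proof.
induction n as [|n IH].
- simpl. rewrite <- Cexp_0. f_equal. ring.
- rewrite S_INR, RtoC_plus, Cpow_S, <- IH, <- Cexp_plus. f_equal. ring.
Qed.

(** Powers of [1 + z/n] are convenient because closure under products applies directly. Telescoping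
    [a^n - b^n] with [a = exp(z/n)] and [b = 1 + z/n], both of modulus at most [exp(B/n)], leaves
    the error [8 B^2 exp(B) / n]. *)
Lemma Cexp_limit B eps : 0 <= B -> 0 < eps -> exists n : nat, (1 <= n)%nat /\
  forall z, Cmod z <= B -> Cmod (Cexp z - (1 + / INR n * z) ^ n)%C <= eps.
Proof.
intros HB He.
(* [n > 2B] brings [z/n] into the disc of radius 1/2 where the linear approximation holds; the other
   summand makes the error at most [eps]. *)
destruct (INR_unbounded (2 * B + 8 * B^2 * exp B / eps)) as [n Hn].
assert (P1 : 0 <= 8 * B^2 * exp B / eps).
{ apply Rdiv_le_0_compat; auto. pose proof (exp_pos B). nra. }
destruct n as [|n].
{ simpl in Hn. lra. }
assert (Hpos : 0 < INR (S n)) by (pose proof (INR_ge1 n); lra).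
exists (S n); split; [lia|]. intros z Hz.
set (w := (/ INR (S n) * z)%C).
assert (Ew : z = (RtoC (INR (S n)) * w)%C).
{ unfold w. rewrite Cmult_assoc, Cinv_r, Cmult_1_l; auto. intros H. apply RtoC_inj in H. lra. }
assert (Hw : Cmod w = Cmod z / INR (S n)).
{ unfold w. rewrite <- RtoC_inv by lra. rewrite Cmod_mult, Cmod_R, Rabs_pos_eq; [unfold Rdiv; ring|].
  left; apply Rinv_0_lt_compat; auto. }
assert (Hw1 : Cmod w <= B / INR (S n)).
{ rewrite Hw. apply Rmult_le_compat_r; auto. left; apply Rinv_0_lt_compat; auto. }
rewrite Ew at 1. rewrite Cexp_pow.
eapply Rle_trans.
{ apply (Cpow_diff_bound _ _ (exp (B / INR (S n)))).
  - rewrite Cmod_Cexp. apply exp_monotone. eapply Rle_trans; [|apply Hw1].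
    destruct w as [x y]; simpl. eapply Rle_trans; [apply RRle_abs|].
    eapply Rle_trans; [|apply (Rmax_Cmod (x, y))]. apply Rmax_l.
  - eapply Rle_trans; [apply Cmod_triangle|]. rewrite Cmod_1.
    pose proof (exp_ineq1_le (B / INR (S n))). lra. }
assert (E1 : exp (B / INR (S n)) ^ n <= exp B).
{ rewrite <- exp_INR_mult. apply exp_monotone. unfold Rdiv. 
  apply Rmult_le_reg_r with (INR (S n)); auto. rewrite S_INR in *. field_simplify; [|lra].
  pose proof (pos_INR n). nra. }
assert (E2 : Cmod (Cexp w - (1 + w))%C <= 8 * Cmod w ^ 2).
{ apply Cexp_linear_approx. eapply Rle_trans; [apply Hw1|].
  apply Rmult_le_reg_r with (INR (S n)); auto. field_simplify; lra. }
assert (E3 : Cmod w ^ 2 <= (B / INR (S n)) ^ 2) by (apply pow_incr; split; auto using Cmod_ge_0).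
pose proof (exp_pos B).
assert (0 <= exp (B / INR (S n)) ^ n) by (apply pow_le; left; apply exp_pos).
apply Rle_trans with (INR (S n) * (8 * (B / INR (S n))^2) * exp B).
- apply Rmult_le_compat; auto.
  + apply Rmult_le_pos; [lra|apply Cmod_ge_0].
  + apply Rmult_le_compat_l; lra.
- apply Rmult_le_reg_r with (INR (S n)); auto. field_simplify; [|lra].
  assert (8 * B^2 * exp B / eps * eps = 8 * B^2 * exp B) by (field; lra).
  nra.
Qed.

Lemma unif_approx_exp T (HT : submonoid T) sig (Hsig : 0 <= sig) F :
  unif_approx T sig F -> unif_approx T sig (fun x => Cexp (F x)).
Proof.
intros H. apply unif_approx_limit. intros eps He.
destruct (unif_approx_bounded T sig Hsig F H) as (B & HB & HB').
destruct (Cexp_limit B eps HB He) as (n & Hn & K).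
exists (fun x => (1 + / INR n * F x) ^ n)%C; split; auto.
apply unif_approx_pow; auto. apply unif_approx_plus; auto; [apply unif_approx_const; auto|].
apply unif_approx_scal; auto.
Qed.

(** * Mean values on vertical lines *)

(* A finite average that annihilates every frequency of the list exactly, because [t] and [t + PI / l]
   give opposite values of [exp (i l t)]; it replaces the limit of [(1/2T) int_{-T}^T]. *)
Fixpoint mean (L : list R) (g : R -> C) : C :=
  match L with
  | nil => g 0
  | l :: L' => (RtoC (/ 2) * (mean L' g + mean L' (fun t => g (t + PI / l)%R)))%C
  end.

Lemma mean_ext L g h : (forall t, g t = h t) -> mean L g = mean L h.
Proof.
revert g h; induction L as [|l L IH]; intros g h H; simpl; auto.
f_equal. f_equal; apply IH; auto.
Qed.

Lemma mean_plus L g h : mean L (fun t => g t + h t)%C = (mean L g + mean L h)%C.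
Proof.
revert g h; induction L as [|l L IH]; intros g h; simpl; auto.
rewrite !IH. ring.
Qed.

Lemma mean_scal L a g : mean L (fun t => a * g t)%C = (a * mean L g)%C.
Proof.
revert g; induction L as [|l L IH]; intros g; simpl; auto.
rewrite !IH. ring.
Qed.

Lemma mean_csum L f n : mean L (fun t => csum (fun k => f k t) n) = csum (fun k => mean L (f k)) n.
Proof.
induction n as [|n IH]; simpl.
- rewrite (mean_ext _ _ (fun _ => RtoC 0 * RtoC 0)%C) by (intros; ring).
  rewrite mean_scal; ring.
- rewrite mean_plus, IH; auto.
Qed.

Lemma mean_const L a : mean L (fun _ => a) = a.
Proof.
induction L as [|l L IH]; simpl; auto. rewrite IH.
apply injective_projections; simpl; field.
Qed.

Lemma Re_mean_le L g h : (forall t, Re (g t) <= Re (h t)) -> Re (mean L g) <= Re (mean L h).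
Proof.
revert g h; induction L as [|l L IH]; intros g h H; simpl mean; auto.
pose proof (IH g h H) as H1.
pose proof (IH (fun t => g (t + PI / l)) (fun t => h (t + PI / l)) (fun t => H _)) as H2.
unfold Re in *; simpl; lra.
Qed.

Definition cis (mu t : R) : C := Cexp (0, mu * t).

Lemma cis_plus mu t u : cis mu (t + u) = (cis mu t * cis mu u)%C.
Proof.
unfold cis. rewrite <- Cexp_plus. f_equal. unfold Cplus; simpl; f_equal; ring.
Qed.

Lemma mean_cis L mu a : In mu L -> mu <> 0 -> mean L (fun t => a * cis mu t)%C = RtoC 0.
Proof.
intros HL Hmu; revert a. induction L as [|l L IH]; intros a; [destruct HL|].
simpl. rewrite (mean_ext L (fun t => a * cis mu (t + PI / l)%R)%C
  (fun t => (cis mu (PI / l)%R) * (a * cis mu t))%C) by (intros; rewrite cis_plus; ring).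
rewrite (mean_scal L (cis mu (PI / l)) (fun t => a * cis mu t)%C). destruct HL as [->|HL].
- assert (E : cis mu (PI / mu) = (- RtoC 1)%C).
  { unfold cis, Cexp. simpl. replace (mu * (PI / mu)) with PI by (field; auto).
    rewrite cos_PI, sin_PI, exp_0. apply injective_projections; simpl; ring. }
  rewrite E. ring.
- rewrite IH; auto; ring.
Qed.

(** The diagonal contributes the frequency 0. Whatever the value of [PI / 0], averaging over that
    shift still fixes constants and preserves inequalities and zero means. *)
Definition freqs (J : nat) : list R :=
  flat_map (fun m => map (fun n => ln (INR (S n)) - ln (INR (S m))) (seq 0 J)) (seq 0 J).

Lemma freqs_In J m n : (m < J)%nat -> (n < J)%nat -> In (ln (INR (S n)) - ln (INR (S m))) (freqs J).
Proof.
intros Hm Hn. apply in_flat_map. exists m; split; [apply in_seq; lia|].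
apply (in_map (fun n => ln (INR (S n)) - ln (INR (S m)))). apply in_seq; lia.
Qed.

Lemma freqs_neq m n : m <> n -> ln (INR (S n)) - ln (INR (S m)) <> 0.
Proof.
intros H E. apply H. pose proof (INR_ge1 m). pose proof (INR_ge1 n).
assert (E' : INR (S n) = INR (S m)) by (apply ln_inv; lra).
apply INR_eq in E'. lia.
Qed.

Lemma Cexp_RtoC x : Cexp (RtoC x) = RtoC (exp x).
Proof. unfold Cexp; simpl. rewrite cos_0, sin_0. apply injective_projections; simpl; ring. Qed.

Lemma npow_line k sig t :
  npow (S k) (sig, t) = (RtoC (Rpower (INR (S k)) (- sig)) * cis (- ln (INR (S k))) t)%C.
Proof.
unfold npow, cis, Rpower. rewrite <- Cexp_RtoC, <- Cexp_plus. f_equal.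
apply injective_projections; simpl; ring.
Qed.

Definition wt (sig : R) (k : nat) : R := Rpower (INR (S k)) (- (2 * sig)).

Lemma wt_pos sig k : 0 < wt sig k.
Proof. apply exp_pos. Qed.

Lemma wt_sqr sig k : Rpower (INR (S k)) (- sig) ^ 2 = wt sig k.
Proof.
unfold wt. simpl. rewrite Rmult_1_r, <- Rpower_plus. f_equal; ring.
Qed.

Lemma Cconj_csum f n : Cconj (csum f n) = csum (fun k => Cconj (f k)) n.
Proof.
induction n as [|n IH]; simpl; [apply injective_projections; simpl; ring|].
rewrite Cplus_conj, IH; auto.
Qed.

Lemma cis_conj mu t : Cconj (cis mu t) = cis (- mu) t.
Proof.
unfold cis, Cexp, Cconj; simpl.
replace (- mu * t) with (- (mu * t)) by ring. rewrite cos_neg, sin_neg. f_equal; ring.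
Qed.

Lemma cis_freq_plus mu nu t : (cis mu t * cis nu t)%C = cis (mu + nu) t.
Proof.
unfold cis. rewrite <- Cexp_plus. f_equal. unfold Cplus; simpl; f_equal; ring.
Qed.

Lemma cis_0 t : cis 0 t = RtoC 1.
Proof. unfold cis. rewrite <- Cexp_0. f_equal. unfold RtoC; f_equal; ring. Qed.

Lemma parseval p N J sig : (N <= J)%nat ->
  mean (freqs J) (fun t => RtoC (Cmod (dpoly p N (Some (sig, t))) ^ 2)) =
  RtoC (rsum (fun k => Cmod (p (S k)) ^ 2 * wt sig k) N).
Proof.
intros HJ.
set (A := fun k => (p (S k) * RtoC (Rpower (INR (S k)) (- sig)))%C).
rewrite (mean_ext _ _ (fun t => csum (fun i => csum (fun j =>
   (A i * Cconj (A j)) * cis (ln (INR (S j)) - ln (INR (S i))) t)%C N) N)).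
- rewrite mean_csum, <- csum_RtoC. apply csum_ext; intros i Hi.
  rewrite mean_csum, (csum_single _ _ i); auto.
  + rewrite (mean_ext _ _ (fun _ => A i * Cconj (A i))%C).
    * rewrite mean_const, <- Cmod2_conj. unfold A.
      rewrite Cmod_mult, Rpow_mult_distr, Cmod_R, pow2_abs, wt_sqr. auto.
    * intros t. replace (ln (INR (S i)) - ln (INR (S i))) with 0 by ring.
      rewrite cis_0; ring.
  + intros k Hk Hki. apply mean_cis; [apply freqs_In; lia|apply freqs_neq; auto].
- intros t. rewrite Cmod2_conj.
  assert (E : dpoly p N (Some (sig, t)) = csum (fun k => A k * cis (- ln (INR (S k))) t)%C N).
  { apply csum_ext; intros k _. unfold A, mono. rewrite npow_line. ring. }
  rewrite E, Cconj_csum, Cmult_comm, <- csum_scal. apply csum_ext; intros i _.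
  rewrite Cmult_comm, <- csum_scal. apply csum_ext; intros j _.
  rewrite Cmult_conj, cis_conj.
  replace (ln (INR (S j)) - ln (INR (S i))) with (- ln (INR (S i)) + - - ln (INR (S j))) by ring.
  rewrite <- cis_freq_plus. ring.
Qed.

Lemma mean_dpoly p N J sig : (0 < N)%nat -> (N <= J)%nat ->
  mean (freqs J) (fun t => dpoly p N (Some (sig, t))) = p 1%nat.
Proof.
intros HN HJ. unfold dpoly, mono.
rewrite mean_csum, (csum_single _ _ 0%nat); auto.
- rewrite (mean_ext _ _ (fun _ => p 1%nat)); [apply mean_const|].
  intros t. rewrite npow_1. ring.
- intros k Hk Hk0.
  rewrite (mean_ext _ _ (fun t => (p (S k) * RtoC (Rpower (INR (S k)) (- sig)))
     * cis (ln (INR 1) - ln (INR (S k))) t)%C).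
  + apply mean_cis; [apply freqs_In; lia|apply freqs_neq; auto].
  + intros t. rewrite npow_line. simpl (INR 1). rewrite ln_1, Rminus_0_l. ring.
Qed.

Lemma dpoly_inf p N : (0 < N)%nat -> dpoly p N None = p 1%nat.
Proof.
intros HN. unfold dpoly, mono. rewrite (csum_single _ _ 0%nat); auto.
- simpl. ring.
- intros k _ Hk. destruct (Nat.eqb_spec (S k) 1); [lia|ring].
Qed.

Lemma parseval_le p N sig B : 0 <= B ->
  (forall t, Cmod (dpoly p N (Some (sig, t))) <= B) ->
  rsum (fun k => Cmod (p (S k)) ^ 2 * wt sig k) N <= B ^ 2.
Proof.
intros HB H.
change (Re (RtoC (rsum (fun k => Cmod (p (S k)) ^ 2 * wt sig k) N)) <= Re (RtoC (B ^ 2))).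
rewrite <- (parseval p N N) by lia. rewrite <- (mean_const (freqs N) (RtoC (B ^ 2))).
apply Re_mean_le. intros t. apply (pow_incr _ _ 2); split; auto using Cmod_ge_0.
Qed.

(* [b] is the sequence of Dirichlet coefficients of [F], which need not be given by a convergent series yet:
   it is characterized by its l2 distance to the coefficients of uniform approximants. *)
Definition bohr_coef (F : option C -> C) (b : nat -> C) : Prop :=
  forall T sig eps p N, 0 < sig -> 0 <= eps -> supp T p N ->
  (forall s, sig <= Re s -> Cmod (F (Some s) - dpoly p N (Some s))%C <= eps) ->
  forall J, rsum (fun k => Cmod (p (S k) - b (S k))%C ^ 2 * wt sig k) J <= eps ^ 2.

Lemma supp_minus T U p q N M : supp T p N -> supp U q M ->
  supp (fun _ => True) (fun n => p n - q n)%C (max N M).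
Proof.
intros [H _] [K _]; split; [|tauto]. intros n Hn. rewrite H, K by lia. ring.
Qed.

Lemma dpoly_minus p q N x : dpoly (fun n => p n - q n)%C N x = (dpoly p N x - dpoly q N x)%C.
Proof.
replace (dpoly p N x - dpoly q N x)%C with (dpoly p N x + (-(1)) * dpoly q N x)%C by ring.
rewrite <- dpoly_scal, <- dpoly_plus. apply csum_ext; intros; ring.
Qed.

(** Parseval applied to the difference of two approximants of the same [F]: this is what makes the
    coefficients of [F] well defined. *)
Lemma approx_diff T U F p N q M sig e1 e2 : 0 <= e1 -> 0 <= e2 -> supp T p N -> supp U q M ->
  (forall s, sig <= Re s -> Cmod (F (Some s) - dpoly p N (Some s))%C <= e1) ->
  (forall s, sig <= Re s -> Cmod (F (Some s) - dpoly q M (Some s))%C <= e2) ->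
  forall J, rsum (fun k => Cmod (p (S k) - q (S k))%C ^ 2 * wt sig k) J <= (e1 + e2) ^ 2.
Proof.
intros He1 He2 Hp Hq H1 H2 J.
assert (HK : exists K, K = max J (max N M)) by eauto. destruct HK as [K HK].
apply Rle_trans with (rsum (fun k => Cmod (p (S k) - q (S k))%C ^ 2 * wt sig k) K).
{ apply rsum_incr; [|lia]. intros k. apply Rmult_le_pos; [apply pow2_ge_0|left; apply wt_pos]. }
apply (parseval_le (fun n => p n - q n)%C); [lra|]. intros t.
rewrite dpoly_minus, (dpoly_pad T p N K), (dpoly_pad U q M K); auto; try lia.
assert (D : sig <= Re (sig, t)) by (simpl; lra).
specialize (H1 _ D). specialize (H2 _ D).
set (f := F (Some (sig, t))) in *.
replace (dpoly p N (Some (sig, t)) - dpoly q M (Some (sig, t)))%C with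
 (- (f - dpoly p N (Some (sig, t))) + (f - dpoly q M (Some (sig, t))))%C by ring.
eapply Rle_trans; [apply Cmod_triangle|]. rewrite Cmod_opp. apply Rplus_le_compat; [exact H1|exact H2].
Qed.

Lemma is_lim_seq_inv_INR : is_lim_seq (fun j => / INR (S j)) 0.
Proof.
apply is_lim_seq_spec. intros [e He].
destruct (INR_unbounded (/ e)) as [n Hn]. exists n; intros j Hj. change (pos (mkposreal e He)) with e.
rewrite Rminus_0_r, Rabs_pos_eq by (left; apply Rinv_0_lt_compat; pose proof (INR_ge1 j); lra).
rewrite <- (Rinv_inv e). apply Rinv_lt_contravar.
- apply Rmult_lt_0_compat; [apply Rinv_0_lt_compat; auto|pose proof (INR_ge1 j); lra].
- apply le_INR in Hj. rewrite S_INR; lra.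
Qed.

(** The explicit rate survives the limit, and later limits are taken with this error term. *)
Lemma C_cauchy_limit (u : nat -> C) K : 0 <= K ->
  (forall i j, Cmod (u i - u j)%C <= K * (/ INR (S i) + / INR (S j))) ->
  exists l, forall i, Cmod (u i - l)%C <= K * / INR (S i).
Proof.
intros HK H.
(* [f] will be [Re] and [Im]; both are 1-Lipschitz, so one Cauchy argument serves for both. *)
assert (HC : forall f : C -> R, (forall z w, Rabs (f z - f w) <= Cmod (z - w)%C) ->
   exists l : R, is_lim_seq (fun i => f (u i)) l).
{ intros f Hf. destruct (proj2 (ex_lim_seq_cauchy_corr (fun i => f (u i)))) as [l Hl]; eauto.
  intros [e He]; simpl.
  destruct (INR_unbounded (2 * K / e)) as [n Hn].
  exists n; intros i j Hi Hj. eapply Rle_lt_trans; [apply Hf|].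
  eapply Rle_lt_trans; [apply H|].
  assert (P : 0 < INR (S n)) by (pose proof (INR_ge1 n); lra).
  assert (Q : forall i, (n <= i)%nat -> / INR (S i) <= / INR (S n)).
  { intros a Ha. apply Rinv_le_contravar; auto. apply le_INR; lia. }
  pose proof (Q i Hi). pose proof (Q j Hj).
  apply Rle_lt_trans with (K * (2 * / INR (S n))).
  - apply Rmult_le_compat_l; lra.
  - apply Rmult_lt_reg_r with (INR (S n)); auto.
    replace (K * (2 * / INR (S n)) * INR (S n)) with (2 * K / e * e) by (field; split; lra).
    rewrite Rmult_comm. apply Rmult_lt_compat_l; auto. rewrite S_INR; lra. }
destruct (HC Re) as [l1 H1].
{ intros [x y] [x' y']; simpl. eapply Rle_trans; [|apply Rmax_Cmod]. apply Rmax_l. }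
destruct (HC Im) as [l2 H2].
{ intros [x y] [x' y']; simpl. eapply Rle_trans; [|apply Rmax_Cmod]. apply Rmax_r. }
exists (l1, l2). intros i.
assert (L : is_lim_seq (fun j => (Re (u i) - Re (u j)) ^ 2 + (Im (u i) - Im (u j)) ^ 2)
    ((Re (u i) - l1) ^ 2 + (Im (u i) - l2) ^ 2)).
{ assert (X : forall v l c, is_lim_seq v (Finite l) -> is_lim_seq (fun j => (c - v j) ^ 2) ((c - l) ^ 2)).
  { intros v l c Hv. apply (is_lim_seq_ext (fun j => (c - v j) * (c - v j))); [intros; ring|].
    replace ((c - l) ^ 2) with ((c - l) * (c - l)) by ring.
    apply is_lim_seq_mult'; apply is_lim_seq_minus'; auto; apply is_lim_seq_const. }
  apply is_lim_seq_plus'; apply X; auto. }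
assert (R : is_lim_seq (fun j => (K * (/ INR (S i) + / INR (S j))) ^ 2) ((K * / INR (S i)) ^ 2)).
{ assert (Z : is_lim_seq (fun j => K * (/ INR (S i) + / INR (S j))) (K * / INR (S i))).
  { replace (K * / INR (S i)) with (K * (/ INR (S i) + 0)) by ring.
    apply (is_lim_seq_scal_l _ K (/ INR (S i) + 0)). apply is_lim_seq_plus'; [apply is_lim_seq_const|].
    apply is_lim_seq_inv_INR. }
  apply (is_lim_seq_ext (fun j => (K * (/ INR (S i) + / INR (S j))) * (K * (/ INR (S i) + / INR (S j)))));
    [intros; ring|].
  replace ((K * / INR (S i)) ^ 2) with ((K * / INR (S i)) * (K * / INR (S i))) by ring.
  apply is_lim_seq_mult'; auto. }
assert (E : (Re (u i) - l1) ^ 2 + (Im (u i) - l2) ^ 2 <= (K * / INR (S i)) ^ 2).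
{ assert (Z := fun H => is_lim_seq_le _ _ _ _ H L R). cbn [Rbar_le] in Z. apply Z. intros j.
  specialize (H i j). pose proof (Cmod_sqr (u i - u j)%C) as E.
  change (Re (u i - u j)%C) with (Re (u i) - Re (u j)) in E.
  change (Im (u i - u j)%C) with (Im (u i) - Im (u j)) in E.
  cbv beta. rewrite <- E. apply (pow_incr _ _ 2); split; auto using Cmod_ge_0. }
pose proof (Cmod_sqr (u i - (l1, l2))%C) as E'.
change (Re (u i - (l1, l2))%C) with (Re (u i) - l1) in E'.
change (Im (u i - (l1, l2))%C) with (Im (u i) - l2) in E'.
assert (0 <= K * / INR (S i)).
{ apply Rmult_le_pos; auto. left; apply Rinv_0_lt_compat. pose proof (INR_ge1 i); lra. }
pose proof (Cmod_ge_0 (u i - (l1, l2))%C). nra.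
Qed.

(** * Coefficients of a uniform limit *)

(** The restriction to [eps <= 1] lets higher powers of [eps] be absorbed into a linear error. *)
Lemma le_of_le_add_eps x y K : (forall eps, 0 < eps <= 1 -> x <= y + eps * K) -> x <= y.
Proof.
intros H. destruct (Rle_dec x y) as [h|h]; auto. exfalso.
assert (HK : 0 < K) by (specialize (H 1); lra).
assert (Hd : 0 < (x - y) / (2 * K)) by (apply Rdiv_lt_0_compat; lra).
specialize (H (Rmin 1 ((x - y) / (2 * K)))).
assert (A : Rmin 1 ((x - y) / (2 * K)) <= (x - y) / (2 * K)) by apply Rmin_r.
assert (B : 0 < Rmin 1 ((x - y) / (2 * K)) <= 1).
{ split; [apply Rmin_glb_lt; lra|apply Rmin_l]. }
specialize (H B).
assert (D : (x - y) / (2 * K) * K = (x - y) / 2) by (field; lra).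
nra.
Qed.

Lemma rsum_term f n k : (forall i, 0 <= f i) -> (k < n)%nat -> f k <= rsum f n.
Proof.
intros H Hk. apply Rle_trans with (rsum f (S k)).
- simpl. pose proof (rsum_pos f k (fun i _ => H i)). lra.
- apply rsum_incr; auto.
Qed.

Lemma coef_bound (p b : nat -> C) sig eps k : 0 <= eps ->
  (forall J, rsum (fun k => Cmod (p (S k) - b (S k))%C ^ 2 * wt sig k) J <= eps ^ 2) ->
  Cmod (p (S k) - b (S k))%C <= eps * Rpower (INR (S k)) sig.
Proof.
intros He H. specialize (H (S k)).
assert (H1 := rsum_term (fun k => Cmod (p (S k) - b (S k))%C ^ 2 * wt sig k) (S k) k).
cbv beta in H1. rewrite <- wt_sqr in H1.
assert (E : Rpower (INR (S k)) (- sig) * Rpower (INR (S k)) sig = 1).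
{ rewrite <- Rpower_plus, Rplus_opp_l. apply Rpower_O. pose proof (INR_ge1 k); lra. }
assert (P1 : 0 < Rpower (INR (S k)) (- sig)) by apply exp_pos.
assert (P2 : 0 < Rpower (INR (S k)) sig) by apply exp_pos.
set (c := Cmod (p (S k) - b (S k))%C) in *.
assert (Hc : 0 <= c) by apply Cmod_ge_0.
set (u := Rpower (INR (S k)) (- sig)) in *. set (v := Rpower (INR (S k)) sig) in *.
assert (H2 : (c * u) ^ 2 <= eps ^ 2).
{ rewrite Rpow_mult_distr. eapply Rle_trans; [apply H1|exact H]; auto.
  intros i. apply Rmult_le_pos; [apply pow2_ge_0|left; apply wt_pos]. }
assert (H3 : c * u <= eps) by nra.
replace c with (c * u * v) by (rewrite Rmult_assoc, E; ring). nra.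
Qed.

Lemma is_lim_seq_rsum (f : nat -> nat -> R) (l : nat -> R) n :
  (forall k, is_lim_seq (f k) (l k)) ->
  is_lim_seq (fun j => rsum (fun k => f k j) n) (rsum l n).
Proof.
intros H. induction n as [|n IH]; simpl; [apply is_lim_seq_const|].
apply is_lim_seq_plus'; auto.
Qed.

Lemma is_lim_seq_Cmod (u : nat -> C) l K :
  (forall i, Cmod (u i - l)%C <= K * / INR (S i)) -> is_lim_seq (fun i => Cmod (u i)) (Cmod l).
Proof.
intros H.
assert (Z : is_lim_seq (fun j => K * / INR (S j)) 0).
{ replace (Finite 0) with (Finite (K * 0)) by (f_equal; ring).
  apply (is_lim_seq_scal_l _ K 0), is_lim_seq_inv_INR. }
apply is_lim_seq_le_le with (fun j => Cmod l - K * / INR (S j)) (fun j => Cmod l + K * / INR (S j)).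
- intros j. specialize (H j).
  assert (A : Cmod (u j) <= Cmod l + Cmod (u j - l)%C).
  { eapply Rle_trans; [|apply Cmod_triangle]. right; f_equal; ring. }
  assert (B : Cmod l <= Cmod (u j) + Cmod (u j - l)%C).
  { rewrite <- (Cmod_opp (u j - l)%C). eapply Rle_trans; [|apply Cmod_triangle]. right; f_equal; ring. }
  lra.
- replace (Finite (Cmod l)) with (Finite (Cmod l - 0)) by (f_equal; ring).
  apply is_lim_seq_minus'; auto. apply is_lim_seq_const.
- replace (Finite (Cmod l)) with (Finite (Cmod l + 0)) by (f_equal; ring).
  apply is_lim_seq_plus'; auto. apply is_lim_seq_const.
Qed.

Lemma is_lim_seq_le_eventually (u v : nat -> R) (l1 l2 : R) :
  eventually (fun n => u n <= v n) -> is_lim_seq u l1 -> is_lim_seq v l2 -> l1 <= l2.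
Proof. intros H H1 H2. exact (is_lim_seq_le_loc _ _ _ _ H H1 H2). Qed.

Lemma inv_INR_pos k : 0 < / INR (S k).
Proof. apply Rinv_0_lt_compat. pose proof (INR_ge1 k); lra. Qed.

Lemma inv_INR_le1 k : / INR (S k) <= 1.
Proof. rewrite <- Rinv_1. apply Rinv_le_contravar; [lra|apply INR_ge1]. Qed.

(* Cauchy-Schwarz in its AM-GM form, free of square roots. *)
Lemma weighted_cs (d : nat -> C) s sig (e : nat -> R) del J : 0 < del -> (forall k, 0 <= e k) ->
  (forall k, d k = RtoC 0 \/ Rpower (INR (S k)) (- (2 * (Re s - sig))) <= e k) ->
  Cmod (csum (fun k => d k * npow (S k) s)%C J) <=
  / 2 * (/ del * rsum (fun k => Cmod (d k) ^ 2 * wt sig k) J + del * rsum e J).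
Proof.
intros Hdel He Hd.
rewrite <- !rsum_scal, <- rsum_plus, <- rsum_scal.
eapply Rle_trans; [apply Cmod_csum|]. apply rsum_le; intros k _.
rewrite Cmod_mult, Cmod_npow. destruct (Hd k) as [-> | HT].
- rewrite Cmod_0, Rmult_0_l. specialize (He k). assert (0 <= del * e k) by nra. simpl. lra.
- replace (- Re s) with (- sig + - (Re s - sig)) by ring. rewrite Rpower_plus.
  fold (wt (Re s - sig) k) in HT. rewrite <- !wt_sqr in *.
  set (u := Rpower _ (- sig)) in *. set (v := Rpower _ (- (Re s - sig))) in *.
  set (c := Cmod (d k)) in *.
  assert (K : 2 * del * (c * (u * v)) <= (c * u) ^ 2 + del ^ 2 * v ^ 2).
  { pose proof (pow2_ge_0 (c * u - del * v)). nra. }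
  apply Rmult_le_reg_l with (2 * del); [lra|].
  replace (2 * del * (/ 2 * (/ del * (c ^ 2 * u ^ 2) + del * e k))) with
    ((c * u) ^ 2 + del ^ 2 * e k) by (field; lra).
  assert (del ^ 2 * v ^ 2 <= del ^ 2 * e k) by (apply Rmult_le_compat_l; [apply pow2_ge_0|auto]).
  lra.
Qed.

(** Only finitely many terms occur, so the inequality passes to the limit. It is required eventually
    only, since an approximant is valid on a given half-plane from some index on. *)
Lemma l2_limit (u : nat -> nat -> C) (l p : nat -> C) (K w : nat -> R) e J :
  (forall k i, Cmod (u i k - l k)%C <= K k * / INR (S i)) ->
  eventually (fun j => rsum (fun k => Cmod (p k - u j k)%C ^ 2 * w k) J <= (e + / INR (S j)) ^ 2) ->
  rsum (fun k => Cmod (p k - l k)%C ^ 2 * w k) J <= e ^ 2.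
Proof.
intros Hl H.
apply (is_lim_seq_le_eventually _ _ _ _ H).
- apply (is_lim_seq_rsum (fun k j => Cmod (p k - u j k)%C ^ 2 * w k)
    (fun k => Cmod (p k - l k)%C ^ 2 * w k)).
  intros k. apply (is_lim_seq_scal_r _ (w k) (Cmod (p k - l k)%C ^ 2)).
  assert (Z : is_lim_seq (fun j => Cmod (p k - u j k)%C) (Cmod (p k - l k)%C)).
  { apply is_lim_seq_Cmod with (K k). intros i.
    replace (p k - u i k - (p k - l k))%C with (- (u i k - l k))%C by ring.
    rewrite Cmod_opp; auto. }
  apply (is_lim_seq_ext (fun j => Cmod (p k - u j k)%C * Cmod (p k - u j k)%C)); [intros; ring|].
  replace (Cmod (p k - l k)%C ^ 2) with (Cmod (p k - l k)%C * Cmod (p k - l k)%C) by ring.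
  apply is_lim_seq_mult'; auto.
- assert (Z : is_lim_seq (fun j => e + / INR (S j)) e).
  { replace (Finite e) with (Finite (e + 0)) by (f_equal; ring).
    apply is_lim_seq_plus'; [apply is_lim_seq_const|apply is_lim_seq_inv_INR]. }
  apply (is_lim_seq_ext (fun j => (e + / INR (S j)) * (e + / INR (S j)))); [intros; ring|].
  replace (e ^ 2) with (e * e) by ring. apply is_lim_seq_mult'; auto.
Qed.

Section Coefficients.
Variable T : nat -> Prop.
Variable F : option C -> C.
Hypothesis HF : forall sig, 0 < sig -> unif_approx T sig F.

(** Diagonal choice: the [j]-th polynomial has accuracy [1/(j+1)] on [Re s >= 1/(j+1)], so a single
    sequence serves every [sig] and its coefficients converge. *)
Lemma bohr_coef_exists : exists b, bohr_coef F b /\ forall k, ~ T (S k) -> b (S k) = RtoC 0.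
Proof.
destruct (functional_choice (fun (j : nat) (pN : (nat -> C) * nat) =>
  supp T (fst pN) (snd pN) /\
  forall s, / INR (S j) <= Re s ->
    Cmod (F (Some s) - dpoly (fst pN) (snd pN) (Some s))%C <= / INR (S j))) as [u Hu].
{ intros j. destruct (HF (/ INR (S j)) (inv_INR_pos j) (/ INR (S j)) (inv_INR_pos j))
    as (P & (p & N & Hp & HP) & H).
  exists (p, N); split; auto. intros s Hs; simpl. rewrite <- HP. apply H; auto. }
assert (Hc : forall k, exists l, forall i, Cmod (fst (u i) (S k) - l)%C <= INR (S k) * / INR (S i)).
{ intros k. apply C_cauchy_limit; [apply pos_INR|]. intros i j.
  (* All the half-planes contain [Re s >= 1]; comparing there costs the factor [(k+1)^1]. *)
  rewrite <- (Rpower_1 (INR (S k))) by (pose proof (INR_ge1 k); lra).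
  rewrite (Rmult_comm (Rpower _ _)).
  pose proof (inv_INR_pos i). pose proof (inv_INR_pos j).
  pose proof (inv_INR_le1 i). pose proof (inv_INR_le1 j).
  apply coef_bound; [lra|]. destruct (Hu i), (Hu j).
  eapply (approx_diff T T F); eauto; try lra; intros s Hs.
  - apply H4; lra.
  - apply H6; lra. }
apply functional_choice in Hc. destruct Hc as [l Hl].
exists (fun n => l (pred n)); split.
- intros U sig eps p N Hsig Heps Hp H J. simpl pred.
  apply (l2_limit (fun j k => fst (u j) (S k)) l (fun k => p (S k)) (fun k => INR (S k))); [exact Hl|].
  destruct (INR_unbounded (/ sig)) as [n Hn]. exists n; intros j Hj.
  destruct (Hu j) as [Hu1 Hu2].
  eapply (approx_diff U T F); eauto; try lra; [left; apply inv_INR_pos|]. intros s Hs.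
  apply Hu2. apply Rle_trans with sig; auto. rewrite <- (Rinv_inv sig).
  apply Rinv_le_contravar; [apply Rinv_0_lt_compat; auto|].
  apply le_INR in Hj. rewrite S_INR; lra.
- intros k Hk. simpl. apply Cmod_eq_0.
  assert (Z : is_lim_seq (fun j => Cmod (fst (u j) (S k))) (Cmod (l k))).
  { apply is_lim_seq_Cmod with (INR (S k)); auto. }
  apply (is_lim_seq_ext _ (fun _ => 0)) in Z.
  + apply is_lim_seq_unique in Z. rewrite Lim_seq_const in Z. injection Z; auto.
  + intros j. destruct (Hu j) as [[_ Hu1] _]. rewrite Hu1, Cmod_0; auto.
Qed.

(** Cauchy-Schwarz over the frequencies in [T] only, [e] majorizing [n^(-2(Re s - sig))] there. Over
    all integers a finite [D] requires [Re s > 1/2]; over the powers of 2 the sum is geometric and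
    every [Re s > 0] is admissible. *)
Lemma bohr_coef_partial_sums b s sig (e : nat -> R) D : bohr_coef F b -> (forall k, ~ T (S k) -> b (S k) = RtoC 0) ->
  0 < sig <= Re s -> (forall k, 0 <= e k) ->
  (forall k, T (S k) -> Rpower (INR (S k)) (- (2 * (Re s - sig))) <= e k) ->
  (forall J, rsum e J <= D) ->
  forall eps, 0 < eps -> exists J0, forall J, (J0 <= J)%nat ->
    Cmod (csum (dterm b s) J - F (Some s))%C <= eps.
Proof.
intros Hb HbT Hsig He HeT HD eps Heps.
assert (HD0 : 0 <= D) by (apply (HD 0%nat)).
set (del := eps / (2 + D)).
assert (Hdel : 0 < del) by (apply Rdiv_lt_0_compat; lra).
destruct (HF sig ltac:(lra) del Hdel) as (P & (p & N & Hp & HP) & H).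
assert (HbJ := Hb T sig del p N ltac:(lra) ltac:(lra) Hp).
exists N; intros J HJ.
replace (csum (dterm b s) J - F (Some s))%C with
  (- (F (Some s) - dpoly p N (Some s)) + - (dpoly p N (Some s) - csum (dterm b s) J))%C by ring.
eapply Rle_trans; [apply Cmod_triangle|]. rewrite !Cmod_opp.
assert (A : Cmod (F (Some s) - dpoly p N (Some s))%C <= del).
{ rewrite <- HP. apply H. simpl; lra. }
assert (B : Cmod (dpoly p N (Some s) - csum (dterm b s) J)%C <= / 2 * (del + del * D)).
{ rewrite <- (dpoly_pad T p N J) by auto.
  replace (dpoly p J (Some s) - csum (dterm b s) J)%C
    with (csum (fun k => (p (S k) - b (S k)) * npow (S k) s)%C J).
  2:{ unfold dpoly, dterm, mono. 
      replace (csum (fun k => p (S k) * npow (S k) s)%C J - csum (fun k => b (S k) * npow (S k) s)%C J)%C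
       with (csum (fun k => p (S k) * npow (S k) s)%C J + (-(1)) * csum (fun k => b (S k) * npow (S k) s)%C J)%C by ring.
      rewrite <- csum_scal, <- csum_plus. apply csum_ext; intros; ring. }
  eapply Rle_trans.
  { apply (weighted_cs _ s sig e del J Hdel He). intros k.
    destruct (Classical_Prop.classic (T (S k))) as [HT|HT]; [right; auto|left].
    destruct Hp as [_ Hp]. rewrite Hp, HbT by auto. ring. }
  apply Rmult_le_compat_l; [lra|]. apply Rplus_le_compat.
  - apply Rmult_le_reg_l with del; auto. rewrite <- Rmult_assoc, Rinv_r, Rmult_1_l by lra.
    replace (del * del) with (del ^ 2) by ring. apply HbJ. intros s' Hs'. rewrite <- HP. apply H; auto.
  - apply Rmult_le_compat_l; [lra|auto]. }
assert (E : del * (2 + D) = eps) by (unfold del; field; lra).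
nra.
Qed.

(** Linearity, by comparing approximants on [Re s >= 1]; the factor 4 in the proof collects the
    errors [1 + 1 + 2]. *)
Lemma bohr_coef_minus G H b d b' : (forall sig, 0 < sig -> unif_approx T sig G) ->
  (forall s, H (Some s) = (F (Some s) - G (Some s))%C) ->
  bohr_coef F b -> bohr_coef G d -> bohr_coef H b' -> forall k, b' (S k) = (b (S k) - d (S k))%C.
Proof.
intros HG EH Hb Hd Hb' k.
assert (Z : Cmod (b' (S k) - (b (S k) - d (S k)))%C <= 0).
{ apply le_of_le_add_eps with (4 * Rpower (INR (S k)) 1). intros eps Heps. rewrite Rplus_0_l.
  destruct (HF 1 ltac:(lra) eps ltac:(lra)) as (P & (p & N & Hp & HP) & KP).
  destruct (HG 1 ltac:(lra) eps ltac:(lra)) as (Q & (q & M & Hq & HQ) & KQ).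
  assert (A1 := coef_bound p b 1 eps k ltac:(lra) (Hb T 1 eps p N ltac:(lra) ltac:(lra) Hp
    (fun s Hs => eq_ind _ (fun z => Cmod (F (Some s) - z)%C <= eps) (KP (Some s) Hs) _ (HP (Some s))))).
  assert (A2 := coef_bound q d 1 eps k ltac:(lra) (Hd T 1 eps q M ltac:(lra) ltac:(lra) Hq
    (fun s Hs => eq_ind _ (fun z => Cmod (G (Some s) - z)%C <= eps) (KQ (Some s) Hs) _ (HQ (Some s))))).
  assert (A3 : Cmod (p (S k) - q (S k) - b' (S k))%C <= (2 * eps) * Rpower (INR (S k)) 1).
  { apply (coef_bound (fun n => p n - q n)%C); [lra|].
    apply (Hb' (fun _ => True) 1 (2 * eps) (fun n => p n - q n)%C (max N M)); try lra.
    - eapply supp_minus; eauto.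
    - intros s Hs. rewrite dpoly_minus, (dpoly_pad T p N (max N M)), (dpoly_pad T q M (max N M)); auto; try lia.
      rewrite EH, <- HP, <- HQ.
      replace (F (Some s) - G (Some s) - (P (Some s) - Q (Some s)))%C with
        ((F (Some s) - P (Some s)) + - (G (Some s) - Q (Some s)))%C by ring.
      eapply Rle_trans; [apply Cmod_triangle|]. rewrite Cmod_opp.
      pose proof (KP (Some s) Hs). pose proof (KQ (Some s) Hs). lra. }
  replace (b' (S k) - (b (S k) - d (S k)))%C with
    (- (p (S k) - q (S k) - b' (S k)) + ((p (S k) - b (S k)) + - (q (S k) - d (S k))))%C by ring.
  eapply Rle_trans; [apply Cmod_triangle|].
  assert (A4 := Cmod_triangle (p (S k) - b (S k))%C (- (q (S k) - d (S k)))%C).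
  rewrite Cmod_opp in A4. rewrite Cmod_opp. lra. }
pose proof (Cmod_ge_0 (b' (S k) - (b (S k) - d (S k)))%C).
assert (E : (b' (S k) - (b (S k) - d (S k)))%C = RtoC 0) by (apply Cmod_eq_0; lra).
replace (b' (S k)) with (b' (S k) - (b (S k) - d (S k)) + (b (S k) - d (S k)))%C by ring.
rewrite E; ring.
Qed.

(* Parseval on vertical lines turns a pointwise majorant Re G of |F|^2 into the bound
   Re G(+infinity) for the H^2 norm of F, since the mean of G is its constant term. *)
Lemma bohr_coef_norm_le G b : (forall sig, 0 < sig -> unif_approx T sig G) -> bohr_coef F b ->
  (forall s, 0 < Re s -> Cmod (F (Some s)) ^ 2 <= Re (G (Some s))) ->
  forall J, rsum (fun k => Cmod (b (S k)) ^ 2) J <= Re (G None).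
Proof.
intros HG Hb Hmaj J. set (V := Re (G None)).
assert (W : forall sig, 0 < sig -> rsum (fun k => Cmod (b (S k)) ^ 2 * wt sig k) J <= V).
(* The final estimate expands to [V + (2 eps + eps^2) V + 4 eps + 7 eps^2 + 3 eps^3], whence
   [3 |V| + 14]. *)
{ intros sig Hsig. apply le_of_le_add_eps with (3 * Rabs V + 14). intros eps Heps.
  destruct (HF sig Hsig eps ltac:(lra)) as (P & (p & N & Hp & HP) & KP).
  destruct (HG sig Hsig eps ltac:(lra)) as (Q & (q & M & Hq & HQ) & KQ).
  assert (HbJ : rsum (fun k => Cmod (p (S k) - b (S k))%C ^ 2 * wt sig k) J <= eps ^ 2).
  { apply (Hb T sig eps p N); auto; try lra. intros s Hs; rewrite <- HP; apply (KP (Some s)); auto. }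
  assert (HK : exists K, K = max (S J) (max N M)) by eauto. destruct HK as [K HK].
  assert (Hmean : rsum (fun k => Cmod (p (S k)) ^ 2 * wt sig k) K <= (1 + eps) * (V + 2 * eps) + eps + eps ^ 2).
  { change (Re (RtoC (rsum (fun k => Cmod (p (S k)) ^ 2 * wt sig k) K)) <= (1 + eps) * (V + 2 * eps) + eps + eps ^ 2).
    rewrite <- (parseval p K K) by lia.
    apply Rle_trans with (Re (mean (freqs K) (fun t => RtoC (1 + eps) * dpoly q K (Some (sig, t)) +
       RtoC ((1 + eps) * eps + eps + eps ^ 2))%C)).
    - apply Re_mean_le; intros t.
      assert (D : sig <= Re (sig, t)) by (simpl; lra).
      assert (E1 := KP (Some (sig, t)) D). assert (E2 := KQ (Some (sig, t)) D).
      assert (E3 := Hmaj (sig, t) ltac:(simpl; lra)).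
      rewrite (dpoly_pad T p N K), (dpoly_pad T q M K), <- HP, <- HQ; auto; try lia.
      set (f := F (Some (sig, t))) in *. set (g := G (Some (sig, t))) in *.
      set (x := P (Some (sig, t))) in *. set (y := Q (Some (sig, t))) in *.
      assert (E4 : Cmod x <= Cmod f + eps).
      { replace x with (f + - (f - x))%C by ring. eapply Rle_trans; [apply Cmod_triangle|].
        rewrite Cmod_opp; lra. }
      assert (E5 : Re g <= Re y + eps).
      { assert (Rabs (Re (g - y)%C) <= eps).
        { eapply Rle_trans; [|apply E2]. eapply Rle_trans; [|apply Rmax_Cmod]. apply Rmax_l. }
        apply Rabs_le_between in H. unfold Re in *; simpl in H. lra. }
      pose proof (Cmod_ge_0 x). pose proof (Cmod_ge_0 f).
      (* By [2 eps |f| <= eps (|f|^2 + 1)]: the cross term is charged to [|f|^2], which has a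
         majorant. *)
      assert (E6 : Cmod x ^ 2 <= (1 + eps) * Cmod f ^ 2 + eps + eps ^ 2).
      { assert (Cmod x ^ 2 <= (Cmod f + eps) ^ 2) by (apply pow_incr; lra).
        pose proof (pow2_ge_0 (Cmod f - 1)). nra. }
      apply Rle_trans with ((1 + eps) * Re y + ((1 + eps) * eps + eps + eps ^ 2)).
      + change (Cmod x ^ 2 <= (1 + eps) * Re y + ((1 + eps) * eps + eps + eps ^ 2)).
        assert (E7 : (1 + eps) * Cmod f ^ 2 <= (1 + eps) * (Re y + eps)).
        { apply Rmult_le_compat_l; [lra|]. apply Rle_trans with (Re g); [exact E3|exact E5]. }
        lra.
      + right. unfold Re; simpl; ring.
    - rewrite mean_plus, mean_scal, mean_const, mean_dpoly by lia.
      (* At the point at infinity the approximation compares the constant term [q 1] with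
         [G None]. *)
      assert (E2 := KQ None I). rewrite HQ, <- (dpoly_pad T q M K), dpoly_inf in E2 by (auto; lia).
      assert (E5 : Re (q 1%nat) <= V + eps).
      { assert (Rabs (Re (G None - q 1%nat)%C) <= eps).
        { eapply Rle_trans; [|apply E2]. eapply Rle_trans; [|apply Rmax_Cmod]. apply Rmax_l. }
        apply Rabs_le_between in H. unfold V, Re in *; simpl in H. lra. }
      unfold Re in *; simpl fst. nra. }
  assert (Hle : rsum (fun k => Cmod (b (S k)) ^ 2 * wt sig k) J <=
     (1 + eps) * rsum (fun k => Cmod (p (S k)) ^ 2 * wt sig k) J +
     (1 + / eps) * rsum (fun k => Cmod (p (S k) - b (S k))%C ^ 2 * wt sig k) J).
  { rewrite <- !rsum_scal, <- rsum_plus. apply rsum_le; intros k _.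
    pose proof (wt_pos sig k).
    assert (E : Cmod (b (S k)) <= Cmod (p (S k)) + Cmod (p (S k) - b (S k))%C).
    { replace (b (S k)) with (p (S k) + - (p (S k) - b (S k)))%C at 1 by ring.
      eapply Rle_trans; [apply Cmod_triangle|]. rewrite Cmod_opp; lra. }
    assert (E' : Cmod (b (S k)) ^ 2 <= (1 + eps) * Cmod (p (S k)) ^ 2 + (1 + / eps) * Cmod (p (S k) - b (S k))%C ^ 2).
    { set (x := Cmod (p (S k))) in *. set (y := Cmod (p (S k) - b (S k))%C) in *.
      assert (Cmod (b (S k)) ^ 2 <= (x + y) ^ 2) by (apply pow_incr; split; auto using Cmod_ge_0).
      assert (0 <= / eps * (eps * x - y) ^ 2).
      { apply Rmult_le_pos; [left; apply Rinv_0_lt_compat; lra|apply pow2_ge_0]. }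
      replace (/ eps * (eps * x - y) ^ 2) with (eps * x ^ 2 - 2 * x * y + / eps * y ^ 2) in H1 by (field; lra).
      lra. }
    nra. }
  assert (HJ : rsum (fun k => Cmod (p (S k)) ^ 2 * wt sig k) J <= rsum (fun k => Cmod (p (S k)) ^ 2 * wt sig k) K).
  { apply rsum_incr; [|lia]. intros k. apply Rmult_le_pos; [apply pow2_ge_0|left; apply wt_pos]. }
  assert (Hl : (1 + / eps) * rsum (fun k => Cmod (p (S k) - b (S k))%C ^ 2 * wt sig k) J <= eps ^ 2 + eps).
  { replace (eps ^ 2 + eps) with ((1 + / eps) * eps ^ 2) by (field; lra).
    apply Rmult_le_compat_l; auto. assert (0 < / eps) by (apply Rinv_0_lt_compat; lra). lra. }
  assert (HV : V <= Rabs V) by apply RRle_abs.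
  assert (HV0 : 0 <= Rabs V) by apply Rabs_pos.
  set (X := rsum (fun k => Cmod (b (S k)) ^ 2 * wt sig k) J) in *.
  assert (X <= (1 + eps) * ((1 + eps) * (V + 2 * eps) + eps + eps ^ 2) + (eps ^ 2 + eps)).
  { eapply Rle_trans; [apply Hle|]. apply Rplus_le_compat; auto. apply Rmult_le_compat_l; lra. }
  assert (Hsq : 0 <= eps ^ 2 <= eps) by nra.
  assert (Hcu : 0 <= eps ^ 3 <= eps) by (simpl; nra).
  assert (V * eps <= Rabs V * eps) by nra.
  assert (V * eps ^ 2 <= Rabs V * eps).
  { apply Rle_trans with (Rabs V * eps ^ 2); [apply Rmult_le_compat_r|apply Rmult_le_compat_l]; lra. }
  simpl in *. lra. }
(* With [J] fixed, [sig] tends to 0: [wt sig k >= 1 - 2 sig ln(k+1) >= 1 - sig L]. *)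
set (L := 2 * INR J).
apply le_of_le_add_eps with (L * rsum (fun k => Cmod (b (S k)) ^ 2) J).
intros sig Hsig. specialize (W sig ltac:(lra)).
assert (Hw : (1 - sig * L) * rsum (fun k => Cmod (b (S k)) ^ 2) J <= rsum (fun k => Cmod (b (S k)) ^ 2 * wt sig k) J).
{ rewrite <- rsum_scal. apply rsum_le; intros k Hk.
  rewrite Rmult_comm. apply Rmult_le_compat_l; [apply pow2_ge_0|].
  unfold wt, Rpower. eapply Rle_trans; [|apply exp_ineq1_le].
  assert (ln (INR (S k)) <= INR J).
  { apply Rle_trans with (INR (S k)); [|apply le_INR; lia].
    pose proof (INR_ge1 k). pose proof (exp_ineq1_le (ln (INR (S k)))) as E.
    rewrite exp_ln in E; lra. }
  pose proof (ln_INR_pos k). unfold L. nra. }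
lra.
Qed.
End Coefficients.

(** * Estimates for power sums *)

(** The tangent of [exp] at [p L] lies below the graph at 0 and, strictly, at [L]; the two bounds
    are combined with weights [1 - p] and [p]. *)
Lemma exp_chord_strict L p : 0 < p < 1 -> L <> 0 -> exp (p * L) < p * exp L + (1 - p).
Proof.
intros Hp HL.
assert (A : 1 + (L - p * L) < exp (L - p * L)).
{ apply exp_ineq1. replace (L - p * L) with ((1 - p) * L) by ring. apply Rmult_integral_contrapositive_currified; lra. }
assert (B : 1 + - (p * L) <= exp (- (p * L))) by apply exp_ineq1_le.
assert (C : exp (p * L) * exp (L - p * L) = exp L) by (rewrite <- exp_plus; f_equal; ring).
assert (D : exp (p * L) * exp (- (p * L)) = 1) by (rewrite <- exp_plus, Rplus_opp_r; apply exp_0).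
pose proof (exp_pos (p * L)) as P.
rewrite <- C.
set (e := exp (p * L)) in *.
assert (p * (e * (1 + (L - p * L))) < p * (e * exp (L - p * L))).
{ apply Rmult_lt_compat_l; [lra|]. apply Rmult_lt_compat_l; auto. }
assert ((1 - p) * (e * (1 + - (p * L))) <= (1 - p) * (e * exp (- (p * L)))).
{ apply Rmult_le_compat_l; [lra|]. apply Rmult_le_compat_l; lra. }
replace (p * (e * exp (L - p * L)) + (1 - p)) with
  (p * (e * exp (L - p * L)) + (1 - p) * (e * exp (- (p * L)))) by (rewrite D; ring).
replace e with (p * (e * (1 + (L - p * L))) + (1 - p) * (e * (1 + - (p * L)))) at 1 by ring.
lra.
Qed.

(** Bernoulli's inequality, from the chord bound with [L = ln y]; the cases split off are those of
    equality. *)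
Lemma Rpower_le_linear y p : 0 < y -> 0 <= p <= 1 -> Rpower y p <= 1 + p * (y - 1).
Proof.
intros Hy Hp. unfold Rpower.
destruct (Req_dec p 0) as [->|H0]; [rewrite Rmult_0_l, exp_0; lra|].
destruct (Req_dec p 1) as [->|H1]; [rewrite Rmult_1_l, exp_ln; lra|].
destruct (Req_dec y 1) as [->|H2]; [rewrite ln_1, Rmult_0_r, exp_0; lra|].
assert (HL : ln y <> 0).
{ intros E. apply H2. rewrite <- (exp_ln y) by auto. rewrite E; apply exp_0. }
pose proof (exp_chord_strict (ln y) p ltac:(lra) HL) as H. rewrite exp_ln in H; lra.
Qed.

Lemma Rpower_pos x y : 0 < Rpower x y.
Proof. apply exp_pos. Qed.

Lemma Rpower_neg_le1 x a : 1 <= x -> 0 <= a -> Rpower x (- a) <= 1.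
Proof.
intros Hx Ha. rewrite <- (Rpower_O x) by lra. destruct (Req_dec x 1) as [->|].
- unfold Rpower. rewrite ln_1, !Rmult_0_r; lra.
- apply Rle_Rpower; lra.
Qed.

(** Midpoint rule for the convex function [x^(-1-a)] on [[1 - t, 1 + t]], multiplied by [a]. The
    derivative is nonnegative because [X Y = (1 - c^2)^(-1-a) >= 1] forces [X + Y >= 2]. *)
Lemma midpoint_scaled a t : 0 < a -> 0 <= t < 1 ->
  2 * a * t <= Rpower (1 - t) (- a) - Rpower (1 + t) (- a).
Proof.
intros Ha Ht. destruct (Req_dec t 0) as [->|Hn].
{ rewrite Rminus_0_r, Rplus_0_r. lra. }
set (D := fun u => Rpower (1 - u) (- a) - Rpower (1 + u) (- a) - 2 * a * u).
destruct (MVT_cor2 D (fun u => a * (Rpower (1 - u) (- a) / (1 - u) + Rpower (1 + u) (- a) / (1 + u) - 2)) 0 t)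
  as (c & E & Hc); [lra| |].
- intros c Hc. unfold D, Rpower. apply is_derive_Reals. auto_derive; [lra|]. unfold Rminus. field; lra.
- unfold D in E. rewrite Rminus_0_r, Rplus_0_r in E.
  set (X := Rpower (1 - c) (- a) / (1 - c)) in *. set (Y := Rpower (1 + c) (- a) / (1 + c)) in *.
  assert (PX : 0 < X) by (apply Rdiv_lt_0_compat; [apply Rpower_pos|lra]).
  assert (PY : 0 < Y) by (apply Rdiv_lt_0_compat; [apply Rpower_pos|lra]).
  assert (HXY : 1 <= X * Y).
  { unfold X, Y. 
    replace (Rpower (1 - c) (- a) / (1 - c) * (Rpower (1 + c) (- a) / (1 + c))) with
      ((Rpower (1 - c) (- a) * Rpower (1 + c) (- a)) / ((1 - c) * (1 + c))) by (field; lra).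
    rewrite Rpower_mult_distr by lra.
    set (v := (1 - c) * (1 + c)). assert (Hv : 0 < v <= 1) by (unfold v; nra).
    assert (A : 1 <= Rpower v (- a)).
    { unfold Rpower. rewrite <- exp_0. apply exp_monotone.
      assert (ln v <= 0). { rewrite <- ln_1. destruct (Req_dec v 1) as [->|]; [lra|]. left; apply ln_increasing; lra. }
      nra. }
    apply Rmult_le_reg_r with v; [lra|]. unfold Rdiv. rewrite Rmult_assoc, Rinv_l; lra. }
  assert (2 <= X + Y).
  { assert (4 <= (X + Y) ^ 2) by (pose proof (pow2_ge_0 (X - Y)); nra). nra. }
  assert (0 <= a * (X + Y - 2) * t) by (apply Rmult_le_pos; nra). lra.
Qed.

Lemma Rpower_inv_base x a : 0 < x -> Rpower (/ x) a = Rpower x (- a).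
Proof. intros Hx. unfold Rpower. rewrite ln_Rinv by auto. f_equal; ring. Qed.

Lemma midpoint x a : 0 < a -> 1/2 < x ->
  a * Rpower x (- (1 + a)) <= Rpower (x - 1/2) (- a) - Rpower (x + 1/2) (- a).
Proof.
intros Ha Hx.
pose proof (midpoint_scaled a (1/(2*x)) Ha) as H.
assert (E1 : x - 1/2 = x * (1 - 1/(2*x))) by (field; lra).
assert (E2 : x + 1/2 = x * (1 + 1/(2*x))) by (field; lra).
assert (P : 0 < 1/(2*x) < 1).
{ split; [apply Rdiv_lt_0_compat; lra|]. apply Rmult_lt_reg_r with (2*x); [lra|]. field_simplify; lra. }
rewrite E1, E2. rewrite <- !Rpower_mult_distr by lra.
replace (- (1 + a)) with (-(1) + - a) by ring. rewrite Rpower_plus, Rpower_Ropp, Rpower_1 by lra.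
pose proof (Rpower_pos x (- a)) as Q. specialize (H ltac:(lra)).
replace (a * (/ x * Rpower x (- a))) with (Rpower x (- a) * (2 * a * (1 / (2 * x)))) by (field; lra).
nra.
Qed.

Definition zsum (a : R) (N : nat) : R := rsum (fun k => Rpower (INR (S k)) (- (1 + a))) N.

(** The midpoint rule lets the integral start at [m + 1/2]. Compared with [m^(-a)/a] this gains a
    factor [1 - a/(2m)] to first order, which the rows of the Schur test need when [a > 1]. *)
Lemma zsum_tail a m N : 0 < a -> (m <= N)%nat ->
  zsum a N - zsum a m <= Rpower (INR m + 1/2) (- a) / a.
Proof.
intros Ha H.
assert (G : a * (zsum a N - zsum a m) <= Rpower (INR m + 1/2) (- a) - Rpower (INR N + 1/2) (- a)).
{ induction H as [|N H IH]; [unfold zsum; lra|].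
  assert (M := midpoint (INR (S N)) a Ha).
  pose proof (INR_ge1 N). specialize (M ltac:(lra)).
  rewrite S_INR in M at 2. replace (INR N + 1 - 1/2) with (INR N + 1/2) in M by lra.
  change (zsum a (S N)) with (zsum a N + Rpower (INR (S N)) (- (1 + a))). lra. }
pose proof (Rpower_pos (INR N + 1/2) (- a)).
apply Rmult_le_reg_l with a; auto. replace (a * (Rpower (INR m + 1/2) (- a) / a)) with (Rpower (INR m + 1/2) (- a)) by (field; lra).
lra.
Qed.

Lemma zsum_le a m N : (m <= N)%nat -> zsum a m <= zsum a N.
Proof. intros H. apply rsum_incr; auto. intros; left; apply Rpower_pos. Qed.

Lemma zsum_1 a : zsum a 1 = 1.
Proof. unfold zsum. simpl. unfold Rpower. rewrite ln_1, Rmult_0_r, exp_0; ring. Qed.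

Lemma zsum_bound a N : 0 < a -> zsum a N <= 1 + / a.
Proof.
intros Ha. apply Rle_trans with (zsum a (S N)); [apply zsum_le; lia|].
pose proof (zsum_tail a 1 (S N) Ha ltac:(lia)) as H. rewrite zsum_1 in H.
assert (Rpower (INR 1 + 1/2) (- a) / a <= / a).
{ rewrite <- (Rmult_1_l (/ a)). apply Rmult_le_compat_r; [left; apply Rinv_0_lt_compat; auto|].
  apply Rpower_neg_le1; simpl; lra. }
lra.
Qed.

(** Trapezoidal rule on [[1 - t, 1]] for the concave function [x^(a-1)], multiplied by [a]; the sign
    of the derivative is Bernoulli's inequality at [1/(1 - c)]. *)
Lemma trapezoid_scaled a t : 1 <= a <= 2 -> 0 <= t < 1 ->
  a * t / 2 * (1 + Rpower (1 - t) (a - 1)) <= 1 - Rpower (1 - t) a.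
Proof.
intros Ha Ht. destruct (Req_dec t 0) as [->|Hn].
{ rewrite Rminus_0_r. unfold Rpower. rewrite ln_1, Rmult_0_r, exp_0; lra. }
set (D := fun u => 1 - Rpower (1 - u) a - a * u / 2 * (1 + Rpower (1 - u) (a - 1))).
destruct (MVT_cor2 D (fun u => a * (Rpower (1 - u) a / (1 - u)) - a / 2 * (1 + Rpower (1 - u) (a - 1))
   + a * u / 2 * ((a - 1) * (Rpower (1 - u) (a - 1) / (1 - u)))) 0 t)
  as (c & E & Hc); [lra| |].
- intros c Hc. unfold D, Rpower. apply is_derive_Reals. auto_derive; [lra|]. unfold Rminus. field; lra.
- assert (D0 : D 0 = 0).
  { unfold D. rewrite Rminus_0_r. unfold Rpower. rewrite ln_1, !Rmult_0_r, exp_0; lra. }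
  rewrite D0 in E. fold (D t). 
  assert (E1 : Rpower (1 - c) a / (1 - c) = Rpower (1 - c) (a - 1)).
  { unfold Rminus at 4. rewrite Rpower_plus, Rpower_Ropp, Rpower_1 by lra. reflexivity. }
  rewrite E1 in E.
  set (X := Rpower (1 - c) (a - 1)) in *.
  assert (PX : 0 < X) by apply Rpower_pos.
  assert (I := Rpower_le_linear (/ (1 - c)) (a - 1) ltac:(apply Rinv_0_lt_compat; lra) ltac:(lra)).
  rewrite Rpower_inv_base, Rpower_Ropp in I by lra. fold X in I.
  assert (J : 1 <= X + c * (a - 1) * (X / (1 - c))).
  { replace (X + c * (a - 1) * (X / (1 - c))) with (X * (1 + (a - 1) * (/ (1 - c) - 1))) by (field; lra).
    replace 1 with (X * / X) at 1 by (field; lra). apply Rmult_le_compat_l; lra. }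
  assert (0 <= D t).
  { replace (D t) with (D t - 0) by ring. rewrite E. apply Rmult_le_pos; [|lra].
    replace (a * X - a / 2 * (1 + X) + a * c / 2 * ((a - 1) * (X / (1 - c)))) with
      (a / 2 * (X + c * (a - 1) * (X / (1 - c)) - 1)) by (field; lra).
    apply Rmult_le_pos; lra. }
  unfold D in H. lra.
Qed.

Definition usum (a : R) (N : nat) : R := rsum (fun k => Rpower (INR (S k)) (a - 1)) N.

Lemma Rpower_pred x a : 0 < x -> Rpower x (a - 1) = Rpower x a / x.
Proof. intros Hx. unfold Rminus. rewrite Rpower_plus, Rpower_Ropp, Rpower_1 by lra. reflexivity. Qed.

Lemma usum_1 a : usum a 1 = 1.
Proof. unfold usum. simpl. unfold Rpower. rewrite ln_1, Rmult_0_r, exp_0; ring. Qed.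

(** Trapezoidal rule from 1 on. The constant [1/a - 1/2] gives equality for a single term; it is
    kept because it later absorbs the second-order errors of the rows [m >= 3]. *)
Lemma usum_concave a m : 1 <= a <= 2 ->
  usum a (S m) <= Rpower (INR (S m)) a / a + Rpower (INR (S m)) (a - 1) / 2 - (/ a - / 2).
Proof.
intros Ha. induction m as [|m IH].
{ rewrite usum_1. simpl. unfold Rpower. rewrite ln_1, !Rmult_0_r, exp_0. lra. }
change (usum a (S (S m))) with (usum a (S m) + Rpower (INR (S (S m))) (a - 1)).
pose proof (INR_ge1 m) as P. rewrite (S_INR (S m)) in *.
set (x := INR (S m)) in *.
assert (Ht : 0 <= 1 / (x + 1) < 1).
{ split; [apply Rdiv_le_0_compat; lra|]. apply Rmult_lt_reg_r with (x+1); [lra|]. field_simplify; lra. }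
pose proof (trapezoid_scaled a (1/(x+1)) Ha Ht) as T.
assert (Ex : forall b, Rpower x b = Rpower (x + 1) b * Rpower (1 - 1/(x+1)) b).
{ intros b. rewrite Rpower_mult_distr; try lra. f_equal. field; lra. }
rewrite (Ex a), (Ex (a - 1)) in IH.
rewrite Rpower_pred in * by lra.
set (A := Rpower (x + 1) a) in *. assert (PA : 0 < A) by apply Rpower_pos.
set (v := Rpower (1 - 1/(x+1)) (a - 1)) in *.
rewrite <- (Rpower_pred (1 - 1/(x+1))) in * by lra. fold v in IH, T.
set (w := Rpower (1 - 1/(x+1)) a) in *.
assert (T' : A / a * (a * (1 / (x + 1)) / 2 * (1 + v)) <= A / a * (1 - w)).
{ apply Rmult_le_compat_l; auto. apply Rdiv_le_0_compat; lra. }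
replace (A / a * (a * (1 / (x + 1)) / 2 * (1 + v))) with (A / (x + 1) / 2 + A / (x + 1) * v / 2) in T' by (field; lra).
replace (A / a * (1 - w)) with (A / a - A * w / a) in T' by (field; lra).
lra.
Qed.

(** For [a <= 1] the function [x^(a-1)] does not increase, so each term is at most its integral over
    the preceding unit interval, starting with [[0, 1]]. *)
Lemma usum_convex a m : 0 < a <= 1 -> usum a (S m) <= Rpower (INR (S m)) a / a.
Proof.
intros Ha. induction m as [|m IH].
{ rewrite usum_1. simpl. unfold Rpower. rewrite ln_1, !Rmult_0_r, exp_0.
  apply Rmult_le_reg_r with a; [lra|]. field_simplify; lra. }
change (usum a (S (S m))) with (usum a (S m) + Rpower (INR (S (S m))) (a - 1)).
pose proof (INR_ge1 m) as P. rewrite (S_INR (S m)) in *.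
set (x := INR (S m)) in *.
assert (Ht : 0 <= 1 / (x + 1) < 1).
{ split; [apply Rdiv_le_0_compat; lra|]. apply Rmult_lt_reg_r with (x+1); [lra|]. field_simplify; lra. }
assert (B := Rpower_le_linear (1 - 1/(x+1)) a ltac:(lra) ltac:(lra)).
replace (Rpower x a) with (Rpower (x + 1) a * Rpower (1 - 1/(x+1)) a) in IH.
2:{ rewrite Rpower_mult_distr; try lra. f_equal. field; lra. }
rewrite Rpower_pred by lra.
set (A := Rpower (x + 1) a) in *. assert (PA : 0 < A) by apply Rpower_pos.
set (w := Rpower (1 - 1/(x+1)) a) in *.
assert (T' : A / a * w <= A / a * (1 + a * (1 - 1 / (x + 1) - 1))).
{ apply Rmult_le_compat_l; auto. apply Rdiv_le_0_compat; lra. }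
replace (A / a * (1 + a * (1 - 1 / (x + 1) - 1))) with (A / a - A / (x + 1)) in T' by (field; lra).
replace (A * w / a) with (A / a * w) in IH by (field; lra).
lra.
Qed.

(** * Row sums of the Schur test *)

Lemma Rpower_opp_mul x a : 0 < x -> Rpower x (- a) * Rpower x a = 1.
Proof. intros Hx. rewrite <- Rpower_plus, Rplus_opp_l. apply Rpower_O; auto. Qed.

(** With weights [n^(-1/2)], column [n <= m] contributes [m^(-a) n^(a-1)] and column [n > m]
    contributes [m^a n^(-1-a)]. *)
Definition schur (a : R) (m N : nat) : R :=
  Rpower (INR m) (- a) * usum a m + Rpower (INR m) a * (zsum a N - zsum a m).

Lemma schur_tail a m N : 0 < a -> (1 <= m <= N)%nat ->
  Rpower (INR m) a * (zsum a N - zsum a m) <= Rpower (1 + 1 / (2 * INR m)) (- a) / a.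
Proof.
intros Ha Hm. pose proof (zsum_tail a m N Ha ltac:(lia)) as H.
assert (P : 1 <= INR m) by (apply (le_INR 1); lia).
assert (E : Rpower (INR m + 1/2) (- a) = Rpower (INR m) (- a) * Rpower (1 + 1 / (2 * INR m)) (- a)).
{ rewrite Rpower_mult_distr; try lra.
  - f_equal. field; lra.
  - assert (0 < 1 / (2 * INR m)) by (apply Rdiv_lt_0_compat; lra). lra. }
rewrite E in H. pose proof (Rpower_opp_mul (INR m) a ltac:(lra)) as O.
pose proof (Rpower_pos (INR m) a) as Q.
apply Rle_trans with (Rpower (INR m) a * (Rpower (INR m) (- a) * Rpower (1 + 1 / (2 * INR m)) (- a) / a)).
- apply Rmult_le_compat_l; lra.
- right. transitivity ((Rpower (INR m) (- a) * Rpower (INR m) a) * (Rpower (1 + 1 / (2 * INR m)) (- a) / a)).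
  + field; lra.
  + rewrite O; ring.
Qed.

(** Bernoulli's inequality is applied to [(1 + y)^(-(a-1))] only; the remaining factor [1/(1 + y)]
    stays exact. *)
Lemma Rpower_neg_above1 a y : 1 <= a <= 2 -> 0 <= y ->
  Rpower (1 + y) (- a) <= (1 + (2 - a) * y) / (1 + y) ^ 2.
Proof.
intros Ha Hy.
assert (H := Rpower_le_linear (/ (1 + y)) (a - 1) ltac:(apply Rinv_0_lt_compat; lra) ltac:(lra)).
rewrite Rpower_inv_base in H by lra.
replace (- a) with (- (a - 1) + - (1)) by ring.
rewrite Rpower_plus, (Rpower_Ropp _ 1), Rpower_1 by lra.
replace ((1 + (2 - a) * y) / (1 + y) ^ 2) with ((1 + (a - 1) * (/ (1 + y) - 1)) * / (1 + y)) by (field; lra).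
apply Rmult_le_compat_r; auto. left; apply Rinv_0_lt_compat; lra.
Qed.

Lemma sqrt2_bounds : (1414/1000) < sqrt 2 < (14143/10000).
Proof.
split.
- rewrite <- (sqrt_pow2 (1414/1000)) by lra. apply sqrt_lt_1; lra.
- rewrite <- (sqrt_pow2 (14143/10000)) by lra. apply sqrt_lt_1; lra.
Qed.

(** The uniform estimate for [m >= 3] is too coarse here, so the columns 1 and 2 are kept exactly,
    as [2^(-a) + 1/2], and then bounded numerically. *)
Lemma schur_2 a N : 1 <= a <= (149/100) -> (2 <= N)%nat -> schur a 2 N <= 2 / a.
Proof.
intros Ha HN. unfold schur.
pose proof (schur_tail a 2 N ltac:(lra) ltac:(lia)) as T.
assert (E1 : Rpower (INR 2) (- a) * usum a 2 = Rpower 2 (- a) + 1/2).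
{ unfold usum. simpl rsum. simpl INR.
  replace (1 + 1) with 2 by ring.
  replace (Rpower 1 (a - 1)) with 1 by (unfold Rpower; rewrite ln_1, Rmult_0_r, exp_0; auto).
  rewrite Rpower_pred by lra. pose proof (Rpower_opp_mul 2 a ltac:(lra)).
  replace (Rpower 2 (- a) * (0 + 1 + Rpower 2 a / 2)) with (Rpower 2 (- a) + (Rpower 2 (- a) * Rpower 2 a) / 2) by field.
  rewrite H; lra. }
rewrite E1.
assert (B1 : Rpower (1 + 1 / (2 * INR 2)) (- a) <= (96/100) - (16/100) * a).
{ simpl INR. replace (1 + 1 / (2 * (1 + 1))) with (1 + / 4) by field.
  eapply Rle_trans; [apply Rpower_neg_above1; lra|].
  replace ((1 + / 4) ^ 2) with (25/16) by field. lra. }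
(* Chord of [2^(-a)] between [a = 1] and [a = 3/2], written in base [sqrt 2]; [5857/10000] is
   [2 - 14143/10000]. *)
assert (B2 : Rpower 2 (- a) <= ((14143/10000) + (3 - 2 * a) * (5857/10000)) / 4).
{ pose proof sqrt2_bounds as S.
  assert (Q : sqrt 2 * sqrt 2 = 2) by (apply sqrt_sqrt; lra).
  assert (L := Rpower_le_linear (sqrt 2) (3 - 2 * a) ltac:(lra) ltac:(lra)).
  assert (E : Rpower 2 (- a) = sqrt 2 / 4 * Rpower (sqrt 2) (3 - 2 * a)).
  { rewrite <- Q at 1. rewrite <- Rpower_mult_distr, <- Rpower_plus by lra.
    replace (3 - 2 * a) with (1 + 1 + 1 + (- a + - a)) by ring. rewrite !Rpower_plus, Rpower_1 by lra.
    replace (sqrt 2 / 4 * (sqrt 2 * sqrt 2 * sqrt 2 * (Rpower (sqrt 2) (- a) * Rpower (sqrt 2) (- a)))) with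
      ((sqrt 2 * sqrt 2) * (sqrt 2 * sqrt 2) / 4 * (Rpower (sqrt 2) (- a) * Rpower (sqrt 2) (- a))) by field.
    rewrite Q. field. }
  rewrite E. apply Rle_trans with (sqrt 2 / 4 * (1 + (3 - 2 * a) * (sqrt 2 - 1))).
  - apply Rmult_le_compat_l; lra.
  - nra. }
assert (B3 : Rpower (1 + 1 / (2 * INR 2)) (- a) / a <= ((96/100) - (16/100) * a) / a).
{ apply Rmult_le_compat_r; auto. left; apply Rinv_0_lt_compat; lra. }
apply Rle_trans with (((14143/10000) + (3 - 2 * a) * (5857/10000)) / 4 + 1/2 + ((96/100) - (16/100) * a) / a); [lra|].
apply Rmult_le_reg_r with a; [lra|].
replace (2 / a * a) with 2 by (field; lra).
replace ((((14143/10000) + (3 - 2 * a) * (5857/10000)) / 4 + 1 / 2 + ((96/100) - (16/100) * a) / a) * a) with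
  (((14143/10000) + (3 - 2 * a) * (5857/10000)) / 4 * a + a / 2 + ((96/100) - (16/100) * a)) by (field; lra).
nra.
Qed.

(** To first order the columns [n <= m] give [1/a + 1/(2m)] and the columns [n > m] give
    [1/a - 1/(2m)]; the smaller terms decide. *)
Lemma schur_ge3 a m N : 1 <= a <= (149/100) -> (3 <= m <= N)%nat -> schur a m N <= 2 / a.
Proof.
intros Ha Hm. unfold schur.
pose proof (schur_tail a m N ltac:(lra) ltac:(lia)) as T.
pose proof (usum_concave a (pred m) ltac:(lra)) as U.
replace (S (pred m)) with m in U by lia.
assert (P : 3 <= INR m) by (replace 3 with (INR 3) by (simpl; ring); apply le_INR; lia).
set (x := INR m) in *.
rewrite Rpower_pred in U by lra.
assert (O := Rpower_opp_mul x a ltac:(lra)).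
set (X := Rpower x (- a)) in *. set (Y := Rpower x a) in *.
assert (PX : 0 < X) by apply Rpower_pos.
assert (U' : X * usum a m <= / a + / (2 * x) - (/ a - / 2) * X).
{ apply Rle_trans with (X * (Y / a + Y / x / 2 - (/ a - / 2))); [apply Rmult_le_compat_l; lra|].
  right. transitivity (X * Y * / a + X * Y * / (2 * x) - (/ a - / 2) * X); [field; lra|rewrite O; ring]. }
set (y := 1 / (2 * x)) in *.
assert (Hy : 0 < y) by (apply Rdiv_lt_0_compat; lra).
assert (B := Rpower_neg_above1 a y ltac:(lra) ltac:(lra)).
set (Z := Rpower (1 + y) (- a)) in *.
(* What is left is to beat the second-order error y^2 (2a - 1 + a y)/(1 + y)^2 by (1 - a/2) x^(-a). *)
set (s := sqrt x).
assert (Hs : s * s = x) by (apply sqrt_sqrt; lra).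
assert (Hs1 : (17/10) <= s).
{ unfold s. rewrite <- (sqrt_pow2 (17/10)) by lra. apply sqrt_le_1; lra. }
assert (HX : / (x * s) <= X).
{ unfold X. replace (/ (x * s)) with (Rpower x (- (3/2))).
  - apply Rle_Rpower; lra.
  - rewrite Rpower_Ropp. f_equal. replace (3/2) with (1 + /2) by field.
    rewrite Rpower_plus, Rpower_1, Rpower_sqrt by lra. reflexivity. }
(* [1.98 = 2 * 1.49 - 1] and [0.255 = 1 - 1.49/2] are the extreme values over [a <= 1.49]. What
   remains is [0.99 s <= 0.255 (2 s^2 + 1)], true for [s >= 1.7] but false at [sqrt 2], which is why
   row 2 is separate. *)
assert (K : y ^ 2 * (2 * a - 1 + a * y) / (1 + y) ^ 2 <= (255/1000) * / (x * s)).
{ apply Rle_trans with (y ^ 2 * (198/100) / (1 + y)).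
  - apply Rmult_le_reg_r with ((1 + y) ^ 2); [apply pow_lt; lra|].
    replace (y ^ 2 * (2 * a - 1 + a * y) / (1 + y) ^ 2 * (1 + y) ^ 2) with (y ^ 2 * (2 * a - 1 + a * y)) by (field; lra).
    replace (y ^ 2 * (198/100) / (1 + y) * (1 + y) ^ 2) with (y ^ 2 * ((198/100) * (1 + y))) by (field; lra).
    apply Rmult_le_compat_l; [apply pow2_ge_0|nra].
  - unfold y. apply Rmult_le_reg_r with (x * s * (2 * x + 1)); [nra|].
    replace ((1 / (2 * x)) ^ 2 * (198/100) / (1 + 1 / (2 * x)) * (x * s * (2 * x + 1))) with ((99/100) * s) by (field; lra).
    replace ((255/1000) * / (x * s) * (x * s * (2 * x + 1))) with ((255/1000) * (2 * x + 1)) by (field; nra).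
    nra. }
assert (Q : (1 + (2 - a) * y) / (1 + y) ^ 2 = 1 - a * y + y ^ 2 * (2 * a - 1 + a * y) / (1 + y) ^ 2) by (field; lra).
assert (W : Z <= 1 - a * y + (1 - a / 2) * X).
{ assert ((255/1000) * / (x * s) <= (1 - a / 2) * X).
  { apply Rmult_le_compat; try lra. left; apply Rinv_0_lt_compat; nra. }
  lra. }
assert (W' : Z / a <= / a - / (2 * x) + (/ a - / 2) * X).
{ apply Rle_trans with ((1 - a * y + (1 - a / 2) * X) / a).
  - apply Rmult_le_compat_r; auto. left; apply Rinv_0_lt_compat; lra.
  - right. unfold y. field; lra. }
replace (2 / a) with (/ a + / a) by (field; lra). lra.
Qed.

(** For [a <= 1] each half of a row is at most [1/a]. For [a > 1] the row [m = 1] is a partial sum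
    of [zeta(1 + a)] and rests on [Hz]. *)
Lemma schur_bound a m N : 0 < a <= (149/100) -> (forall M, zsum a M <= 2 / a) ->
  (1 <= m <= N)%nat -> schur a m N <= 2 / a.
Proof.
intros Ha Hz Hm. destruct (Rle_dec a 1) as [h|h].
- unfold schur. pose proof (schur_tail a m N ltac:(lra) ltac:(lia)) as T.
  pose proof (usum_convex a (pred m) ltac:(lra)) as U. replace (S (pred m)) with m in U by lia.
  assert (P : 1 <= INR m) by (apply (le_INR 1); lia).
  assert (O := Rpower_opp_mul (INR m) a ltac:(lra)).
  assert (U' : Rpower (INR m) (- a) * usum a m <= / a).
  { apply Rle_trans with (Rpower (INR m) (- a) * (Rpower (INR m) a / a)).
    - apply Rmult_le_compat_l; auto. left; apply Rpower_pos.
    - right. unfold Rdiv. rewrite <- Rmult_assoc, O; ring. }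
  assert (V : Rpower (1 + 1 / (2 * INR m)) (- a) / a <= / a).
  { rewrite <- (Rmult_1_l (/ a)). apply Rmult_le_compat_r; [left; apply Rinv_0_lt_compat; lra|].
    apply Rpower_neg_le1; [|lra]. assert (0 <= 1 / (2 * INR m)) by (apply Rdiv_le_0_compat; lra). lra. }
  replace (2 / a) with (/ a + / a) by (field; lra). lra.
- destruct (Nat.eq_dec m 1) as [->|h1].
  + unfold schur. rewrite usum_1, zsum_1. simpl INR. unfold Rpower. rewrite ln_1, !Rmult_0_r, exp_0.
    specialize (Hz N). lra.
  + destruct (Nat.eq_dec m 2) as [->|h2].
    * apply schur_2; [lra|lia].
    * apply schur_ge3; [lra|lia].
Qed.

(** * Zeta on the real axis: limits and numerical bounds *)

Definition zeta1 (a : R) : R := Series (fun k => Rpower (INR (S k)) (- (1 + a))).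

Lemma ex_series_bounded f B : (forall k, 0 <= f k) -> (forall n, rsum f n <= B) ->
  ex_series f /\ Series f <= B.
Proof.
intros Hf HB.
assert (E : ex_finite_lim_seq (sum_n f)).
{ apply ex_finite_lim_seq_incr with B.
  - intros n. rewrite !sum_n_rsum. apply rsum_incr; auto.
  - intros n. rewrite sum_n_rsum; auto. }
destruct E as [l Hl]. split; [exists l; exact Hl|].
rewrite (is_series_unique f l Hl).
apply (is_lim_seq_le_eventually (sum_n f) (fun _ => B) l B); [exists 0%nat; intros; rewrite sum_n_rsum; auto|exact Hl|apply is_lim_seq_const].
Qed.

Lemma rsum_lim f : ex_series f -> is_lim_seq (rsum f) (Series f).
Proof.
intros H. apply is_lim_seq_incr_1.
apply (is_lim_seq_ext (sum_n f)); [intros; apply sum_n_rsum|]. apply (Series_correct f H).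
Qed.

Lemma rsum_le_Series f n : (forall k, 0 <= f k) -> ex_series f -> rsum f n <= Series f.
Proof.
intros Hf H. apply (is_lim_seq_le_eventually (fun _ => rsum f n) (rsum f) (rsum f n) (Series f)).
- exists n; intros; apply rsum_incr; auto.
- apply is_lim_seq_const.
- apply rsum_lim; auto.
Qed.

Lemma zeta1_ex a : 0 < a -> ex_series (fun k => Rpower (INR (S k)) (- (1 + a))).
Proof.
intros Ha. apply (ex_series_bounded _ (1 + / a)).
- intros; left; apply Rpower_pos.
- intros n; apply zsum_bound; auto.
Qed.

Lemma zsum_le_zeta1 a N : 0 < a -> zsum a N <= zeta1 a.
Proof.
intros Ha. apply (rsum_le_Series (fun k => Rpower (INR (S k)) (- (1 + a)))); [|apply zeta1_ex; auto].
intros; left; apply Rpower_pos.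
Qed.

Lemma zsum_lim a : 0 < a -> is_lim_seq (zsum a) (zeta1 a).
Proof. intros Ha. apply rsum_lim, zeta1_ex; auto. Qed.

Lemma zeta1_upper a m : 0 < a -> zeta1 a <= zsum a m + Rpower (INR m + 1/2) (- a) / a.
Proof.
intros Ha. apply (is_lim_seq_le_eventually (zsum a) (fun _ => zsum a m + Rpower (INR m + 1/2) (- a) / a) (zeta1 a)).
- exists m; intros n Hn. pose proof (zsum_tail a m n Ha Hn). lra.
- apply zsum_lim; auto.
- apply is_lim_seq_const.
Qed.

(** Each term exceeds the integral over the following unit interval, in the form
    [(1 + 1/x)^(-a) >= 1 - a/x]. *)
Lemma zsum_tail_lower a m N : 0 < a -> (m <= N)%nat ->
  (Rpower (INR (S m)) (- a) - Rpower (INR (S N)) (- a)) / a <= zsum a N - zsum a m.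
Proof.
intros Ha H.
assert (G : Rpower (INR (S m)) (- a) - Rpower (INR (S N)) (- a) <= a * (zsum a N - zsum a m)).
{ induction H as [|N H IH]; [unfold zsum; lra|].
  change (zsum a (S N)) with (zsum a N + Rpower (INR (S N)) (- (1 + a))).
  pose proof (INR_ge1 N) as P. rewrite (S_INR (S N)). set (x := INR (S N)) in *.
  assert (HL : ln (1 + / x) <= / x).
  { assert (0 < / x) by (apply Rinv_0_lt_compat; lra).
    pose proof (exp_ineq1_le (ln (1 + / x))) as E. rewrite exp_ln in E; lra. }
  assert (HB : 1 - a * / x <= Rpower (1 + / x) (- a)).
  { unfold Rpower. eapply Rle_trans; [|apply exp_ineq1_le]. nra. }
  assert (E : Rpower (x + 1) (- a) = Rpower x (- a) * Rpower (1 + / x) (- a)).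
  { rewrite Rpower_mult_distr; [f_equal; field; lra|lra|]. assert (0 < / x) by (apply Rinv_0_lt_compat; lra). lra. }
  rewrite E. replace (- (1 + a)) with (- (1) + - a) by ring.
  rewrite (Rpower_plus (- (1))), (Rpower_Ropp x 1), Rpower_1 by lra.
  pose proof (Rpower_pos x (- a)) as Q. set (W := Rpower x (- a)) in *. nra. }
apply Rmult_le_reg_l with a; auto.
replace (a * ((Rpower (INR (S m)) (- a) - Rpower (INR (S N)) (- a)) / a)) with (Rpower (INR (S m)) (- a) - Rpower (INR (S N)) (- a)) by (field; lra).
lra.
Qed.

(** For a rational exponent the [q]-th power is algebraic, so bounds on [Rpower] reduce to comparing
    integers. *)
Lemma Rpower_frac_pow x p q : 0 < x -> (0 < q)%nat ->
  Rpower x (- (INR p / INR q)) ^ q * x ^ p = 1.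
Proof.
intros Hx Hq. rewrite <- !Rpower_pow by (auto; apply Rpower_pos).
rewrite Rpower_mult, <- Rpower_plus.
replace (- (INR p / INR q) * INR q + INR p) with 0; [apply Rpower_O; auto|].
assert (0 < INR q) by (apply lt_0_INR; auto). field; lra.
Qed.

Lemma pow_lt_compat_base x y n : 0 <= x < y -> (0 < n)%nat -> x ^ n < y ^ n.
Proof.
intros H Hn. destruct n as [|n]; [lia|]. induction n as [|n IH]; [simpl; lra|].
change (x ^ S (S n)) with (x * x ^ S n). change (y ^ S (S n)) with (y * y ^ S n).
specialize (IH ltac:(lia)). pose proof (pow_le x (S n) ltac:(lra)). nra.
Qed.

(** The premise is a Boolean test on integers, which [vm_compute] can settle for each numerical
    instance. *)
Lemma frac_pow_le (a b c d : Z) p q : (0 < b)%Z -> (0 < d)%Z ->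
  (a ^ Z.of_nat q * c ^ Z.of_nat p <=? b ^ Z.of_nat q * d ^ Z.of_nat p)%Z = true ->
  (IZR a / IZR b) ^ q * (IZR c / IZR d) ^ p <= 1.
Proof.
intros Hb Hd H. apply Z.leb_le, IZR_le in H. rewrite !mult_IZR, <- !pow_IZR in H.
apply IZR_lt in Hb, Hd. pose proof (pow_lt _ q Hb). pose proof (pow_lt _ p Hd).
unfold Rdiv. rewrite !Rpow_mult_distr, !pow_inv.
apply Rmult_le_reg_r with (IZR b ^ q * IZR d ^ p); [apply Rmult_lt_0_compat; auto|].
field_simplify; lra.
Qed.

Lemma frac_pow_ge (a b c d : Z) p q : (0 < b)%Z -> (0 < d)%Z ->
  (b ^ Z.of_nat q * d ^ Z.of_nat p <=? a ^ Z.of_nat q * c ^ Z.of_nat p)%Z = true ->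
  1 <= (IZR a / IZR b) ^ q * (IZR c / IZR d) ^ p.
Proof.
intros Hb Hd H. apply Z.leb_le, IZR_le in H. rewrite !mult_IZR, <- !pow_IZR in H.
apply IZR_lt in Hb, Hd. pose proof (pow_lt _ q Hb). pose proof (pow_lt _ p Hd).
unfold Rdiv. rewrite !Rpow_mult_distr, !pow_inv.
apply Rmult_le_reg_r with (IZR b ^ q * IZR d ^ p); [apply Rmult_lt_0_compat; auto|].
field_simplify; lra.
Qed.

Lemma Rpower_frac_le x y p q : 0 < x -> 0 < y -> (0 < q)%nat -> 1 <= y ^ q * x ^ p ->
  Rpower x (- (INR p / INR q)) <= y.
Proof.
intros Hx Hy Hq H. pose proof (Rpower_frac_pow x p q Hx Hq) as E.
set (w := Rpower _ _) in *. assert (Hw : 0 < w) by apply Rpower_pos.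
destruct (Rle_dec w y) as [h|h]; auto. exfalso.
assert (L : y ^ q < w ^ q) by (apply pow_lt_compat_base; auto; lra).
pose proof (pow_lt x p Hx). nra.
Qed.

Lemma Rpower_frac_ge x y p q : 0 < x -> 0 < y -> (0 < q)%nat -> y ^ q * x ^ p <= 1 ->
  y <= Rpower x (- (INR p / INR q)).
Proof.
intros Hx Hy Hq H. pose proof (Rpower_frac_pow x p q Hx Hq) as E.
set (w := Rpower _ _) in *. assert (Hw : 0 < w) by apply Rpower_pos.
destruct (Rle_dec y w) as [h|h]; auto. exfalso.
assert (L : w ^ q < y ^ q) by (apply pow_lt_compat_base; auto; lra).
pose proof (pow_lt x p Hx). nra.
Qed.

(** * The equation for the critical value *)

Lemma Rpower_frac_upper (a b c d : Z) (p q : nat) e : (0 < b)%Z -> (0 < d)%Z -> (0 < a)%Z -> (0 < c)%Z ->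
  (0 < q)%nat -> e = - (INR p / INR q) ->
  (b ^ Z.of_nat q * d ^ Z.of_nat p <=? a ^ Z.of_nat q * c ^ Z.of_nat p)%Z = true ->
  Rpower (IZR c / IZR d) e <= IZR a / IZR b.
Proof.
intros Hb Hd Ha Hc Hq -> H. apply Rpower_frac_le; auto; try (apply Rdiv_lt_0_compat; apply IZR_lt; auto).
apply frac_pow_ge; auto.
Qed.

Lemma Rpower_frac_lower (a b c d : Z) (p q : nat) e : (0 < b)%Z -> (0 < d)%Z -> (0 < a)%Z -> (0 < c)%Z ->
  (0 < q)%nat -> e = - (INR p / INR q) ->
  (a ^ Z.of_nat q * c ^ Z.of_nat p <=? b ^ Z.of_nat q * d ^ Z.of_nat p)%Z = true ->
  IZR a / IZR b <= Rpower (IZR c / IZR d) e.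
Proof.
intros Hb Hd Ha Hc Hq -> H. apply Rpower_frac_ge; auto; try (apply Rdiv_lt_0_compat; apply IZR_lt; auto).
apply frac_pow_le; auto.
Qed.

Ltac frac_side :=
  first [ lia | rewrite !INR_IZR_INZ; cbn [Z.of_nat Pos.of_succ_nat]; simpl; lra | vm_compute; reflexivity ].

(** Four terms and the midpoint tail from [9/2] give about 1.998, so the decimals leave little
    slack. *)
Lemma zeta1_148 : 148/100 * zeta1 (148/100) < 2.
Proof.
pose proof (zeta1_upper (148/100) 4 ltac:(lra)) as H.
unfold zsum in H. cbn [rsum] in H. rewrite !INR_IZR_INZ in H. simpl in H.
assert (A1 : Rpower 1 (-(1 + 148/100)) = 1) by (unfold Rpower; rewrite ln_1, Rmult_0_r; apply exp_0).
assert (A2 : Rpower (2/1) (-(1 + 148/100)) <= 17925/100000).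
{ apply (Rpower_frac_upper 17925 100000 2 1 62 25); frac_side. }
assert (A3 : Rpower (3/1) (-(1 + 148/100)) <= 6558/100000).
{ apply (Rpower_frac_upper 6558 100000 3 1 62 25); frac_side. }
assert (A4 : Rpower (4/1) (-(1 + 148/100)) <= 3213/100000).
{ apply (Rpower_frac_upper 3213 100000 4 1 62 25); frac_side. }
assert (A5 : Rpower (9/2) (-(148/100)) <= 10796/100000).
{ apply (Rpower_frac_upper 10796 100000 9 2 37 25); frac_side. }
replace (4 + 1/2) with (9/2) in H by field.
replace (2/1) with 2 in A2 by field. replace (3/1) with 3 in A3 by field. replace (4/1) with 4 in A4 by field.
rewrite A1 in H. lra.
Qed.

(** Nine terms and the integral from 10 to 1000 give about 2.002; stopping at 1000 costs less than
    0.00004. *)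
Lemma zeta1_149 : 2 < 149/100 * zeta1 (149/100).
Proof.
pose proof (zsum_tail_lower (149/100) 9 999 ltac:(lra) ltac:(lia)) as H.
pose proof (zsum_le_zeta1 (149/100) 999 ltac:(lra)) as H0.
assert (E : zsum (149/100) 9 = rsum (fun k => Rpower (INR (S k)) (- (1 + 149/100))) 9) by reflexivity.
cbn [rsum] in E.
rewrite !INR_IZR_INZ in E. rewrite !INR_IZR_INZ in H.
change (Z.of_nat 10) with 10%Z in H. change (Z.of_nat 1000) with 1000%Z in H. simpl in E.
assert (A1 : Rpower 1 (-(1 + 149/100)) = 1) by (unfold Rpower; rewrite ln_1, Rmult_0_r; apply exp_0).
assert (A2 : 17800/100000 <= Rpower (2/1) (-(1 + 149/100))).
{ apply (Rpower_frac_lower 17800 100000 2 1 249 100); frac_side. }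
assert (A3 : 6485/100000 <= Rpower (3/1) (-(1 + 149/100))).
{ apply (Rpower_frac_lower 6485 100000 3 1 249 100); frac_side. }
assert (A4 : 3168/100000 <= Rpower (4/1) (-(1 + 149/100))).
{ apply (Rpower_frac_lower 3168 100000 4 1 249 100); frac_side. }
assert (A5 : 1817/100000 <= Rpower (5/1) (-(1 + 149/100))).
{ apply (Rpower_frac_lower 1817 100000 5 1 249 100); frac_side. }
assert (A6 : 1154/100000 <= Rpower (6/1) (-(1 + 149/100))).
{ apply (Rpower_frac_lower 1154 100000 6 1 249 100); frac_side. }
assert (A7 : 786/100000 <= Rpower (7/1) (-(1 + 149/100))).
{ apply (Rpower_frac_lower 786 100000 7 1 249 100); frac_side. }
assert (A8 : 564/100000 <= Rpower (8/1) (-(1 + 149/100))).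
{ apply (Rpower_frac_lower 564 100000 8 1 249 100); frac_side. }
assert (A9 : 420/100000 <= Rpower (9/1) (-(1 + 149/100))).
{ apply (Rpower_frac_lower 420 100000 9 1 249 100); frac_side. }
assert (A10 : 3235/100000 <= Rpower (10/1) (-(149/100))).
{ apply (Rpower_frac_lower 3235 100000 10 1 149 100); frac_side. }
assert (A1000 : Rpower (1000/1) (-(149/100)) <= 4/100000).
{ apply (Rpower_frac_upper 4 100000 1000 1 149 100); frac_side. }
assert (D : forall x, x / 1 = x) by (intros; field). rewrite D in A2, A3, A4, A5, A6, A7, A8, A9, A10, A1000.
rewrite A1 in E. lra.
Qed.

(** One term and the midpoint tail: [a zeta(1+a) <= a + (3/2)^(-a)]. Every solution of the equation
    is thus confined to [a > 1], where monotonicity is proved. *)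
Lemma zeta1_lt2_small a : 0 < a <= 1 -> a * zeta1 a < 2.
Proof.
intros Ha. pose proof (zeta1_upper a 1 ltac:(lra)) as H. rewrite zsum_1 in H.
assert (B : Rpower (INR 1 + 1/2) (- a) < 1).
{ apply Rlt_le_trans with (Rpower (INR 1 + 1/2) 0); [apply Rpower_lt; simpl; lra|].
  rewrite Rpower_O; simpl; lra. }
apply Rle_lt_trans with (a * (1 + Rpower (INR 1 + 1/2) (- a) / a)).
- apply Rmult_le_compat_l; lra.
- replace (a * (1 + Rpower (INR 1 + 1/2) (- a) / a)) with (a + Rpower (INR 1 + 1/2) (- a)) by (field; lra). lra.
Qed.

Lemma zeta1_gt1 a : 0 < a -> 1 < zeta1 a.
Proof.
intros Ha. pose proof (zsum_le_zeta1 a 2 Ha) as H.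
change (zsum a 2) with (zsum a 1 + Rpower (INR 2) (- (1 + a))) in H. rewrite zsum_1 in H.
pose proof (Rpower_pos (INR 2) (- (1 + a))). lra.
Qed.

(** The slope [s t^(-s-1)] decreases in [s] once [s ln t >= 1], which [t >= 2], [s >= 2] and
    [ln 2 >= 1/2] ensure; hence the range [a >= 1] in what follows. *)
Lemma power_gap_decreasing n s s' : (2 <= n)%nat -> 2 <= s < s' ->
  Rpower (INR n) (- s') - Rpower (INR (S n)) (- s') <= Rpower (INR n) (- s) - Rpower (INR (S n)) (- s).
Proof.
intros Hn Hs.
assert (Hx : 2 <= INR n) by (apply (le_INR 2); auto). rewrite S_INR. set (x := INR n) in *.
destruct (MVT_cor2 (fun t => Rpower t (- s') - Rpower t (- s))
  (fun t => - s' * (Rpower t (- s') / t) + s * (Rpower t (- s) / t)) x (x + 1)) as (c & E & Hc); [lra| |].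
- intros c Hc. unfold Rpower. apply is_derive_Reals. auto_derive; [lra|]. field; lra.
- assert (L : 1/2 <= ln c).
  { apply Rle_trans with (ln 2); [pose proof ln_lt_2; lra|].
    destruct (Req_dec c 2) as [->|]; [lra|left; apply ln_increasing; lra]. }
  assert (K : Rpower c (- s) = Rpower c (- s') * Rpower c (s' - s)).
  { rewrite <- Rpower_plus. f_equal; ring. }
  assert (M : s' <= s * Rpower c (s' - s)).
  { assert (A1 : 1 <= s * ln c) by nra.
    assert (0 <= (s' - s) * (s * ln c - 1)) by (apply Rmult_le_pos; lra).
    apply Rle_trans with (s * (1 + (s' - s) * ln c)); [lra|].
    apply Rmult_le_compat_l; [lra|]. apply exp_ineq1_le. }
  rewrite K in E. pose proof (Rpower_pos c (- s')) as P.
  set (u := Rpower c (- s')) in *. set (v := Rpower c (s' - s)) in *.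
  assert (0 <= - s' * (u / c) + s * (u * v / c)).
  { replace (- s' * (u / c) + s * (u * v / c)) with (u / c * (s * v - s')) by (field; lra).
    apply Rmult_le_pos; [apply Rdiv_le_0_compat|]; lra. }
  nra.
Qed.

(** Partial sums of [1 - 2^(-s) + 3^(-s) - ...] at [s = 1 + a], paired so that each pair is monotone
    in [a]. *)
Definition eta_sum (a : R) (N : nat) : R :=
  1 - rsum (fun k => Rpower (INR (2 * k + 2)) (- (1 + a)) - Rpower (INR (2 * k + 3)) (- (1 + a))) N.

(** Finite form of [eta(s) = (1 - 2^(1-s)) zeta(s)]: twice the even terms are subtracted. *)
Lemma eta_sum_zsum a N :
  eta_sum a N = zsum a (2 * N + 1) - Rpower 2 (- a) * zsum a N.
Proof.
unfold eta_sum. induction N as [|N IH].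
- change (2 * 0 + 1)%nat with 1%nat. rewrite zsum_1. unfold zsum. simpl. ring.
- replace (2 * S N + 1)%nat with (S (S (2 * N + 1))) by lia.
  cbn [rsum]. unfold zsum in *. cbn [rsum].
  replace (S (2 * N + 1)) with (2 * N + 2)%nat by lia.
  replace (S (2 * N + 2)) with (2 * N + 3)%nat by lia.
  assert (E : Rpower 2 (- a) * Rpower (INR (S N)) (- (1 + a)) = 2 * Rpower (INR (2 * N + 2)) (- (1 + a))).
  { replace (INR (2 * N + 2)) with (2 * INR (S N)) by (rewrite plus_INR, mult_INR, S_INR; simpl; ring).
    pose proof (INR_ge1 N). rewrite <- Rpower_mult_distr by lra.
    replace (- a) with (1 + - (1 + a)) by ring. rewrite Rpower_plus, Rpower_1 by lra. ring. }
  rewrite Rmult_plus_distr_l, E. lra.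
Qed.

Lemma eta_lim a : 0 < a -> is_lim_seq (eta_sum a) ((1 - Rpower 2 (- a)) * zeta1 a).
Proof.
intros Ha. apply (is_lim_seq_ext (fun N => zsum a (2 * N + 1) - Rpower 2 (- a) * zsum a N)).
- intros; symmetry; apply eta_sum_zsum.
- replace ((1 - Rpower 2 (- a)) * zeta1 a) with (zeta1 a - Rpower 2 (- a) * zeta1 a) by ring.
  apply is_lim_seq_minus'.
  + apply (is_lim_seq_subseq (zsum a) (zeta1 a) (fun N => 2 * N + 1)%nat); [|apply zsum_lim; auto].
    apply eventually_subseq. intros; lia.
  + apply (is_lim_seq_scal_l (zsum a) (Rpower 2 (- a)) (zeta1 a)), zsum_lim; auto.
Qed.

Lemma eta_increasing a b : 1 <= a < b ->
  (1 - Rpower 2 (- a)) * zeta1 a <= (1 - Rpower 2 (- b)) * zeta1 b.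
Proof.
intros H.
apply (is_lim_seq_le_eventually (eta_sum a) (eta_sum b)); [|apply eta_lim; lra|apply eta_lim; lra].
exists 0%nat; intros n _. unfold eta_sum.
apply Rplus_le_compat_l, Ropp_le_contravar, rsum_le. intros k _.
replace (2 * k + 3)%nat with (S (2 * k + 2)) by lia.
apply power_gap_decreasing; [lia|lra].
Qed.

(* Here [zeta1 a = zeta (1+a)], and [a zeta(1+a)] is the product of [a / (1 - 2^-a)] and of the alternating zeta function at [1+a]. *)
Lemma zeta1_increasing a b : 1 <= a < b -> a * zeta1 a < b * zeta1 b.
Proof.
intros H. pose proof (eta_increasing a b H) as E.
assert (L2 : 0 < ln 2) by (pose proof ln_lt_2; lra).
(* The chord of [exp] from [-b ln 2] to 0 shows that [a / (1 - 2^(-a))] is strictly increasing. *)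
assert (C := exp_chord_strict (- b * ln 2) (a / b)).
assert (R : 0 < a / b < 1).
{ split; [apply Rdiv_lt_0_compat; lra|]. apply Rmult_lt_reg_r with b; [lra|]. field_simplify; lra. }
specialize (C R ltac:(nra)).
replace (a / b * (- b * ln 2)) with (- a * ln 2) in C by (field; lra).
fold (Rpower 2 (- a)) in C. fold (Rpower 2 (- b)) in C.
assert (U : forall t, 0 < t -> 0 < 1 - Rpower 2 (- t)).
{ intros t Ht. assert (Rpower 2 (- t) < Rpower 2 0) by (apply Rpower_lt; lra).
  rewrite Rpower_O in H0; lra. }
pose proof (U a ltac:(lra)) as Ua. pose proof (U b ltac:(lra)) as Ub.
pose proof (zeta1_gt1 a ltac:(lra)) as Za. pose proof (zeta1_gt1 b ltac:(lra)) as Zb.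
set (ua := Rpower 2 (- a)) in *. set (ub := Rpower 2 (- b)) in *.
assert (C' : a * (1 - ub) < b * (1 - ua)).
{ assert (b * ua < b * (a / b * ub + (1 - a / b))) by (apply Rmult_lt_compat_l; lra).
  replace (b * (a / b * ub + (1 - a / b))) with (a * ub + (b - a)) in H0 by (field; lra). lra. }
apply Rmult_lt_reg_r with ((1 - ua) * (1 - ub)); [nra|].
apply Rle_lt_trans with (a * (1 - ub) * ((1 - ub) * zeta1 b)).
- replace (a * zeta1 a * ((1 - ua) * (1 - ub))) with (a * (1 - ub) * ((1 - ua) * zeta1 a)) by ring.
  apply Rmult_le_compat_l; auto. nra.
- replace (b * zeta1 b * ((1 - ua) * (1 - ub))) with (b * (1 - ua) * ((1 - ub) * zeta1 b)) by ring.
  apply Rmult_lt_compat_r; auto. nra.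
Qed.

(** Termwise, [x^(-(b-a)) >= 1 - (b-a) ln x] and [ln x <= 2 sqrt x]; since [a >= 1], losing half a
    power still leaves a sum bounded by [zeta(3/2)]. *)
Lemma zeta1_lipschitz a b : 1 <= a <= b -> 0 <= zeta1 a - zeta1 b <= (b - a) * (2 * zeta1 (1/2)).
Proof.
intros H.
assert (T : forall k, 0 <= Rpower (INR (S k)) (- (1 + a)) - Rpower (INR (S k)) (- (1 + b)) <=
   (b - a) * 2 * Rpower (INR (S k)) (- (1 + 1/2))).
{ intros k. pose proof (INR_ge1 k) as P. set (x := INR (S k)) in *. split.
  - assert (Rpower x (- (1 + b)) <= Rpower x (- (1 + a))) by (apply Rle_Rpower; lra). lra.
  - assert (E : Rpower x (- (1 + b)) = Rpower x (- (1 + a)) * Rpower x (- (b - a))) by (rewrite <- Rpower_plus; f_equal; ring).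
    assert (L : ln x <= 2 * Rpower x (1/2)).
    { replace (1/2) with (/2) by field. rewrite Rpower_sqrt by lra.
      assert (Q : 0 < sqrt x) by (apply sqrt_lt_R0; lra).
      replace (ln x) with (2 * ln (sqrt x)).
      - pose proof (exp_ineq1_le (ln (sqrt x))) as I. rewrite exp_ln in I; lra.
      - rewrite <- (sqrt_sqrt x) at 2 by lra. rewrite ln_mult by auto. ring. }
    assert (G : 1 - (b - a) * ln x <= Rpower x (- (b - a))).
    { unfold Rpower. eapply Rle_trans; [|apply exp_ineq1_le]. right; ring. }
    assert (W : Rpower x (- (1 + a)) * Rpower x (1/2) <= Rpower x (- (1 + 1/2))).
    { rewrite <- Rpower_plus. apply Rle_Rpower; lra. }
    rewrite E. pose proof (Rpower_pos x (- (1 + a))) as Q.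
    set (u := Rpower x (- (1 + a))) in *. set (v := Rpower x (1/2)) in *.
    assert (u * (1 - Rpower x (- (b - a))) <= u * ((b - a) * (2 * v))).
    { apply Rmult_le_compat_l; [lra|]. assert ((b - a) * ln x <= (b - a) * (2 * v)) by (apply Rmult_le_compat_l; lra). lra. }
    assert ((b - a) * 2 * (u * v) <= (b - a) * 2 * Rpower x (- (1 + 1/2))) by (apply Rmult_le_compat_l; lra).
    lra. }
assert (E : forall N, 0 <= zsum a N - zsum b N <= (b - a) * 2 * zsum (1/2) N).
{ unfold zsum. induction N as [|N IH]; cbn [rsum]; [lra|]. specialize (T N). lra. }
split.
- apply (is_lim_seq_le_eventually (fun _ => 0) (fun N => zsum a N - zsum b N)); [exists 0%nat; intros n _; apply E|apply is_lim_seq_const|].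
  apply is_lim_seq_minus'; apply zsum_lim; lra.
- apply (is_lim_seq_le_eventually (fun N => zsum a N - zsum b N) (fun _ => (b - a) * (2 * zeta1 (1/2))));
   [|apply is_lim_seq_minus'; apply zsum_lim; lra|apply is_lim_seq_const].
  exists 0%nat; intros n _. destruct (E n) as [_ E2]. eapply Rle_trans; [apply E2|].
  rewrite <- Rmult_assoc. apply Rmult_le_compat_l; [lra|]. apply zsum_le_zeta1; lra.
Qed.

Lemma zeta1_continuous a : 1 < a -> continuity_pt zeta1 a.
Proof.
intros Ha. pose proof (zeta1_gt1 (1/2) ltac:(lra)) as P. set (K := 2 * zeta1 (1/2)) in *.
intros e He. exists (Rmin (a - 1) (e / (2 * K))). split.
{ apply Rmin_glb_lt; [lra|]. apply Rdiv_lt_0_compat; unfold K; lra. }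
intros x [_ Hx]. simpl in *. unfold R_dist in *.
assert (D1 : Rabs (x - a) < a - 1) by (eapply Rlt_le_trans; [apply Hx|apply Rmin_l]).
assert (D2 : Rabs (x - a) < e / (2 * K)) by (eapply Rlt_le_trans; [apply Hx|apply Rmin_r]).
assert (HK : K * Rabs (x - a) < e).
{ apply Rlt_trans with (K * (e / (2 * K)) + e / 4).
  - assert (K * Rabs (x - a) < K * (e / (2 * K))) by (apply Rmult_lt_compat_l; unfold K in *; lra). lra.
  - replace (K * (e / (2 * K))) with (e / 2) by (field; unfold K; lra). lra. }
assert (D1' := Rabs_def2 _ _ D1).
destruct (Rle_dec x a) as [h|h].
- pose proof (zeta1_lipschitz x a ltac:(lra)) as L. fold K in L.
  rewrite Rabs_left1 in HK by lra. rewrite Rabs_pos_eq by lra. lra.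
- pose proof (zeta1_lipschitz a x ltac:(lra)) as L. fold K in L.
  rewrite Rabs_pos_eq in HK by lra. rewrite Rabs_left1 by lra. lra.
Qed.

Lemma alpha0_exists : exists a0, 148/100 <= a0 < 149/100 /\ a0 * zeta1 a0 = 2.
Proof.
destruct (IVT_interv (fun a => a * zeta1 a - 2) (148/100) (149/100)) as (a0 & H & E).
- intros a Ha. apply continuity_pt_minus; [|apply continuity_pt_const; intros ? ?; auto].
  apply continuity_pt_mult; [apply derivable_continuous_pt, derivable_pt_id|apply zeta1_continuous; lra].
- lra.
- pose proof zeta1_148; lra.
- pose proof zeta1_149; lra.
- exists a0; split; [|lra]. split; [lra|].
  destruct (Req_dec a0 (149/100)) as [->|]; [pose proof zeta1_149; lra|lra].
Qed.

Lemma alpha0_unique a b : 0 < a -> 0 < b -> a * zeta1 a = 2 -> b * zeta1 b = 2 -> a = b.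
Proof.
intros Ha Hb Ea Eb.
assert (H1 : 1 < a).
{ destruct (Rle_dec a 1); [pose proof (zeta1_lt2_small a); lra|lra]. }
assert (H2 : 1 < b).
{ destruct (Rle_dec b 1); [pose proof (zeta1_lt2_small b); lra|lra]. }
destruct (Rtotal_order a b) as [h|[h|h]]; auto.
- pose proof (zeta1_increasing a b); lra.
- pose proof (zeta1_increasing b a); lra.
Qed.

Lemma zsum_le_below_alpha0 a0 a N : a0 * zeta1 a0 = 2 -> 0 < a <= a0 -> zsum a N <= 2 / a.
Proof.
intros E Ha.
assert (H : a * zeta1 a <= 2).
{ destruct (Rle_dec a 1); [left; apply zeta1_lt2_small; lra|].
  destruct (Req_dec a a0) as [->|]; [lra|].
  pose proof (zeta1_increasing a a0); lra. }
pose proof (zsum_le_zeta1 a N ltac:(lra)).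
apply Rle_trans with (zeta1 a); auto. apply Rmult_le_reg_l with a; [lra|].
replace (a * (2 / a)) with 2 by (field; lra). auto.
Qed.

(** * The harmonic majorant and the Schur test *)

Definition gap (g : nat -> R) (k : nat) : R :=
  match k with O => g O | S j => g (S j) - g j end.

Lemma rsum_gap g n : rsum (gap g) (S n) = g n.
Proof.
induction n as [|n IH]; [simpl; ring|].
change (rsum (gap g) (S (S n))) with (rsum (gap g) (S n) + gap g (S n)).
rewrite IH; simpl; ring.
Qed.

(** The form [sum A_m conj(A_n) min(g_m, g_n)], [g] nondecreasing, with both triangles folded onto
    [n <= m] and [B n] standing for [conj(A_n) g_n]. Folding keeps the real part and gives an
    expression analytic as soon as [A] and [B] are. *)
Definition majorant (A B : nat -> C) (N : nat) : C :=
  csum (fun m => A m * (B m + RtoC 2 * csum B m))%C N.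

Lemma gap_csum A g N :
  csum (fun k => RtoC (gap g k) * (csum A N - csum A k))%C N = csum (fun n => RtoC (g n) * A n)%C N.
Proof.
induction N as [|N IH]; [reflexivity|].
rewrite (csum_ext _ (fun k => RtoC (gap g k) * (csum A N - csum A k) + A N * RtoC (gap g k))%C).
2:{ intros k _; simpl; ring. }
rewrite csum_plus, csum_scal, csum_RtoC, rsum_gap. cbn [csum]. rewrite IH. ring.
Qed.

(** Serves an induction on [N]: appending [A N] shifts all tail sums by the same [u]. *)
Lemma rsum_shift_square (d : nat -> R) (z : nat -> C) u n :
  rsum (fun k => d k * Cmod (z k + u)%C ^ 2) n =
  rsum (fun k => d k * Cmod (z k) ^ 2) n + 2 * Re (Cconj u * csum (fun k => RtoC (d k) * z k)%C n)%C
    + Cmod u ^ 2 * rsum d n.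
Proof.
induction n as [|n IH]; cbn [rsum csum]; [simpl; ring|].
rewrite IH, !Cmod_sqr. destruct (z n) as [x y], u as [v w]. unfold Cconj, Re, Im; simpl. ring.
Qed.

(* Summation by parts: the kernel [min(g m, g n)] is a positive combination of squares. *)
Lemma majorant_squares A g N :
  Re (majorant A (fun n => Cconj (A n) * RtoC (g n))%C N) =
  rsum (fun k => gap g k * Cmod (csum A N - csum A k)%C ^ 2) N.
Proof.
induction N as [|N IH]; [reflexivity|].
assert (E : rsum (fun k => gap g k * Cmod (csum A (S N) - csum A k)%C ^ 2) (S N) =
  rsum (fun k => gap g k * Cmod ((csum A N - csum A k) + A N)%C ^ 2) (S N)).
{ apply rsum_ext; intros k _. do 3 f_equal. simpl; ring. }
rewrite E, rsum_shift_square, rsum_gap. cbn [rsum csum].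
replace (csum A N - csum A N)%C with (RtoC 0) by ring. rewrite Cmod_0, <- IH, gap_csum.
unfold majorant. cbn [csum].
assert (X : csum (fun n => Cconj (A n) * RtoC (g n))%C N = Cconj (csum (fun n => RtoC (g n) * A n)%C N)).
{ rewrite Cconj_csum. apply csum_ext; intros k _. rewrite Cmult_conj.
  replace (Cconj (RtoC (g k))) with (RtoC (g k)) by (apply injective_projections; simpl; ring). ring. }
rewrite X, Cmod_sqr. set (M := csum (fun m => _) N). set (D := csum (fun n => _) N).
destruct M as [m1 m2], D as [d1 d2], (A N) as [x y]. unfold Cconj, Re, Im; simpl. ring.
Qed.

(** All squares but the first are dropped; the first has coefficient [g 0 = 1] and contains the full
    sum. *)
Lemma majorant_ge A g N : g 0%nat = 1 -> (forall n, g n <= g (S n)) ->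
  Cmod (csum A N) ^ 2 <= Re (majorant A (fun n => Cconj (A n) * RtoC (g n))%C N).
Proof.
intros Hg0 Hg. rewrite majorant_squares. destruct N as [|N].
- unfold majorant; cbn [csum]. rewrite Cmod_0. unfold Re; simpl; lra.
- rewrite rsum_head. change (gap g 0) with (g 0%nat). rewrite Hg0.
  replace (csum A (S N) - csum A 0)%C with (csum A (S N)) by (simpl; ring).
  assert (0 <= rsum (fun k => gap g (S k) * Cmod (csum A (S N) - csum A (S k))%C ^ 2) N).
  { apply rsum_pos. intros k _. apply Rmult_le_pos; [simpl; specialize (Hg k); lra|apply pow2_ge_0]. }
  lra.
Qed.

(** The real factor is 1 on [Re w = 1/2]: there [n^(w-1)] coincides with [conj(n^(-w))], and unlike
    the latter it is analytic. *)
Lemma npow_reflect k w :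
  npow (S k) (1 - w)%C = (Cconj (npow (S k) w) * RtoC (Rpower (INR (S k)) (2 * Re w - 1)))%C.
Proof.
unfold Rpower. rewrite <- Cexp_RtoC. unfold npow.
replace (Cconj (Cexp (- (w * RtoC (ln (INR (S k))))))) with (Cexp (Cconj (- (w * RtoC (ln (INR (S k))))))%C).
- rewrite <- Cexp_plus. f_equal. destruct w as [x y]. apply injective_projections; simpl; ring.
- unfold Cexp, Cconj; simpl. rewrite cos_neg, sin_neg. f_equal; ring.
Qed.

(* The analytic function whose real part is the Poisson integral of [|f(1/2 + i t)|^2] on [Re w > 1/2],
   [f] being the Dirichlet polynomial [sum_{n <= N} a_n n^(-w)]; the conjugate of [a_n n^(-w)] times
   [n^(2 Re w - 1)] is the analytic term [conj(a_n) n^(w-1)]. *)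
Definition dmajorant (a : nat -> C) (N : nat) (w : C) : C :=
  majorant (dterm a w) (fun n => Cconj (a (S n)) * npow (S n) (1 - w))%C N.

Lemma dmajorant_eq a N w : dmajorant a N w =
  majorant (dterm a w) (fun n => Cconj (dterm a w n) * RtoC (Rpower (INR (S n)) (2 * Re w - 1)))%C N.
Proof.
assert (E : forall n, (Cconj (a (S n)) * npow (S n) (1 - w))%C =
  (Cconj (dterm a w n) * RtoC (Rpower (INR (S n)) (2 * Re w - 1)))%C).
{ intros n. rewrite npow_reflect. unfold dterm. rewrite Cmult_conj. ring. }
unfold dmajorant, majorant. apply csum_ext; intros m _.
rewrite E. do 3 f_equal. apply csum_ext; intros n _; apply E.
Qed.

Lemma dmajorant_ge a N w : 1/2 <= Re w ->
  Cmod (csum (dterm a w) N) ^ 2 <= Re (dmajorant a N w).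
Proof.
intros Hw. rewrite dmajorant_eq.
apply (majorant_ge (dterm a w) (fun n => Rpower (INR (S n)) (2 * Re w - 1))).
- simpl INR. unfold Rpower. rewrite ln_1, Rmult_0_r; apply exp_0.
- intros n. apply Rle_Rpower_l; [lra|]. pose proof (INR_ge1 n). rewrite (S_INR (S n)). lra.
Qed.

Lemma rsum_exchange (u v : nat -> R) N :
  rsum (fun m => v m * rsum u m) N = rsum (fun n => u n * (rsum v N - rsum v (S n))) N.
Proof.
induction N as [|N IH]; [reflexivity|]. cbn [rsum] in *. rewrite IH.
assert (E : rsum (fun n => u n * (rsum v N + v N - (rsum v n + v n))) N =
  rsum (fun n => u n * (rsum v N - (rsum v n + v n)) + v N * u n) N).
{ apply rsum_ext; intros; ring. }
rewrite E, rsum_plus, rsum_scal. ring.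
Qed.

Lemma Re_le_Cmod z : Re z <= Cmod z.
Proof. eapply Rle_trans; [|apply Rmax_Cmod]. eapply Rle_trans; [apply RRle_abs|apply Rmax_l]. Qed.

(* Schur test with weights [n^(-1/2)] for the Hilbert-type form [sum a_m a_n (mn)^(al-1/2) / max(m,n)^(2 al)]. *)
Lemma dmajorant_schur a N w : 1/2 < Re w ->
  Re (dmajorant a N w) <= rsum (fun m => Cmod (a (S m)) ^ 2 * schur (Re w - 1/2) (S m) N) N.
Proof.
intros Hw. rewrite dmajorant_eq. set (al := Re w - 1/2).
set (x := fun n => Cmod (a (S n))). set (pw := fun n r => Rpower (INR (S n)) r).
assert (Hpw : forall n r t, pw n r * pw n t = pw n (r + t)) by (intros; unfold pw; rewrite Rpower_plus; auto).
assert (Ppw : forall n r, 0 < pw n r) by (intros; apply Rpower_pos).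
assert (HA : forall n, Cmod (dterm a w n) = x n * pw n (- (al + 1/2))).
{ intros n. unfold dterm. rewrite Cmod_mult, Cmod_npow. unfold al, pw, x. do 2 f_equal. ring. }
assert (HB : forall n, Cmod (Cconj (dterm a w n) * RtoC (Rpower (INR (S n)) (2 * Re w - 1)))%C = x n * pw n (al - 1/2)).
{ intros n. rewrite Cmod_mult, Cmod_conj, HA, Cmod_R, Rabs_pos_eq by (left; apply Rpower_pos).
  fold (pw n (2 * Re w - 1)). rewrite Rmult_assoc, Hpw. do 2 f_equal. unfold al; field. }
apply Rle_trans with (rsum (fun m => x m ^ 2 * (pw m (-1)) +
   (pw m (- (1 + al)) * rsum (fun n => x n ^ 2 * pw n al) m + x m ^ 2 * pw m (- al) * usum al m)) N).
- eapply Rle_trans; [apply Re_le_Cmod|]. eapply Rle_trans; [apply Cmod_csum|].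
  apply rsum_le; intros m _. rewrite Cmod_mult.
  apply Rle_trans with (x m * pw m (- (al + 1/2)) * (x m * pw m (al - 1/2) + 2 * rsum (fun n => x n * pw n (al - 1/2)) m)).
  + rewrite HA. apply Rmult_le_compat_l.
    { apply Rmult_le_pos; [apply Cmod_ge_0|left; apply Ppw]. }
    eapply Rle_trans; [apply Cmod_triangle|]. rewrite HB, Cmod_mult, Cmod_R, Rabs_pos_eq by lra.
    apply Rplus_le_compat_l, Rmult_le_compat_l; [lra|].
    eapply Rle_trans; [apply Cmod_csum|]. right. apply rsum_ext; intros; apply HB.
  + rewrite Rmult_plus_distr_l. apply Rplus_le_compat.
    * right. replace (-1) with (- (al + 1/2) + (al - 1/2)) by field. rewrite <- Hpw. ring.
    * unfold usum. rewrite <- !rsum_scal, <- rsum_plus. apply rsum_le; intros n _.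
      fold (pw n (al - 1)).
      (* The entry is split as [2 p q <= p^2 + q^2], tilted by the ratio [(m/n)^(1/2)] of the
         weights; [p^2] is charged to row [m] and [q^2] to row [n]. *)
      set (p := x m * pw m (- (1/2) * al) * pw n (1/2 * (al - 1))).
      set (q := x n * pw n (1/2 * al) * pw m (- (1/2) * (1 + al))).
      assert (E1 : p ^ 2 = x m ^ 2 * pw m (- al) * pw n (al - 1)).
      { unfold p. replace (- al) with (- (1/2) * al + - (1/2) * al) by field.
        replace (al - 1) with (1/2 * (al - 1) + 1/2 * (al - 1)) at 2 by field. rewrite <- !Hpw. ring. }
      assert (E2 : q ^ 2 = pw m (- (1 + al)) * (x n ^ 2 * pw n al)).
      { unfold q. replace (- (1 + al)) with (- (1/2) * (1 + al) + - (1/2) * (1 + al)) by field.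
        replace al with (1/2 * al + 1/2 * al) at 5 by field. rewrite <- !Hpw. ring. }
      assert (E3 : p * q = x m * pw m (- (al + 1/2)) * (x n * pw n (al - 1/2))).
      { unfold p, q. replace (- (al + 1/2)) with (- (1/2) * al + - (1/2) * (1 + al)) by field.
        replace (al - 1/2) with (1/2 * (al - 1) + 1/2 * al) by field. rewrite <- !Hpw. ring. }
      rewrite <- E1, <- E2.
      replace (x m * pw m (- (al + 1/2)) * (2 * (x n * pw n (al - 1/2)))) with (2 * (p * q)) by (rewrite E3; ring).
      pose proof (pow2_ge_0 (p - q)). lra.
(* The squares charged to row [n] add up to the zeta tail beyond it, and the diagonal [pw m (-1)]
   supplies the last term of [usum al (S m)]. *)
- right. rewrite !rsum_plus, rsum_exchange, <- !rsum_plus. apply rsum_ext; intros m _.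
  unfold schur. change (usum al (S m)) with (usum al m + pw m (al - 1)).
  fold (x m). fold (pw m (- al)). fold (pw m al).
  replace (-1) with (- al + (al - 1)) by ring. rewrite <- Hpw.
  change (rsum (fun k => pw k (- (1 + al))) N) with (zsum al N).
  change (rsum (fun k => pw k (- (1 + al))) (S m)) with (zsum al (S m)). ring.
Qed.

(** * The upper bound *)

(* The value at [None] is the constant term [c_1 = phi(+infinity)]. *)
Definition ext_symbol (c : nat -> C) (x : option C) : C :=
  match x with Some s => dsum c s | None => c 1%nat end.

Definition comp_poly (c a : nat -> C) (N : nat) (x : option C) : C :=
  csum (dterm a (ext_symbol c x)) N.

Lemma dpoly_dterm p N s : dpoly p N (Some s) = csum (dterm p s) N.
Proof. reflexivity. Qed.

Lemma unif_approx_symbol T c : (forall eps, 0 < eps -> dirichlet_cvu c eps) ->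
  (forall n, ~ T n -> c n = RtoC 0) -> forall sig, 0 < sig -> unif_approx T sig (ext_symbol c).
Proof.
intros Hc HT sig Hsig eps Heps.
(* Half of [sig] is given up because [dirichlet_cvu] concerns open half-planes and [dom] is
   closed. *)
destruct (Hc (sig / 2) ltac:(lra) eps Heps) as [N HN].
set (c' := fun n => if Nat.leb n (S N) then c n else RtoC 0).
assert (E : forall x, dpoly c' (S N) x = dpoly c (S N) x).
{ intros x. apply csum_ext; intros k Hk. unfold c'. destruct (Nat.leb_spec (S k) (S N)); [auto|lia]. }
exists (fun x => dpoly c (S N) x); split.
- exists c', (S N); split; [|intros; symmetry; apply E]. split; intros n Hn; unfold c'.
  + destruct (Nat.leb_spec n (S N)); [lia|auto].
  + rewrite HT by auto. destruct (Nat.leb n (S N)); auto.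
- intros [s|] Hs.
  + rewrite dpoly_dterm, <- sum_n_csum. cbn [ext_symbol].
    replace (dsum c s - sum_n (dterm c s) N)%C with (- (sum_n (dterm c s) N - dsum c s))%C.
    * rewrite Cmod_opp. left. apply HN; [lia|]. unfold halfplane; simpl in Hs; lra.
    * generalize (sum_n (dterm c s) N : C). intros z. change (- (z - dsum c s) = dsum c s - z)%C. ring.
  + rewrite dpoly_inf by lia. simpl. replace (c 1%nat - c 1%nat)%C with (RtoC 0) by ring.
    rewrite Cmod_0; lra.
Qed.

Lemma dsum_limit b s z :
  (forall eps, 0 < eps -> exists J0, forall J, (J0 <= J)%nat -> Cmod (csum (dterm b s) J - z)%C <= eps) ->
  dsum b s = z.
Proof.
intros H.
assert (L : forall (f : C -> R), (forall u v, Rabs (f u - f v) <= Cmod (u - v)%C) ->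
  is_lim_seq (fun n => f (csum (dterm b s) (S n))) (f z)).
{ intros f Hf. apply is_lim_seq_spec. intros [e He]. destruct (H (e/2)) as [J0 HJ]; [lra|].
  exists J0; intros n Hn. eapply Rle_lt_trans; [apply Hf|]. simpl pos.
  specialize (HJ (S n) ltac:(lia)). lra. }
unfold dsum. rewrite (surjective_pairing z). f_equal; apply is_series_unique.
- change (is_lim_seq (sum_n (fun k => Re (dterm b s k))) (Re z)).
  apply (is_lim_seq_ext (fun n => Re (csum (dterm b s) (S n)))).
  + intros n. rewrite Re_csum, sum_n_rsum. auto.
  + apply L. intros [x y] [u v]; simpl. eapply Rle_trans; [|apply Rmax_Cmod]. apply Rmax_l.
- change (is_lim_seq (sum_n (fun k => Im (dterm b s k))) (Im z)).
  apply (is_lim_seq_ext (fun n => Im (csum (dterm b s) (S n)))).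
  + intros n. rewrite Im_csum, sum_n_rsum. auto.
  + apply L. intros [x y] [u v]; simpl. eapply Rle_trans; [|apply Rmax_Cmod]. apply Rmax_r.
Qed.

(** Absolute convergence from [2 |a_n n^(-w)| <= |a_n|^2 + n^(-2 Re w)]. *)
Lemma H2_dsum_converges a w : in_H2 a -> 1/2 < Re w ->
  forall eps, 0 < eps -> exists J0, forall J, (J0 <= J)%nat ->
    Cmod (csum (dterm a w) J - dsum a w)%C <= eps.
Proof.
intros Ha Hw.
set (m := fun k => Cmod (a (S k)) ^ 2 + Rpower (INR (S k)) (- (1 + (2 * Re w - 1)))).
assert (Hm : ex_series m).
{ apply (ex_series_plus (fun k => Cmod (a (S k)) ^ 2)); [exact Ha|]. apply zeta1_ex; lra. }
assert (Hle : forall k, Cmod (dterm a w k) <= m k).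
{ intros k. unfold m, dterm. rewrite Cmod_mult, Cmod_npow.
  replace (- (1 + (2 * Re w - 1))) with (- Re w + - Re w) by ring. rewrite Rpower_plus.
  pose proof (pow2_ge_0 (Cmod (a (S k)) - Rpower (INR (S k)) (- Re w))).
  pose proof (Cmod_ge_0 (a (S k))). pose proof (Rpower_pos (INR (S k)) (- Re w)). nra. }
assert (L : forall f : C -> R, (forall z, Rabs (f z) <= Cmod z) -> ex_series (fun k => f (dterm a w k))).
{ intros f Hf. apply (ex_series_le (fun k => f (dterm a w k)) m); auto.
  intros k. eapply Rle_trans; [apply Hf|apply Hle]. }
assert (L1 := rsum_lim _ (L Re (fun z => Rle_trans _ _ _ (Rmax_l _ _) (Rmax_Cmod z)))).
assert (L2 := rsum_lim _ (L Im (fun z => Rle_trans _ _ _ (Rmax_r _ _) (Rmax_Cmod z)))).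
intros eps Heps. apply is_lim_seq_spec in L1, L2.
destruct (L1 (mkposreal (eps/2) ltac:(lra))) as [N1 H1].
destruct (L2 (mkposreal (eps/2) ltac:(lra))) as [N2 H2].
exists (max N1 N2); intros J HJ. specialize (H1 J ltac:(lia)). specialize (H2 J ltac:(lia)).
simpl pos in *. eapply Rle_trans; [apply Cmod_le_abs|].
change (Re (csum (dterm a w) J - dsum a w)%C) with (Re (csum (dterm a w) J) - Re (dsum a w)).
change (Im (csum (dterm a w) J - dsum a w)%C) with (Im (csum (dterm a w) J) - Im (dsum a w)).
change (Re (dsum a w)) with (Series (fun k => Re (dterm a w k))).
change (Im (dsum a w)) with (Series (fun k => Im (dterm a w k))).
rewrite Re_csum, Im_csum. lra.
Qed.

Section Composition.
Variable T : nat -> Prop.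
Hypothesis HT : submonoid T.
Variable c : nat -> C.
Hypothesis Hc : forall sig, 0 < sig -> unif_approx T sig (ext_symbol c).

Lemma unif_approx_npow_symbol n sig : 0 < sig -> unif_approx T sig (fun x => npow n (ext_symbol c x)).
Proof.
intros Hsig. unfold npow. apply unif_approx_exp; auto; [lra|].
apply unif_approx_ext with (fun x => (- RtoC (ln (INR n))) * ext_symbol c x)%C; [intros; ring|].
apply unif_approx_scal; auto; lra.
Qed.

Lemma unif_approx_npow_reflect n sig : 0 < sig -> unif_approx T sig (fun x => npow n (1 - ext_symbol c x)%C).
Proof.
intros Hsig. unfold npow. apply unif_approx_exp; auto; [lra|].
apply unif_approx_ext with (fun x => - RtoC (ln (INR n)) + RtoC (ln (INR n)) * ext_symbol c x)%C; [intros; ring|].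
apply unif_approx_plus; auto; [apply unif_approx_const; auto|].
apply unif_approx_scal; auto; lra.
Qed.

Lemma unif_approx_comp_poly a N sig : 0 < sig -> unif_approx T sig (comp_poly c a N).
Proof.
intros Hsig. unfold comp_poly, dterm.
apply (unif_approx_csum T HT sig (fun k x => a (S k) * npow (S k) (ext_symbol c x))%C).
intros k _. apply unif_approx_scal; auto; [lra|]. apply unif_approx_npow_symbol; auto.
Qed.

Lemma unif_approx_dmajorant a N sig : 0 < sig -> unif_approx T sig (fun x => dmajorant a N (ext_symbol c x)).
Proof.
intros Hsig. assert (H0 : 0 <= sig) by lra. unfold dmajorant, majorant, dterm.
assert (B : forall n, unif_approx T sig (fun x => Cconj (a (S n)) * npow (S n) (1 - ext_symbol c x))%C).
{ intros n. apply unif_approx_scal; auto. apply unif_approx_npow_reflect; auto. }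
apply (unif_approx_csum T HT sig (fun m x => a (S m) * npow (S m) (ext_symbol c x) *
  (Cconj (a (S m)) * npow (S m) (1 - ext_symbol c x) +
   RtoC 2 * csum (fun n => Cconj (a (S n)) * npow (S n) (1 - ext_symbol c x)) m))%C).
intros m _. apply unif_approx_mult; auto; [apply unif_approx_scal; auto; apply unif_approx_npow_symbol; auto|].
apply unif_approx_plus; auto. apply unif_approx_scal; auto.
apply (unif_approx_csum T HT sig (fun n x => Cconj (a (S n)) * npow (S n) (1 - ext_symbol c x))%C).
intros; apply B.
Qed.

Variable K : R.
Hypothesis Hphi : forall s, 0 < Re s -> 1/2 < Re (dsum c s).
Hypothesis Hc1 : 1/2 < Re (c 1%nat).
Hypothesis HK : forall m N, (1 <= m <= N)%nat -> schur (Re (c 1%nat) - 1/2) m N <= K.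

(** The constant term of the composed majorant is its value at [c 1], so the Schur test is applied
    only with [al = Re c_1 - 1/2]. *)
Lemma comp_poly_norm_le a N b : bohr_coef (comp_poly c a N) b ->
  forall J, rsum (fun k => Cmod (b (S k)) ^ 2) J <= K * rsum (fun k => Cmod (a (S k)) ^ 2) N.
Proof.
intros Hb J.
eapply Rle_trans.
- apply (bohr_coef_norm_le T (comp_poly c a N) (fun sig => unif_approx_comp_poly a N sig)
    (fun x => dmajorant a N (ext_symbol c x))); eauto.
  + intros; apply unif_approx_dmajorant; auto.
  + intros s Hs. apply dmajorant_ge. left. apply Hphi; auto.
- eapply Rle_trans; [apply dmajorant_schur; auto|]. rewrite <- rsum_scal.
  apply rsum_le; intros k Hk. rewrite Rmult_comm. apply Rmult_le_compat_r; [apply pow2_ge_0|].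
  apply HK; lia.
Qed.

Lemma K_pos : 0 <= K.
Proof.
eapply Rle_trans; [|apply (HK 1 1); lia]. unfold schur.
replace (zsum (Re (c 1%nat) - 1 / 2) 1 - zsum (Re (c 1%nat) - 1 / 2) 1) with 0 by ring.
rewrite usum_1. pose proof (Rpower_pos (INR 1) (- (Re (c 1%nat) - 1 / 2))). lra.
Qed.

(** The difference of two truncations is the composition of the block between them, to which the
    norm bound applies. *)
Lemma comp_poly_diff a N M b d : (N <= M)%nat -> bohr_coef (comp_poly c a N) b -> bohr_coef (comp_poly c a M) d ->
  forall J, rsum (fun k => Cmod (d (S k) - b (S k))%C ^ 2) J <=
    K * (rsum (fun k => Cmod (a (S k)) ^ 2) M - rsum (fun k => Cmod (a (S k)) ^ 2) N).
Proof.
intros HNM Hb Hd J.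
set (a' := fun n => if Nat.leb n N then RtoC 0 else a n).
destruct (bohr_coef_exists T (comp_poly c a' M) (fun sig => unif_approx_comp_poly a' M sig)) as (b' & Hb' & _).
assert (E0 : forall (f : nat -> C), csum (fun k => if Nat.leb (S k) N then RtoC 0 else f k) M =
   (csum f M - csum f N)%C).
{ intros f. clear -HNM. induction HNM as [|M H IH].
  - rewrite (csum_ext _ (fun _ => RtoC 0 * RtoC 0)%C).
    + rewrite csum_scal; ring.
    + intros k Hk. destruct (Nat.leb_spec (S k) N); [ring|lia].
  - cbn [csum]. rewrite IH. destruct (Nat.leb_spec (S M) N); [lia|]. ring. }
assert (E : forall k, b' (S k) = (d (S k) - b (S k))%C).
{ apply (bohr_coef_minus T (comp_poly c a M) (fun sig => unif_approx_comp_poly a M sig) (comp_poly c a N) (comp_poly c a' M)); auto.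
  - intros; apply unif_approx_comp_poly; auto.
  - intros s. unfold comp_poly. rewrite <- E0. apply csum_ext; intros k _. unfold dterm, a'.
    destruct (Nat.leb (S k) N); ring. }
rewrite (rsum_ext _ (fun k => Cmod (b' (S k)) ^ 2)) by (intros; rewrite E; auto).
eapply Rle_trans; [apply (comp_poly_norm_le a' M b' Hb')|]. right. f_equal.
apply RtoC_inj. rewrite RtoC_minus, <- !csum_RtoC, <- E0. apply csum_ext; intros k _.
unfold a'. destruct (Nat.leb (S k) N); auto. rewrite Cmod_0. f_equal; ring.
Qed.

Lemma comp_exists a : in_H2 a -> exists b,
  (forall s, 1/2 < Re s -> dsum b s = dsum a (dsum c s)) /\
  forall J, rsum (fun k => Cmod (b (S k)) ^ 2) J <= K * Series (fun k => Cmod (a (S k)) ^ 2).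
Proof.
intros Ha. pose proof K_pos as HK0.
set (f := fun k => Cmod (a (S k)) ^ 2).
assert (Hf : forall k, 0 <= f k) by (intros; apply pow2_ge_0).
assert (HS : forall N, rsum f N <= Series f) by (intros; apply rsum_le_Series; auto).
set (V := Series f) in *.
assert (HV : 0 <= V) by (apply (HS 0%nat)).
(* The tail beyond [N i] costs at most [1/(i+1)^2], which yields a Cauchy sequence with explicit
   rate; [i <= N i] makes the truncations exhaust [a]. *)
destruct (functional_choice (fun i N => (i <= N)%nat /\ K * (V - rsum f N) <= (/ INR (S i)) ^ 2)) as [N HN].
{ intros i. pose proof (inv_INR_pos i) as P.
  assert (L := rsum_lim f Ha). apply is_lim_seq_spec in L.
  assert (Q : 0 < (/ INR (S i)) ^ 2 / (K + 1)) by (apply Rdiv_lt_0_compat; [apply pow_lt; auto|lra]).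
  destruct (L (mkposreal _ Q)) as [N0 H0]. exists (max i N0); split; [lia|].
  specialize (H0 (max i N0) ltac:(lia)). cbn [pos] in H0. fold V in H0.
  pose proof (HS (max i N0)). rewrite Rabs_left1 in H0 by lra.
  apply Rle_trans with ((K + 1) * ((/ INR (S i)) ^ 2 / (K + 1))); [|right; generalize ((/ INR (S i)) ^ 2); intros x; field; lra].
  apply Rmult_le_compat; lra. }
destruct (functional_choice (fun i b => bohr_coef (comp_poly c a (N i)) b /\ forall k, ~ T (S k) -> b (S k) = RtoC 0)) as [u Hu].
{ intros i. apply (bohr_coef_exists T). intros; apply unif_approx_comp_poly; auto. }
assert (Hd0 : forall i j J, (N i <= N j)%nat ->
  rsum (fun k => Cmod (u j (S k) - u i (S k))%C ^ 2) J <= (/ INR (S i)) ^ 2).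
{ intros i j J Hij. destruct (Hu i), (Hu j), (HN i) as [_ Hi].
  eapply Rle_trans; [apply (comp_poly_diff a (N i) (N j)); auto|].
  eapply Rle_trans; [|apply Hi]. apply Rmult_le_compat_l; auto. fold f. specialize (HS (N j)). lra. }
assert (Hd : forall i j J,
  rsum (fun k => Cmod (u i (S k) - u j (S k))%C ^ 2 * 1) J <= (/ INR (S i) + / INR (S j)) ^ 2).
{ intros i j J. pose proof (inv_INR_pos i). pose proof (inv_INR_pos j).
  rewrite (rsum_ext _ (fun k => Cmod (u i (S k) - u j (S k))%C ^ 2)) by (intros; ring).
  destruct (Nat.le_ge_cases (N i) (N j)) as [h|h].
  - rewrite (rsum_ext _ (fun k => Cmod (u j (S k) - u i (S k))%C ^ 2)).
    + eapply Rle_trans; [apply Hd0; auto|]. apply pow_incr; lra.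
    + intros k _. f_equal. rewrite <- Cmod_opp. f_equal; ring.
  - eapply Rle_trans; [apply Hd0; auto|]. apply pow_incr; lra. }
assert (Hl : forall k, exists l, forall i, Cmod (u i (S k) - l)%C <= 1 * / INR (S i)).
{ intros k. apply C_cauchy_limit; [lra|]. intros i j. rewrite Rmult_1_l.
  pose proof (inv_INR_pos i). pose proof (inv_INR_pos j).
  assert (X := rsum_term (fun k => Cmod (u i (S k) - u j (S k))%C ^ 2 * 1) (S k) k).
  specialize (Hd i j (S k)). pose proof (Cmod_ge_0 (u i (S k) - u j (S k))%C) as P.
  assert (Y : Cmod (u i (S k) - u j (S k))%C ^ 2 <= (/ INR (S i) + / INR (S j)) ^ 2).
  { eapply Rle_trans; [|apply Hd]. rewrite <- (Rmult_1_r (Cmod _ ^ 2)). apply X; auto.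
    intros n. pose proof (pow2_ge_0 (Cmod (u i (S n) - u j (S n))%C)); lra. }
  nra. }
apply functional_choice in Hl. destruct Hl as [l Hl].
assert (Hul : forall i J, rsum (fun k => Cmod (u i (S k) - l k)%C ^ 2 * 1) J <= (/ INR (S i)) ^ 2).
{ intros i J. apply (l2_limit (fun j k => u j (S k)) l (fun k => u i (S k)) (fun _ => 1) (fun _ => 1)); auto.
  exists 0%nat; intros j _. apply Hd. }
exists (fun n => l (pred n)); split.
- intros s Hs. apply dsum_limit. intros eps Heps.
  set (del := eps / 6).
  set (D := 1 + / (2 * Re s - 1)).
  assert (HD : 0 < D) by (assert (0 < / (2 * Re s - 1)) by (apply Rinv_0_lt_compat; lra); unfold D; lra).
  set (th := eps / (3 * (1 + D))).
  assert (Hth : 0 < th) by (apply Rdiv_lt_0_compat; lra).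
  destruct (INR_unbounded (/ th)) as [i0 Hi0].
  assert (HRw : 1/2 < Re (dsum c s)) by (apply Hphi; lra).
  destruct (H2_dsum_converges a (dsum c s) Ha HRw (eps/3) ltac:(lra)) as [J1 HJ1].
  set (i := max i0 J1). destruct (Hu i) as [Hui HuT].
  assert (Hi : / INR (S i) <= th).
  { rewrite <- (Rinv_inv th). apply Rinv_le_contravar; [apply Rinv_0_lt_compat; auto|].
    apply Rle_trans with (INR i0); [lra|]. apply le_INR. unfold i; lia. }
  (* This [sig] leaves [2 (Re s - sig) = 1 + (Re s - 1/2)], an exponent above 1. *)
  destruct (bohr_coef_partial_sums T (comp_poly c a (N i)) (fun sig H => unif_approx_comp_poly a (N i) sig H) (u i) s
    ((Re s - 1/2) / 2) (fun k => Rpower (INR (S k)) (- (1 + (Re s - 1/2)))) (1 + / (Re s - 1/2)) Hui HuT)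
    with (eps := eps / 3) as [J0 HJ0]; try lra.
  + intros; left; apply Rpower_pos.
  + intros k _. right; f_equal; field.
  + intros J; apply zsum_bound; lra.
  + exists J0; intros J HJ.
    (* Three errors of size [eps/3]: exchanging [l] for [u i], summing the series of [u i] at [s],
       and truncating [a] at [phi(s)]. *)
    replace (csum (dterm (fun n => l (pred n)) s) J - dsum a (dsum c s))%C with
      ((- csum (fun k => (u i (S k) - l k) * npow (S k) s) J +
        (csum (dterm (u i) s) J - comp_poly c a (N i) (Some s))) +
        (comp_poly c a (N i) (Some s) - dsum a (dsum c s)))%C.
    2:{ replace (csum (fun k => (u i (S k) - l k) * npow (S k) s)%C J) with
         (csum (dterm (u i) s) J + (-(1)) * csum (dterm (fun n => l (pred n)) s) J)%C; [ring|].
        rewrite <- csum_scal, <- csum_plus. apply csum_ext; intros k _. unfold dterm. simpl pred. ring. }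
    eapply Rle_trans; [apply Cmod_triangle|].
    assert (X3 : Cmod (comp_poly c a (N i) (Some s) - dsum a (dsum c s))%C <= eps / 3).
    { apply HJ1. destruct (HN i). unfold i in *; lia. }
    assert (X12 := Cmod_triangle (- csum (fun k => (u i (S k) - l k) * npow (S k) s) J)%C
        (csum (dterm (u i) s) J - comp_poly c a (N i) (Some s))%C).
    rewrite Cmod_opp in X12. specialize (HJ0 J HJ).
    assert (X1 : Cmod (csum (fun k => (u i (S k) - l k) * npow (S k) s)%C J) <= eps / 3).
    { eapply Rle_trans.
      - apply (weighted_cs (fun k => u i (S k) - l k)%C s 0 (fun k => Rpower (INR (S k)) (- (1 + (2 * Re s - 1)))) th J Hth).
        + intros; left; apply Rpower_pos.
        + intros k. right. right. f_equal; ring.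
      - fold (zsum (2 * Re s - 1) J).
        assert (Y1 : rsum (fun k => Cmod (u i (S k) - l k)%C ^ 2 * wt 0 k) J <= th ^ 2).
        { rewrite (rsum_ext _ (fun k => Cmod (u i (S k) - l k)%C ^ 2 * 1)).
          - eapply Rle_trans; [apply Hul|]. apply pow_incr; split; auto. left; apply inv_INR_pos.
          - intros k _. f_equal. unfold wt. rewrite Rmult_0_r, Ropp_0. apply Rpower_O. pose proof (INR_ge1 k); lra. }
        assert (Y2 : zsum (2 * Re s - 1) J <= D) by (apply zsum_bound; lra).
        assert (Y3 : / th * rsum (fun k => Cmod (u i (S k) - l k)%C ^ 2 * wt 0 k) J <= th).
        { apply Rmult_le_reg_l with th; auto. rewrite <- Rmult_assoc, Rinv_r, Rmult_1_l by lra.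
          replace (th * th) with (th ^ 2) by ring. auto. }
        assert (Y4 : th * zsum (2 * Re s - 1) J <= th * D) by (apply Rmult_le_compat_l; lra).
        assert (Y5 : th * (1 + D) = eps / 3) by (unfold th; field; lra).
        lra. }
    lra.
- intros J. simpl pred.
  assert (HKV : 0 <= K * V) by (apply Rmult_le_pos; auto).
  rewrite <- (pow2_sqrt (K * V)) by auto.
  rewrite (rsum_ext _ (fun k => Cmod (RtoC 0 - l k)%C ^ 2 * 1)).
  2:{ intros k _. rewrite Rmult_1_r. f_equal. rewrite <- Cmod_opp. f_equal; ring. }
  apply (l2_limit (fun j k => u j (S k)) l (fun _ => RtoC 0) (fun _ => 1) (fun _ => 1)); auto.
  exists 0%nat; intros j _. destruct (Hu j) as [Huj _].
  rewrite (rsum_ext _ (fun k => Cmod (u j (S k)) ^ 2)).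
  2:{ intros k _. rewrite Rmult_1_r. f_equal. rewrite <- Cmod_opp. f_equal; ring. }
  eapply Rle_trans; [apply (comp_poly_norm_le a (N j) (u j) Huj)|].
  apply Rle_trans with (K * V); [apply Rmult_le_compat_l; auto; apply HS|].
  rewrite <- (pow2_sqrt (K * V)) at 1 by auto. apply pow_incr.
  pose proof (sqrt_pos (K * V)). pose proof (inv_INR_pos j). lra.
Qed.
End Composition.

(** * The extremal symbol *)

Lemma in_G_comp_bound c K : in_G 0 c -> 1/2 < Re (c 1%nat) ->
  (forall m N, (1 <= m <= N)%nat -> schur (Re (c 1%nat) - 1/2) m N <= K) ->
  comp_bound (symbol 0 c) (sqrt K).
Proof.
intros [Hcvu [Hhp _]] Hc1 HK.
assert (HT : submonoid (fun _ => True)) by (split; auto).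
assert (HAP := unif_approx_symbol (fun _ => True) c Hcvu ltac:(tauto)).
assert (Hphi : forall s, 0 < Re s -> 1/2 < Re (dsum c s)) by (intros s Hs; apply Hhp; auto).
assert (HK0 := K_pos c K HK).
split; [apply sqrt_pos|]. intros a Ha.
destruct (comp_exists (fun _ => True) HT c HAP K Hphi Hc1 HK a Ha) as (b & Hb & Hbn).
destruct (ex_series_bounded (fun k => Cmod (b (S k)) ^ 2) _ (fun k => pow2_ge_0 _) Hbn) as [Hex HS].
exists b; split; [split; [exact Hex|]|].
- intros s Hs. rewrite Hb by exact Hs. f_equal. unfold symbol. simpl INR. ring.
- unfold H2norm. rewrite <- sqrt_mult_alt by auto. apply sqrt_le_1_alt; auto.
Qed.

(** * Series supported on the powers of 2 *)

Definition power_of_2 (n : nat) : Prop := exists j, n = (2 ^ j)%nat.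

Lemma power_of_2_submonoid : submonoid power_of_2.
Proof.
split; [exists 0%nat; auto|]. intros m n _ _ [i ->] [j ->]. exists (i + j)%nat.
rewrite Nat.pow_add_r; auto.
Qed.

Definition sparse {A} (zero : A) (f : nat -> A) (n : nat) : A :=
  if Nat.eqb n (2 ^ Nat.log2 n) then f (Nat.log2 n) else zero.

(** A new index either is a power of 2, exactly when [Nat.log2] jumps, or adds 0. *)
Lemma csum_sparse f n : csum (fun k => sparse (RtoC 0) f (S k)) (S n) = csum f (S (Nat.log2 (S n))).
Proof.
induction n as [|n IH]; [reflexivity|].
change (csum (fun k => sparse (RtoC 0) f (S k)) (S (S n))) with
  (csum (fun k => sparse (RtoC 0) f (S k)) (S n) + sparse (RtoC 0) f (S (S n)))%C.
rewrite IH. unfold sparse.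
destruct (Nat.log2_spec (S n)) as [L1 L2]; [lia|].
destruct (Nat.log2_spec (S (S n))) as [L3 L4]; [lia|].
destruct (Nat.log2_succ_or (S n)) as [E|E]; rewrite E in *.
- destruct (Nat.eqb_spec (S (S n)) (2 ^ S (Nat.log2 (S n)))); [reflexivity|lia].
- destruct (Nat.eqb_spec (S (S n)) (2 ^ Nat.log2 (S n))); [lia|ring].
Qed.

Lemma rsum_sparse f n : rsum (fun k => sparse 0 f (S k)) (S n) = rsum f (S (Nat.log2 (S n))).
Proof.
apply RtoC_inj. rewrite <- !csum_RtoC, <- csum_sparse. apply csum_ext; intros k _.
unfold sparse. destruct (Nat.eqb _ _); auto.
Qed.

Lemma power_of_2_log2 n : power_of_2 n <-> n = (2 ^ Nat.log2 n)%nat.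
Proof.
split; [|exists (Nat.log2 n); auto]. intros [j ->]. rewrite Nat.log2_pow2 by lia. auto.
Qed.

Lemma geometric_sum_le q n : 0 <= q < 1 -> rsum (fun j => q ^ j) n <= / (1 - q).
Proof.
intros Hq.
assert (E : (1 - q) * rsum (fun j => q ^ j) n = 1 - q ^ n).
{ induction n as [|n IH]; [simpl; ring|]. cbn [rsum]. rewrite Rmult_plus_distr_l, IH. simpl; ring. }
apply Rmult_le_reg_l with (1 - q); [lra|]. rewrite E, Rinv_r by lra.
pose proof (pow_le q n ltac:(lra)). lra.
Qed.

Lemma sparse_geometric_le q n : 0 <= q < 1 -> rsum (fun k => sparse 0 (fun j => q ^ j) (S k)) n <= / (1 - q).
Proof.
intros Hq. destruct n as [|n].
- simpl. left; apply Rinv_0_lt_compat; lra.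
- rewrite rsum_sparse. apply geometric_sum_le; auto.
Qed.

Lemma Rpower_pow2 k t : power_of_2 (S k) -> Rpower (INR (S k)) (- t) = sparse 0 (fun j => Rpower 2 (- t) ^ j) (S k).
Proof.
intros H. apply power_of_2_log2 in H. unfold sparse. rewrite <- H, Nat.eqb_refl, H at 1.
rewrite pow_INR, <- !Rpower_pow by (simpl; try apply Rpower_pos; lra).
rewrite !Rpower_mult. replace (INR 2) with 2 by (simpl; ring). f_equal; ring.
Qed.

Lemma npow_pow2 j s : npow (2 ^ j) s = (npow 2 s ^ j)%C.
Proof.
induction j as [|j IH]; [apply npow_1|].
rewrite Nat.pow_succ_r', <- npow_mult, IH; [reflexivity|lia|].
pose proof (Nat.pow_nonzero 2 j). lia.
Qed.

(* Coefficients of [1/2 + al (1 - z) / (1 + z)] with [z = 2^(-s)], the Riemann map of the disc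
   onto [Re > 1/2] sending [z = 0], i.e. [s = +infinity], to [1/2 + al]. *)
Definition ecoef (al : R) (n : nat) : C :=
  sparse (RtoC 0) (fun j => match j with O => RtoC (1/2 + al) | S _ => (RtoC (2 * al) * (- RtoC 1) ^ j)%C end) n.

Definition emap (al : R) (z : C) : C := (RtoC (1/2) + RtoC al * ((1 - z) / (1 + z)))%C.

Lemma one_plus_neq0 z : Cmod z < 1 -> (1 + z)%C <> RtoC 0.
Proof.
intros Hz E. assert (z = (- RtoC 1)%C).
{ replace z with ((1 + z) + - RtoC 1)%C by ring. rewrite E; ring. }
subst z. rewrite Cmod_opp, Cmod_1 in Hz. lra.
Qed.

Lemma ecoef_partial_sum al s n : Cmod (npow 2 s) < 1 ->
  csum (dterm (ecoef al) s) (S n) =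
  (emap al (npow 2 s) - RtoC (2 * al) * (- npow 2 s) ^ S (Nat.log2 (S n)) / (1 + npow 2 s))%C.
Proof.
intros Hz. set (z := npow 2 s) in *. pose proof (one_plus_neq0 z Hz) as Hne.
set (f := fun j => (match j with O => RtoC (1/2 + al) | S _ => (RtoC (2 * al) * (- RtoC 1) ^ j)%C end * z ^ j)%C).
rewrite (csum_ext _ (fun k => sparse (RtoC 0) f (S k))).
- rewrite csum_sparse. generalize (Nat.log2 (S n)); clear n; intros n.
  induction n as [|n IH].
  + unfold emap, f. cbn [csum]. rewrite Cpow_1_r, RtoC_plus, RtoC_mult.
    change (z ^ 0)%C with (RtoC 1). generalize (RtoC (1/2)); intros h. field; auto.
  + change (csum f (S (S n))) with (csum f (S n) + f (S n))%C. rewrite IH. unfold f.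
    replace ((- z) ^ S (S n))%C with (- z * (- z) ^ S n)%C by (rewrite (Cpow_S _ (S n)); auto).
    replace ((- z) ^ S n)%C with ((- RtoC 1) ^ S n * z ^ S n)%C.
    * field; auto.
    * rewrite <- Cpow_mult_l. f_equal. ring.
- intros k _. unfold dterm, ecoef, sparse, f.
  destruct (Nat.eqb_spec (S k) (2 ^ Nat.log2 (S k))) as [E|E]; [|ring].
  rewrite E at 2. rewrite npow_pow2. reflexivity.
Qed.

(** The bound depends on [s] through [r] only, and this is uniform convergence on [Re s >= eps],
    with [r = 2^(-eps)]. *)
Lemma ecoef_error al s r n : 0 < al -> Cmod (npow 2 s) <= r < 1 ->
  Cmod (csum (dterm (ecoef al) s) (S n) - emap al (npow 2 s))%C <= 2 * al / (1 - r) * r ^ S (Nat.log2 (S n)).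
Proof.
intros Hal Hr. rewrite ecoef_partial_sum by lra. set (z := npow 2 s) in *.
pose proof (one_plus_neq0 z ltac:(lra)) as Hne.
set (m := S (Nat.log2 (S n))).
replace (emap al z - RtoC (2 * al) * (- z) ^ m / (1 + z) - emap al z)%C with
  (- (RtoC (2 * al) * (- z) ^ m / (1 + z)))%C by ring.
rewrite Cmod_opp, Cmod_div by exact Hne. rewrite Cmod_mult, Cmod_R, Cmod_pow, Cmod_opp, Rabs_pos_eq by lra.
assert (H1 : 1 - r <= Cmod (1 + z)%C).
{ assert (Cmod (RtoC 1) <= Cmod (1 + z)%C + Cmod z).
  { pose proof (Cmod_triangle (1 + z)%C (- z)%C) as Tr. rewrite Cmod_opp in Tr.
    replace (1 + z + - z)%C with (RtoC 1) in Tr by ring. exact Tr. }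
  rewrite Cmod_1 in H. lra. }
assert (H2 : Cmod z ^ m <= r ^ m) by (apply pow_incr; split; [apply Cmod_ge_0|lra]).
assert (H3 : 0 <= Cmod z ^ m) by (apply pow_le, Cmod_ge_0).
replace (2 * al / (1 - r) * r ^ m) with (2 * al * r ^ m * / (1 - r)) by (field; lra).
unfold Rdiv. apply Rmult_le_compat.
- apply Rmult_le_pos; lra.
- left; apply Rinv_0_lt_compat; lra.
- apply Rmult_le_compat_l; lra.
- apply Rinv_le_contravar; lra.
Qed.

Lemma pow_log2_small r B eps : 0 <= r < 1 -> 0 < B -> 0 < eps ->
  exists n0, forall n, (n0 <= n)%nat -> B * r ^ S (Nat.log2 (S n)) < eps.
Proof.
intros Hr HB Heps.
destruct (pow_lt_1_zero r) with (y := eps / B) as [m Hm]; [rewrite Rabs_pos_eq; lra|apply Rdiv_lt_0_compat; auto|].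
exists (2 ^ m)%nat; intros n Hn.
assert (L : (m <= S (Nat.log2 (S n)))%nat).
{ apply Nat.le_trans with (Nat.log2 (S n)); [|lia]. rewrite <- (Nat.log2_pow2 m) by lia.
  apply Nat.log2_le_mono; lia. }
specialize (Hm _ L). rewrite Rabs_pos_eq in Hm by (apply pow_le; lra).
apply Rmult_lt_reg_l with (/ B); [apply Rinv_0_lt_compat; auto|].
rewrite <- Rmult_assoc, Rinv_l, Rmult_1_l by lra. replace (/ B * eps) with (eps / B) by (field; lra). auto.
Qed.

Lemma npow2_lt1 s : 0 < Re s -> Cmod (npow 2 s) < 1.
Proof.
intros Hs. rewrite Cmod_npow. replace (INR 2) with 2 by (simpl; ring).
apply Rlt_le_trans with (Rpower 2 0); [apply Rpower_lt; lra|]. rewrite Rpower_O; lra.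
Qed.

Lemma dsum_ecoef al s : 0 < al -> 0 < Re s -> dsum (ecoef al) s = emap al (npow 2 s).
Proof.
intros Hal Hs. pose proof (npow2_lt1 s Hs) as Hr. pose proof (Cmod_ge_0 (npow 2 s)).
apply dsum_limit. intros eps Heps.
destruct (pow_log2_small (Cmod (npow 2 s)) (2 * al / (1 - Cmod (npow 2 s))) eps) as [n0 Hn0]; auto.
{ apply Rdiv_lt_0_compat; lra. }
exists (S n0); intros J HJ. destruct J as [|J]; [lia|].
eapply Rle_trans; [apply ecoef_error; [auto|split; [apply Rle_refl|auto]]|]. left; apply Hn0; lia.
Qed.

Lemma emap_halfplane al z : 0 < al -> Cmod z < 1 -> 1/2 < Re (emap al z).
Proof.
intros Hal Hz. pose proof (Cmod_sqr z) as E. pose proof (Cmod_ge_0 z) as P.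
destruct z as [x y]. simpl in E.
assert (Hxy : x * x + y * y < 1) by nra.
assert (D : 0 < (1 + x) * (1 + x) + y * y) by nra.
assert (R : Re (emap al (x, y)) = 1/2 + al * ((1 - (x * x + y * y)) / ((1 + x) * (1 + x) + y * y))).
{ unfold emap, Cdiv, Cinv, Cminus, Cplus, Cmult, Copp, RtoC, Re; simpl. field. nra. }
rewrite R. assert (0 < al * ((1 - (x * x + y * y)) / ((1 + x) * (1 + x) + y * y))).
{ apply Rmult_lt_0_compat; auto. apply Rdiv_lt_0_compat; lra. }
lra.
Qed.

Lemma ecoef_1 al : ecoef al 1 = RtoC (1/2 + al).
Proof. reflexivity. Qed.

Lemma ecoef_cvu al eps : 0 < al -> 0 < eps -> dirichlet_cvu (ecoef al) eps.
Proof.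
intros Hal Heps eta Heta.
set (r := Rpower 2 (- eps)).
assert (Hr : 0 <= r < 1).
{ split; [left; apply Rpower_pos|]. unfold r.
  apply Rlt_le_trans with (Rpower 2 0); [apply Rpower_lt; lra|]. rewrite Rpower_O; lra. }
destruct (pow_log2_small r (2 * al / (1 - r)) eta) as [n0 Hn0]; auto.
{ apply Rdiv_lt_0_compat; lra. }
exists n0; intros n Hn s Hs. unfold halfplane in Hs.
rewrite dsum_ecoef by lra. rewrite sum_n_csum.
eapply Rle_lt_trans; [|apply (Hn0 n Hn)].
apply ecoef_error; auto. split; [|lra].
rewrite Cmod_npow. replace (INR 2) with 2 by (simpl; ring). apply Rle_Rpower; lra.
Qed.

Lemma ecoef_in_G al : 0 < al -> in_G 0 (ecoef al).
Proof.
intros Hal. split; [|split].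
- intros eps Heps. apply ecoef_cvu; auto.
- intros _ s Hs. unfold halfplane. rewrite dsum_ecoef by auto.
  apply emap_halfplane; auto. apply npow2_lt1; auto.
- intros H; lia.
Qed.

Lemma ecoef_support al n : ~ power_of_2 n -> ecoef al n = RtoC 0.
Proof.
intros H. unfold ecoef, sparse. destruct (Nat.eqb_spec n (2 ^ Nat.log2 n)) as [E|E]; auto.
exfalso; apply H, power_of_2_log2; auto.
Qed.

Lemma npow_real n x : npow n (RtoC x) = RtoC (Rpower (INR n) (- x)).
Proof.
unfold npow, Rpower. rewrite <- Cexp_RtoC. f_equal. apply injective_projections; simpl; ring.
Qed.

Lemma zeta_real al : 0 < al -> zeta (RtoC (1 + al)) = RtoC (zeta1 al).
Proof.
intros Hal. apply dsum_limit. intros eps Heps.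
pose proof (zsum_lim al Hal) as L. apply is_lim_seq_spec in L.
destruct (L (mkposreal eps Heps)) as [J0 HJ0]. exists J0; intros J HJ. specialize (HJ0 J HJ).
cbn [pos] in HJ0.
replace (csum (dterm (fun _ => RtoC 1) (RtoC (1 + al))) J) with (RtoC (zsum al J)).
- rewrite <- RtoC_minus, Cmod_R. left; auto.
- unfold zsum. rewrite <- csum_RtoC. apply csum_ext; intros k _. unfold dterm. rewrite npow_real. ring.
Qed.

Lemma zeta_equation al : 0 < al ->
  ((RtoC al * zeta (RtoC (1 + al)))%C = RtoC 2 <-> al * zeta1 al = 2).
Proof.
intros Hal. rewrite zeta_real, <- RtoC_mult by auto. split; [apply RtoC_inj|intros ->; auto].
Qed.

Lemma zeta1_ge_inv a : 0 < a -> / a <= zeta1 a.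
Proof.
intros Ha. apply Rmult_le_reg_l with a; auto. rewrite Rinv_r by lra.
apply le_of_le_add_eps with 1. intros eps Heps.
(* [N > eps^(-1/a)] makes the part [(N+1)^(-a)] missing from the integral at most [eps]. *)
destruct (INR_unbounded (Rpower eps (- / a))) as [N HN].
pose proof (zsum_tail_lower a 0 N Ha ltac:(lia)) as H. pose proof (zsum_le_zeta1 a N Ha) as H'.
replace (zsum a 0) with 0 in H by reflexivity.
assert (E1 : Rpower (INR 1) (- a) = 1) by (simpl INR; unfold Rpower; rewrite ln_1, Rmult_0_r; apply exp_0).
rewrite E1 in H.
assert (E2 : Rpower (INR (S N)) (- a) <= eps).
{ pose proof (Rpower_pos eps (- / a)) as P.
  assert (E3 : Rpower (Rpower eps (- / a)) a = / eps).
  { rewrite Rpower_mult. replace (- / a * a) with (- (1)) by (field; lra).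
    rewrite Rpower_Ropp, Rpower_1; lra. }
  rewrite Rpower_Ropp, <- (Rinv_inv eps), <- E3.
  apply Rinv_le_contravar; [apply Rpower_pos|]. apply Rle_Rpower_l; [lra|]. rewrite S_INR. lra. }
apply Rle_trans with (a * zsum a N + eps).
- assert (a * ((1 - Rpower (INR (S N)) (- a)) / a) <= a * (zsum a N - 0)) by (apply Rmult_le_compat_l; lra).
  replace (a * ((1 - Rpower (INR (S N)) (- a)) / a)) with (1 - Rpower (INR (S N)) (- a)) in H0 by (field; lra). lra.
- assert (a * zsum a N <= a * zeta1 a) by (apply Rmult_le_compat_l; lra). lra.
Qed.

Lemma csum_diff_le (f : nat -> C) (m : nat -> R) n J : (forall k, Cmod (f k) <= m k) -> (n <= J)%nat ->
  Cmod (csum f J - csum f n)%C <= rsum m J - rsum m n.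
Proof.
intros H; induction 1 as [|J HJ IH].
- replace (csum f n - csum f n)%C with (RtoC 0) by ring. rewrite Cmod_0; lra.
- cbn [csum rsum]. replace (csum f J + f J - csum f n)%C with ((csum f J - csum f n) + f J)%C by ring.
  eapply Rle_trans; [apply Cmod_triangle|]. specialize (H J). lra.
Qed.

(** * Identification of coefficients and the lower bound *)

Lemma H2_uniform b : in_H2 b -> forall eps, 0 < eps -> exists n0, forall n s, (n0 <= n)%nat -> 2 <= Re s ->
  Cmod (dsum b s - csum (dterm b s) n)%C <= eps.
Proof.
intros Hb eps Heps.
set (m := fun k => Cmod (b (S k)) ^ 2 + Rpower (INR (S k)) (- (1 + 3))).
assert (Hm : ex_series m).
{ apply (ex_series_plus (fun k => Cmod (b (S k)) ^ 2)); [exact Hb|]. apply zeta1_ex; lra. }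
assert (Hm0 : forall k, 0 <= m k).
{ intros k. unfold m. pose proof (pow2_ge_0 (Cmod (b (S k)))). pose proof (Rpower_pos (INR (S k)) (- (1 + 3))). lra. }
assert (Hle : forall s k, 2 <= Re s -> Cmod (dterm b s k) <= m k).
{ intros s k Hs. unfold m, dterm. rewrite Cmod_mult, Cmod_npow.
  replace (- (1 + 3)) with (- (2) + - (2)) by ring. rewrite Rpower_plus.
  assert (Rpower (INR (S k)) (- Re s) <= Rpower (INR (S k)) (- (2))) by (apply Rle_Rpower; [apply INR_ge1|lra]).
  pose proof (pow2_ge_0 (Cmod (b (S k)) - Rpower (INR (S k)) (- (2)))).
  pose proof (Cmod_ge_0 (b (S k))). pose proof (Rpower_pos (INR (S k)) (- (2))).
  pose proof (Rpower_pos (INR (S k)) (- Re s)). nra. }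
assert (L := rsum_lim m Hm). apply is_lim_seq_spec in L.
destruct (L (mkposreal (eps / 2) ltac:(lra))) as [n0 Hn0]. cbn [pos] in Hn0.
exists n0; intros n s Hn Hs. specialize (Hn0 n Hn).
destruct (H2_dsum_converges b s Hb ltac:(lra) (eps / 2) ltac:(lra)) as [J0 HJ0].
set (J := max n J0). specialize (HJ0 J ltac:(unfold J; lia)).
pose proof (csum_diff_le (dterm b s) m n J (fun k => Hle s k Hs) ltac:(unfold J; lia)) as D.
pose proof (rsum_le_Series m J Hm0 Hm). pose proof (rsum_le_Series m n Hm0 Hm).
rewrite Rabs_left1 in Hn0 by lra.
replace (dsum b s - csum (dterm b s) n)%C with
  (- (csum (dterm b s) J - dsum b s) + (csum (dterm b s) J - csum (dterm b s) n))%C by ring.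
eapply Rle_trans; [apply Cmod_triangle|]. rewrite Cmod_opp. lra.
Qed.

(** Truncations of [b] are uniform approximants of [F] on [Re s >= 2], and [bohr_coef] compares
    every approximant with [b']. This pins down the sequence whose existence [comp_bound] asserts,
    in particular its support. *)
Lemma H2_coefficients_unique F b b' : in_H2 b -> (forall s, 1/2 < Re s -> dsum b s = F (Some s)) ->
  bohr_coef F b' -> forall k, b (S k) = b' (S k).
Proof.
intros Hb HF Hb' k.
assert (Z : Cmod (b (S k) - b' (S k))%C <= 0).
{ apply le_of_le_add_eps with (Rpower (INR (S k)) 2). intros eps Heps. rewrite Rplus_0_l.
  destruct (H2_uniform b Hb eps ltac:(lra)) as [n0 Hn0].
  set (n := max n0 (S k)).
  set (p := fun j => if Nat.leb j n then b j else RtoC 0).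
  replace (b (S k)) with (p (S k)).
  2:{ unfold p. destruct (Nat.leb_spec (S k) n); [auto|unfold n in *; lia]. }
  apply coef_bound; [lra|].
  apply (Hb' (fun _ => True) 2 eps p n); try lra.
  - split; [|tauto]. intros j Hj. unfold p. destruct (Nat.leb_spec j n); [lia|auto].
  - intros s Hs. rewrite <- HF by lra.
    replace (dpoly p n (Some s)) with (csum (dterm b s) n); [apply Hn0; auto; unfold n; lia|].
    apply csum_ext; intros j Hj. unfold p, dterm, mono.
    destruct (Nat.leb_spec (S j) n); [auto|lia]. }
pose proof (Cmod_ge_0 (b (S k) - b' (S k))%C).
assert (E : (b (S k) - b' (S k))%C = RtoC 0) by (apply Cmod_eq_0; lra).
replace (b (S k)) with (b (S k) - b' (S k) + b' (S k))%C by ring. rewrite E; ring.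
Qed.

(* The bound [||C_phi||^2 >= ||k_{phi(s)}||^2 / ||k_s||^2] for truncated kernels [k], where only the
   powers of 2 matter in [k_s]; this makes every real [s > 0] admissible, and not just [s > 1/2]. *)
Lemma kernel_lower_bound al kap s0 N : 0 < al -> comp_bound (symbol 0 (ecoef al)) kap -> 0 < s0 ->
  zsum (2 * (al * ((1 - Rpower 2 (- s0)) / (1 + Rpower 2 (- s0))))) N <=
  kap ^ 2 * / (1 - Rpower 2 (- s0) ^ 2).
Proof.
intros Hal [Hk0 Hk] Hs0. set (z := Rpower 2 (- s0)).
assert (Hz : 0 < z < 1).
{ split; [apply Rpower_pos|]. apply Rlt_le_trans with (Rpower 2 0); [apply Rpower_lt; lra|].
  rewrite Rpower_O; lra. }
set (w := 1/2 + al * ((1 - z) / (1 + z))).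
assert (Ew : dsum (ecoef al) (RtoC s0) = RtoC w).
{ rewrite dsum_ecoef by auto. rewrite npow_real. replace (INR 2) with 2 by (simpl; ring). fold z.
  unfold emap, w. rewrite RtoC_plus, RtoC_mult, (RtoC_div (1 - z)), (RtoC_plus 1 z), RtoC_minus by lra. reflexivity. }
assert (Hw : 1/2 < w).
{ unfold w. assert (0 < al * ((1 - z) / (1 + z))) by (apply Rmult_lt_0_compat; auto; apply Rdiv_lt_0_compat; lra). lra. }
replace (2 * (al * ((1 - z) / (1 + z)))) with (2 * w - 1) by (unfold w; field; lra).
set (A := zsum (2 * w - 1) N).
(* Truncated reproducing kernel at [w]: its squared norm and its value at [w] are both [A]. *)
set (a := fun n => if Nat.leb n N then RtoC (Rpower (INR n) (- w)) else RtoC 0).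
assert (Ea : forall J, (N <= J)%nat -> rsum (fun k => Cmod (a (S k)) ^ 2) J = A).
{ intros J HJ. rewrite (rsum_stable _ N); auto.
  - apply rsum_ext; intros k Hk'. unfold a. destruct (Nat.leb_spec (S k) N); [|lia].
    rewrite Cmod_R, pow2_abs. simpl. rewrite Rmult_1_r, <- Rpower_plus. f_equal; ring.
  - intros k Hk'. unfold a. destruct (Nat.leb_spec (S k) N); [lia|]. rewrite Cmod_0; simpl; ring. }
destruct (ex_series_bounded (fun k => Cmod (a (S k)) ^ 2) A) as [HaH2 HaS].
{ intros; apply pow2_ge_0. }
{ intros n. rewrite <- (Ea (max n N)) by lia. apply rsum_incr; [intros; apply pow2_ge_0|lia]. }
assert (Hfin : forall u, dsum a u = csum (dterm a u) N).
{ intros u. apply dsum_limit. intros eps Heps. exists N; intros J HJ.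
  rewrite (csum_stable (dterm a u) N J HJ).
  - replace (csum (dterm a u) N - csum (dterm a u) N)%C with (RtoC 0) by ring. rewrite Cmod_0; lra.
  - intros k Hk'. unfold dterm, a. destruct (Nat.leb_spec (S k) N); [lia|ring]. }
destruct (Hk a HaH2) as (b & [HbH2 Hb] & Hbn).
assert (HAP := unif_approx_symbol power_of_2 (ecoef al) (fun eps => ecoef_cvu al eps Hal) (ecoef_support al)).
assert (HF := fun sig => unif_approx_comp_poly power_of_2 power_of_2_submonoid (ecoef al) HAP a N sig).
destruct (bohr_coef_exists power_of_2 _ HF) as (b' & Hb' & Hbs).
assert (Ebb : forall k, b (S k) = b' (S k)).
{ apply (H2_coefficients_unique (comp_poly (ecoef al) a N)); auto.
  intros s Hs. rewrite Hb by exact Hs. unfold comp_poly. rewrite <- Hfin. f_equal.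
  unfold symbol; simpl. ring. }
assert (EA : comp_poly (ecoef al) a N (Some (RtoC s0)) = RtoC A).
{ unfold comp_poly, ext_symbol. rewrite Ew. unfold A, zsum. rewrite <- csum_RtoC.
  apply csum_ext; intros k Hk'. unfold dterm, a. destruct (Nat.leb_spec (S k) N); [|lia].
  rewrite npow_real, <- RtoC_mult, <- Rpower_plus. do 2 f_equal; ring. }
assert (HB : forall J, rsum (fun k => Cmod (b' (S k)) ^ 2) J <= kap ^ 2 * A).
{ intros J. rewrite (rsum_ext _ (fun k => Cmod (b (S k)) ^ 2)) by (intros; rewrite Ebb; auto).
  eapply Rle_trans; [apply (rsum_le_Series (fun k => Cmod (b (S k)) ^ 2)); [intros; apply pow2_ge_0|exact HbH2]|].
  set (SB := Series (fun k => Cmod (b (S k)) ^ 2)).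
  set (SA := Series (fun k => Cmod (a (S k)) ^ 2)) in *.
  assert (PB : 0 <= SB) by (apply (rsum_le_Series (fun k => Cmod (b (S k)) ^ 2) 0); [intros; apply pow2_ge_0|exact HbH2]).
  assert (PA : 0 <= SA) by (apply (rsum_le_Series (fun k => Cmod (a (S k)) ^ 2) 0); [intros; apply pow2_ge_0|exact HaH2]).
  unfold H2norm in Hbn. fold SA SB in Hbn.
  rewrite <- (pow2_sqrt SB) by auto.
  apply Rle_trans with ((kap * sqrt SA) ^ 2); [apply pow_incr; split; [apply sqrt_pos|auto]|].
  rewrite Rpow_mult_distr, pow2_sqrt by auto. apply Rmult_le_compat_l; auto. apply pow2_ge_0. }
set (E := / (1 - z ^ 2)).
assert (Hz2 : 0 <= z ^ 2 < 1) by (simpl; nra).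
assert (HE : 0 < E) by (apply Rinv_0_lt_compat; lra).
assert (HA0 : 0 <= A) by (unfold A; apply (zsum_le _ 0); lia).
apply le_of_le_add_eps with (E + 2). intros eps Heps.
(* [kap] might be 0 a priori, and the AM-GM form of Cauchy-Schwarz requires a positive parameter. *)
set (k2 := kap ^ 2 + eps). assert (Hk2 : 0 < k2) by (unfold k2; pose proof (pow2_ge_0 kap); lra).
destruct (bohr_coef_partial_sums power_of_2 _ HF b' (RtoC s0) (s0 / 2) (fun k => sparse 0 (fun j => z ^ j) (S k)) (/ (1 - z)) Hb' Hbs)
  with (eps := eps) as [J HJ]; simpl Re; try lra.
{ intros k. unfold sparse. destruct (Nat.eqb _ _); [apply pow_le|]; lra. }
{ intros k Hk'. replace (2 * (s0 - s0 / 2)) with s0 by field. right. apply Rpower_pow2; auto. }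
{ intros J. apply sparse_geometric_le; lra. }
specialize (HJ J (le_n J)). rewrite EA in HJ.
(* With squared norm at most [k2 A], this gives [A <= (A + k2 E)/2 + eps], that is
   [A <= k2 E + 2 eps]; [E] is the sum of [4^(-j s0)]. *)
assert (W := weighted_cs (fun k => b' (S k)) (RtoC s0) 0 (fun k => sparse 0 (fun j => (z ^ 2) ^ j) (S k)) k2 J Hk2).
cbv beta in W.
assert (W' : Cmod (csum (dterm b' (RtoC s0)) J) <= / 2 * (A + k2 * E)).
{ eapply Rle_trans; [apply W|].
  - intros k. unfold sparse. destruct (Nat.eqb _ _); [apply pow_le|]; lra.
  - intros k. destruct (Classical_Prop.classic (power_of_2 (S k))) as [h|h]; [right|left; auto].
    simpl Re. rewrite Rminus_0_r, Rpower_pow2 by auto. right. unfold sparse.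
    destruct (Nat.eqb _ _); auto. f_equal. unfold z. simpl. rewrite Rmult_1_r, <- Rpower_plus. f_equal; ring.
  - apply Rmult_le_compat_l; [lra|]. apply Rplus_le_compat.
    + apply Rmult_le_reg_l with k2; auto. rewrite <- Rmult_assoc, Rinv_r, Rmult_1_l by lra.
      rewrite (rsum_ext _ (fun k => Cmod (b' (S k)) ^ 2)).
      * eapply Rle_trans; [apply HB|]. apply Rmult_le_compat_r; auto. unfold k2; lra.
      * intros k _. unfold wt. rewrite Rmult_0_r, Ropp_0, Rpower_O; [ring|pose proof (INR_ge1 k); lra].
    + apply Rmult_le_compat_l; [lra|]. apply sparse_geometric_le; auto. }
assert (X : A <= Cmod (csum (dterm b' (RtoC s0)) J) + eps).
{ rewrite <- (Rabs_pos_eq A) at 1 by auto. rewrite <- Cmod_R.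
  replace (RtoC A) with (csum (dterm b' (RtoC s0)) J + - (csum (dterm b' (RtoC s0)) J - RtoC A))%C at 1 by ring.
  eapply Rle_trans; [apply Cmod_triangle|]. rewrite Cmod_opp. lra. }
unfold k2 in *. lra.
Qed.

Lemma ecoef_lower_bound al kap : 0 < al -> comp_bound (symbol 0 (ecoef al)) kap -> sqrt (2 / al) <= kap.
Proof.
intros Hal Hk. assert (Hk0 : 0 <= kap) by apply Hk.
assert (M : 2 <= al * kap ^ 2).
{ apply le_of_le_add_eps with 2. intros eps Heps.
  (* [eps = 1] would mean [z = 0], which is not a value of [2^(-s)]; the claim is then trivial. *)
  destruct (Req_dec eps 1) as [->|Hne].
  { pose proof (pow2_ge_0 kap). nra. }
  set (z := 1 - eps). assert (Hz : 0 < z < 1) by (unfold z; lra).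
  assert (L2 : 0 < ln 2) by (pose proof ln_lt_2; lra).
  assert (Lz : ln z < 0) by (rewrite <- ln_1; apply ln_increasing; lra).
  set (s0 := - ln z / ln 2).
  assert (Hs0 : 0 < s0) by (apply Rdiv_lt_0_compat; lra).
  assert (Ez : Rpower 2 (- s0) = z).
  { unfold Rpower, s0. replace (- (- ln z / ln 2) * ln 2) with (ln z) by (field; lra). apply exp_ln; lra. }
  assert (K := fun N => kernel_lower_bound al kap s0 N Hal Hk Hs0). rewrite Ez in K.
  set (t := 2 * (al * ((1 - z) / (1 + z)))) in *.
  assert (Ht : 0 < t).
  { unfold t. apply Rmult_lt_0_compat; [lra|]. apply Rmult_lt_0_compat; auto. apply Rdiv_lt_0_compat; lra. }
  assert (Q : / t <= kap ^ 2 * / (1 - z ^ 2)).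
  { eapply Rle_trans; [apply zeta1_ge_inv; auto|].
    apply (is_lim_seq_le_eventually (zsum t) (fun _ => kap ^ 2 * / (1 - z ^ 2)));
      [exists 0%nat; intros; apply K|apply zsum_lim; auto|apply is_lim_seq_const]. }
  (* Both sides of [Q] blow up like [1/(1 - z)]; clearing this factor leaves an inequality whose
     limit at [z = 1] is [4 <= 2 al kap^2]. *)
  assert (Q' : (1 + z) ^ 2 <= 2 * (al * kap ^ 2)).
  { assert (D : 0 < 2 * al * (1 - z) * (1 + z)) by (repeat apply Rmult_lt_0_compat; lra).
    apply (Rmult_le_compat_l (2 * al * (1 - z) * (1 + z))) in Q; [|lra].
    replace (2 * al * (1 - z) * (1 + z) * / t) with ((1 + z) ^ 2) in Q by (unfold t; field; lra).
    replace (2 * al * (1 - z) * (1 + z) * (kap ^ 2 * / (1 - z ^ 2))) with (2 * (al * kap ^ 2)) in Q; auto.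
    field. nra. }
  unfold z in Q'. nra. }
rewrite <- (sqrt_pow2 kap) by auto. apply sqrt_le_1_alt.
apply Rmult_le_reg_l with al; auto. replace (al * (2 / al)) with 2 by (field; lra). auto.
Qed.

Lemma in_G_upper a0 c : a0 < 149/100 -> a0 * zeta1 a0 = 2 -> in_G 0 c -> 0 < Re (c 1%nat) - 1/2 <= a0 ->
  comp_bound (symbol 0 c) (sqrt (2 / (Re (c 1%nat) - 1/2))).
Proof.
intros Ha0 E Hc H. apply in_G_comp_bound; auto; [lra|]. intros m N Hm.
apply schur_bound; auto; [lra|]. intros M. apply (zsum_le_below_alpha0 a0); auto.
Qed.

Theorem corollary3 :
  exists alpha0 : R,
    unique (fun alpha : R =>
      0 < alpha /\ (RtoC alpha * zeta (RtoC (1 + alpha)))%C = RtoC 2) alpha0 /\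
    148 / 100 <= alpha0 < 149 / 100 /\
    (forall c : nat -> C,
       in_G 0 c ->
       0 < Re (c 1%nat) - 1/2 <= alpha0 ->
       Rbar_le (comp_norm (symbol 0 c))
               (Finite (sqrt (2 / (Re (c 1%nat) - 1/2))))) /\
    (forall x : R,
       0 < x <= alpha0 ->
       exists c : nat -> C,
         in_G 0 c /\ Re (c 1%nat) - 1/2 = x /\
         comp_norm (symbol 0 c) = Finite (sqrt (2 / (Re (c 1%nat) - 1/2)))).
Proof.
destruct alpha0_exists as (a0 & Ha0 & E). exists a0.
split; [|split; [exact Ha0|split]].
- split; [split; [lra|apply zeta_equation; [lra|auto]]|].
  intros b [Hb Eb]. apply zeta_equation in Eb; auto. apply alpha0_unique; auto; lra.
- intros c Hc H. destruct (Glb_Rbar_correct (comp_bound (symbol 0 c))) as [L _].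
  apply L. apply (in_G_upper a0); auto; lra.
- intros x Hx. exists (ecoef x).
  assert (E1 : Re (ecoef x 1) - 1/2 = x) by (rewrite ecoef_1; simpl; ring).
  assert (HG : in_G 0 (ecoef x)) by (apply ecoef_in_G; lra).
  split; [auto|split; [exact E1|]].
  apply is_glb_Rbar_unique. split.
  + intros kap Hk. rewrite E1. apply ecoef_lower_bound; auto; lra.
  + intros m Hm. apply Hm. apply (in_G_upper a0); auto; lra.
Qed.
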